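(* There exists a constant $c$ such that the TAR version of \textsc{Dominating Set Reconfiguration} is $\mathsf{PSPACE}$-complete, even when restricted to planar graphs of maximum degree $6$ and bandwidth at most $c$.
   Context: A dominating set of a graph $G=(V,E)$ is a set $D\subseteq V$ such that every vertex not in $D$ has a neighbor in $D$. TAR version of \textsc{Dominating Set Reconfiguration}: given $G$, dominating sets $D_s,D_g$ and an integer threshold $k$, is there a sequence of dominating sets $D_1=D_s,\dots,D_n=D_g$ such that each $D_{i+1}$ is obtained from $D_i$ by adding or removing one vertex and $|D_i|\le k$ for all $i$? The bandwidth of a graph $G=(V,E)$ is the minimum, over all bijections $f:V\to\{1,\dots,|V|\}$, of $\max_{\{u,v\}\in E}|f(u)-f(v)|$. *)

(* Defs.v *)
(* The real plane is Stdlib's R * R, with the topology given by Rstruct_topology. *)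
From Stdlib Require Import BinNums Rdefinitions.
From mathcomp Require Import all_boot all_order all_algebra.
From mathcomp Require Import classical_sets set_interval.
From mathcomp Require Import reals topology normedtype Rstruct Rstruct_topology.
Import numFieldNormedType.Exports.

Set Implicit Arguments.
Unset Strict Implicit.
Unset Printing Implicit Defensive.

Import Order.TTheory GRing.Theory Num.Theory.

Local Open Scope nat_scope.

Inductive move := MoveLeft | MoveStay | MoveRight.

(* Tape symbols: [None] is the blank, [Some (inl b)] an input/output bit,
   [Some (inr a)] one of the machine's own work symbols. *)
Definition sym (W : finType) : finType := option (bool + W)%type.

(* [trans q s = None] means that the machine halts. *)
Record tm := TM {
  ntapes : nat; (* the machine has [ntapes.+1] tapes *)
  state : finType;
  work : finType;
  start : state;
  accepting : pred state;
  trans : state -> {ffun 'I_ntapes.+1 -> sym work} ->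
    option (state * {ffun 'I_ntapes.+1 -> sym work * move})
}.

(* A two-way infinite tape: the cells left of the head (nearest first), the
   scanned cell, and the cells right of it (nearest first); every cell that is
   not listed is blank. *)
Record tape (W : finType) := Tape {
  tape_left : seq (sym W);
  tape_head : sym W;
  tape_right : seq (sym W)
}.

Section Tape.
Variable W : finType.
Implicit Types (t : tape W) (a : sym W).

Definition write a t : tape W := Tape (tape_left t) a (tape_right t).

Definition move_head (m : move) t : tape W :=
  let: Tape l a r := t in
  match m with
  | MoveLeft => Tape (behead l) (head None l) (a :: r)
  | MoveStay => t
  | MoveRight => Tape (a :: l) (head None r) (behead r)
  end.

Definition tape_of_bits (x : seq bool) : tape W :=
  let s := [seq Some (inl b) | b <- x] in
  Tape [::] (head None s) (behead s).

Fixpoint leading_bits (s : seq (sym W)) : seq bool :=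
  if s is Some (inl b) :: s' then b :: leading_bits s' else [::].

(* The output of a tape is read rightwards from its head, up to the first
   symbol that is not a bit. *)
Definition bits_of_tape t : seq bool :=
  leading_bits (tape_head t :: tape_right t).

(* The listed cells are those visited so far or holding the input. *)
Definition tape_space t : nat := (size (tape_left t) + size (tape_right t)).+1.

End Tape.

Section Run.
Variable M : tm.

Definition config : Type :=
  (state M * {ffun 'I_(ntapes M).+1 -> tape (work M)})%type.

Definition init (x : seq bool) : config :=
  (start M, [ffun i => tape_of_bits (work M) (if i == ord0 then x else [::])]).

Definition step (c : config) : option config :=
  if trans c.1 [ffun i => tape_head (c.2 i)] is Some (q, act) then
    Some (q, [ffun i => move_head (act i).2 (write (act i).1 (c.2 i))])
  else None.

Definition halted (c : config) : bool := ~~ isSome (step c).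

(* Configuration after [t] steps; a halted machine stays put. *)
Definition run (x : seq bool) (t : nat) : config :=
  iter t (fun c => odflt c (step c)) (init x).

Definition space_used (c : config) : nat := \sum_i tape_space (c.2 i).

Definition output (c : config) : seq bool := bits_of_tape (c.2 ord_max).

End Run.

Definition language := seq bool -> Prop.

(* "On [P]" means restricted to inputs satisfying [P]: nothing is required of
   the machine on other inputs, and reductions must produce inputs in [P].
   Without the suffix, every string is an input. *)

Definition pspace_on (P L : language) : Prop :=
  exists (M : tm) (p : {poly nat}), forall x, P x ->
    (forall t, space_used (run M x t) <= p.[size x]%R) /\
    (exists t, halted (run M x t) /\ (accepting (run M x t).1 <-> L x)).

Definition pspace (L : language) : Prop := pspace_on (fun _ => True) L.

Definition polytime_computable (f : seq bool -> seq bool) : Prop :=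
  exists (M : tm) (p : {poly nat}), forall x, exists t,
    [/\ t <= p.[size x]%R, halted (run M x t) & output (run M x t) = f x].

Definition pspace_hard_on (P L : language) : Prop :=
  forall L', pspace L' ->
    exists f, polytime_computable f /\
      forall x, P (f x) /\ (L' x <-> L (f x)).

Definition pspace_complete_on (P L : language) : Prop :=
  pspace_on P L /\ pspace_hard_on P L.

Definition pspace_complete (L : language) : Prop :=
  pspace_complete_on (fun _ => True) L.

(* A graph is given by a symmetric irreflexive relation; both properties are
   imposed on instances, in [dsr_instance]. *)

Section Graph.
Variables (T : finType) (adj : rel T).

Definition dominating (D : {set T}) : bool :=
  [forall v, (v \notin D) ==> [exists u, (u \in D) && adj u v]].

Definition max_degree : nat := \max_(v : T) #|[set w | adj v w]|.

Definition stretch (f : {ffun T -> 'I_#|T|}) : nat :=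
  \max_(uv : T * T | adj uv.1 uv.2) `|f uv.1 - f uv.2|%N.

(* Labels are 0, ..., |T|-1 instead of 1, ..., |T|; an injection of [T] into
   'I_#|T| is a bijection. *)
Definition bandwidth : nat :=
  stretch [arg min_(f < [ffun x => enum_rank x] | injectiveb f) stretch f].

Definition tar_step (D D' : {set T}) : bool :=
  [exists v, (v \notin D) && (D' == v |: D)]
  || [exists v, (v \in D) && (D' == D :\ v)].

Definition tar_reachable (k : int) (Ds Dg : {set T}) : Prop :=
  exists s : seq {set T},
    [/\ path tar_step Ds s, last Ds s = Dg
      & {in Ds :: s, forall D, dominating D /\ (#|D|%:Z <= k)%R}].

End Graph.

Section Planarity.
Local Open Scope ring_scope.

(* Drawing in the plane: vertex [u] is the point [p u]; edge uv is the arc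
   [g u v] on [0, 1] from [p u] to [p v], each edge being represented once, by
   its orientation from the smaller to the larger end. *)
Definition planar (n : nat) (adj : rel 'I_n) : Prop :=
  exists (p : 'I_n -> R * R) (g : 'I_n -> 'I_n -> R -> R * R),
    let edge (u v : 'I_n) := adj u v /\ (u < v)%N in
    [/\ injective p,
        (forall u v, edge u v ->
          [/\ {within `[0, 1], continuous (g u v)}%classic,
              {in `[0, 1] &, injective (g u v)},
              g u v 0 = p u & g u v 1 = p v]),
        (forall u v w (t : R), edge u v -> t \in `]0, 1[ -> g u v t <> p w)
      & (forall u v u' v' (s t : R), edge u v -> edge u' v' ->
          (u, v) <> (u', v') ->
          s \in `]0, 1[ -> t \in `]0, 1[ -> g u v s <> g u' v' t)].

End Planarity.

Record dsr_instance := DSRInstance {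
  nvertices : nat;
  adj : rel 'I_nvertices;
  adj_sym : symmetric adj;
  adj_irr : irreflexive adj;
  source : {set 'I_nvertices};
  target : {set 'I_nvertices};
  source_dom : dominating adj source;
  target_dom : dominating adj target;
  threshold : int
}.

Fixpoint bits_of_pos (p : positive) : seq bool :=
  match p with
  | xH => [:: true]
  | xO q => false :: bits_of_pos q
  | xI q => true :: bits_of_pos q
  end.

(* Binary, least significant bit first. *)
Definition bits_of_nat (m : nat) : seq bool :=
  if bin_of_nat m is Npos p then bits_of_pos p else [::].

(* The order in unary and a separator, the adjacency matrix row by row, the
   characteristic vectors of the two sets, the sign of the threshold and its
   absolute value in binary. *)
Definition encode (I : dsr_instance) : seq bool :=
  nseq (nvertices I) true ++ false ::
  [seq adj u v | u <- enum 'I_(nvertices I), v <- enum 'I_(nvertices I)] ++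
  [seq v \in source I | v <- enum 'I_(nvertices I)] ++
  [seq v \in target I | v <- enum 'I_(nvertices I)] ++
  (threshold I < 0)%R :: bits_of_nat `|threshold I|%N.

Definition encodings (C : dsr_instance -> Prop) : language :=
  fun x => exists I, x = encode I /\ C I.

Definition dsr_tar_yes (I : dsr_instance) : Prop :=
  tar_reachable (@adj I) (threshold I) (source I) (target I).

Definition DSR_TAR : language := encodings dsr_tar_yes.

(* Main.v *)
From HB Require Import structures.
From Stdlib Require Import Rdefinitions.
Require Import Defs.
From mathcomp Require Import classical_sets set_interval reals topology normedtype.
From mathcomp Require Import Rstruct Rstruct_topology.
From mathcomp Require Import all_boot all_order all_algebra boolp zify ring lra.

Set Implicit Arguments.
Unset Strict Implicit.
Unset Printing Implicit Defensive.

Local Open Scope nat_scope.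

(** Membership. With n vertices there are at most 2^n dominating sets, so a reconfiguration sequence
    can be shortened to at most 2^n steps ([savitchP]). Halving it repeatedly, with an existentially
    guessed midpoint and a universally chosen half, turns the question into a quantified Boolean
    formula with polynomially many variables ([qbf_savitch]), whose matrix is an easy test of the
    input and the chosen bits ([truth_matrix]). A depth-first evaluation of such a formula needs
    only polynomial space ([pspace_qbf]).

    Hardness. Let the machine M work in polynomial space and let N exceed the bound. A
    configuration, folded at the heads, is a word of N cells over a finite alphabet that depends on
    M only, and a computation step is a sequence of rewritings of two adjacent cells, steered by a
    single token. The rewriting is deterministic and the accepting word is stuck, so undirected
    reachability of that word is the same as acceptance ([accept_iff]). Doubling the cells and
    adding markers replaces the two-cell rules by changes of one letter at a time, subject to
    constraints between adjacent letters ([reach_rewrites]). Such words are laid out on a grid of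
    tiles, where a letter is a signal that travels up its column and then east into the block of the
    next position; the height of the grid depends on the number of letters only ([word_step_reach],
    [reach_word]). The grid is a set of clauses whose satisfying assignments change by flips.
    Finally every variable becomes a triangle and every clause a vertex joined to its literals. The
    threshold is one above the number of variables, so one variable at a time can change its
    literal, and dominating sets follow the flips ([reach_dominating], [dominating_reach]).

    A tile is drawn with straight edges in a square and meets its neighbours only at ports, so the
    graph is planar; numbering the vertices column by column bounds the bandwidth by a multiple of
    the height of the grid ([red_shape]). This bound depends on M. A single constant comes from
    reducing twice: every language in PSPACE reduces to dominating set reconfiguration, and this
    problem, being in PSPACE itself, is decided by one fixed machine, whose alphabet fixes the
    bandwidth of the second reduction.

    Turing machines are obtained by compilation: arithmetic terms become programs on stacks, and
    these become machines. The instance is periodic along the grid, so its bits are printed by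
    nested loops over finite tables ([red_printed]). *)

Definition upd (A : Type) (f : nat -> A) i a : nat -> A :=
  fun j => if j == i then a else f j.

Lemma updE (A : Type) (f : nat -> A) i a j :
  upd f i a j = if j == i then a else f j.
Proof. by []. Qed.

Lemma upd_same (A : Type) (f : nat -> A) i a : upd f i a i = a.
Proof. by rewrite updE eqxx. Qed.

Lemma upd_other (A : Type) (f : nat -> A) i a j : j != i -> upd f i a j = f j.
Proof. by rewrite updE => /negPf->. Qed.

Lemma upd_id (A : Type) (f : nat -> A) i a : f i = a -> upd f i a = f.
Proof. by move=> <-; apply/funext => j; rewrite updE; case: eqP => // ->. Qed.

Lemma upd_upd (A : Type) (f : nat -> A) i a b : upd (upd f i a) i b = upd f i b.
Proof. by apply/funext => j; rewrite !updE; case: eqP. Qed.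

Lemma updC (A : Type) (f : nat -> A) i j a b : i != j ->
  upd (upd f i a) j b = upd (upd f j b) i a.
Proof.
move=> ij; apply/funext => x; rewrite !updE.
by case: eqP => // ->; rewrite eq_sym (negPf ij).
Qed.

(** * Stack programs and their compilation to Turing machines *)

Definition stacks := nat -> seq bool.

(* [PushAt] is the second half of a push, once the head has made room. *)
Inductive cmd :=
  | Skip
  | Stop
  | Push of nat & bool
  | PushAt of nat & bool
  | Pop of nat
  | Seq of cmd & cmd
  | If of (option bool -> bool) & nat & cmd & cmd
  | While of (option bool -> bool) & nat & cmd.

HB.instance Definition _ := gen_eqMixin cmd.
HB.instance Definition _ := gen_choiceMixin cmd.

Declare Scope cmd_scope.
Delimit Scope cmd_scope with C.
Bind Scope cmd_scope with cmd.
Notation "c1 ;; c2" := (Seq c1 c2)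
  (at level 60, right associativity) : cmd_scope.

Section Evaluation.
Variable ok : pred nat.

(* [ev c s n s']: started on [s], [c] ends in [s'] after [n] machine steps,
   and no push makes a stack of a height outside [ok]. *)
Inductive ev : cmd -> stacks -> nat -> stacks -> Prop :=
  | EvSkip s : ev Skip s 1 s
  | EvPush i b s : ok (size (s i)).+1 -> ev (Push i b) s 2 (upd s i (b :: s i))
  | EvPop i s : ev (Pop i) s 1 (upd s i (behead (s i)))
  | EvSeq c1 c2 s n1 s1 n2 s2 :
      ev c1 s n1 s1 -> ev c2 s1 n2 s2 -> ev (c1 ;; c2)%C s (n1 + n2).+1 s2
  | EvIf (p : option bool -> bool) i c1 c2 s n s' :
      ev (if p (ohead (s i)) then c1 else c2) s n s' -> ev (If p i c1 c2) s n.+1 s'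
  | EvWhileT (p : option bool -> bool) i c s n1 s1 n2 s2 :
      p (ohead (s i)) -> ev c s n1 s1 -> ev (While p i c) s1 n2 s2 ->
      ev (While p i c) s (n1 + n2).+1 s2
  | EvWhileF (p : option bool -> bool) i c s : ~~ p (ohead (s i)) -> ev (While p i c) s 1 s.

End Evaluation.

Lemma ev_mono (ok ok' : pred nat) c s n s' :
  (forall m, ok m -> ok' m) -> ev ok c s n s' -> ev ok' c s n s'.
Proof.
move=> sub; elim=> {c s n s'}.
- by constructor.
- by move=> i b s okb; constructor; apply: sub.
- by constructor.
- by move=> *; econstructor; eauto.
- by move=> *; constructor.
- by move=> *; econstructor; eauto.
- by move=> *; constructor.
Qed.

(** Each push costs two steps and lengthens one stack by one bit, so time bounds height. A run can
    thus be found without any restriction ([predT]) and be given its space bound afterwards. *)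
Lemma ev_bounded c s n s' B :
  ev predT c s n s' -> (forall i, size (s i) <= B) ->
  ev (fun m => m <= B + n) c s n s' /\ (forall i, size (s' i) <= B + n).
Proof.
move=> H; elim: H B => {c s n s'}.
- by move=> s B sB; split; [constructor | move=> i; rewrite (leq_trans (sB i)) ?leq_addr].
- move=> i b s _ B sB; split=> [|j].
    by constructor; rewrite addn2 ltnW // !ltnS.
  by rewrite updE; case: (j =P i) => _ /=; have := sB i; have := sB j; lia.
- move=> i s B sB; split=> [|j]; first by constructor.
  by rewrite updE; case: (j =P i) => _ /=;
    rewrite ?size_behead; have := sB i; have := sB j; lia.
- move=> c1 c2 s n1 s1 n2 s2 _ IH1 _ IH2 B sB.
  have [H1 s1B] := IH1 _ sB; have [H2 s2B] := IH2 _ s1B; split.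
    by apply: (EvSeq (n1 := n1) (s1 := s1)); [apply: ev_mono H1 | apply: ev_mono H2];
      move=> m; lia.
  by move=> i; have := s2B i; lia.
- move=> p i c1 c2 s n s' _ IH B sB; have [H s'B] := IH _ sB; split.
    by constructor; apply: ev_mono H => m; lia.
  by move=> j; have := s'B j; lia.
- move=> p i c s n1 s1 n2 s2 pi _ IH1 _ IH2 B sB.
  have [H1 s1B] := IH1 _ sB; have [H2 s2B] := IH2 _ s1B; split.
    apply: (EvWhileT (n1 := n1) (s1 := s1)) => //.
      by apply: ev_mono H1 => m; lia.
    by apply: ev_mono H2 => m; lia.
  by move=> j; have := s2B j; lia.
- by move=> p i c s npi B sB; split; [constructor | move=> j; have := sB j; lia].
Qed.

Fixpoint max_stack (c : cmd) : nat :=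
  match c with
  | Skip | Stop => 0
  | Push i _ | PushAt i _ | Pop i => i
  | Seq c1 c2 => maxn (max_stack c1) (max_stack c2)
  | If _ i c1 c2 => maxn i (maxn (max_stack c1) (max_stack c2))
  | While _ i c => maxn i (max_stack c)
  end.

Lemma ev_untouched ok c s n s' j : ev ok c s n s' -> max_stack c < j -> s' j = s j.
Proof.
elim=> {c s n s'} //=.
- by move=> i b s _ lt; rewrite upd_other // gtn_eqF.
- by move=> i s lt; rewrite upd_other // gtn_eqF.
- by move=> c1 c2 s n1 s1 n2 s2 _ IH1 _ IH2; rewrite gtn_max => /andP[/IH1<- /IH2->].
- move=> p i c1 c2 s n s' _ IH; rewrite !gtn_max => /and3P[_ j1 j2].
  by apply: IH; case: ifP.
- move=> p i c s n1 s1 n2 s2 _ _ IH1 _ IH2 lt; rewrite IH2 // IH1 //.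
  by move: lt; rewrite gtn_max => /andP[].
Qed.

Section Compilation.
Variables (k : nat) (c0 : cmd).

Definition cont := seq cmd.

(** The continuations met while [c] runs with [K] still to come. They are finitely many even with
    loops, since the body of a loop returns to the loop itself, and they become the states of the
    machine. *)
Fixpoint conts (c : cmd) (K : cont) : seq cont :=
  (c :: K) :: match c with
  | Push i b => [:: PushAt i b :: K]
  | Seq c1 c2 => conts c1 (c2 :: K) ++ conts c2 K
  | If _ _ c1 c2 => conts c1 K ++ conts c2 K
  | While _ _ c1 => conts c1 (c :: K)
  | _ => [::]
  end.

Lemma conts_head c K : c :: K \in conts c K.
Proof. by case: c => *; rewrite inE eqxx. Qed.

Definition all_conts : seq cont := rcons (conts c0 [::]) [::].

(** A stack lies on its tape with the top under the head and the rest to its right. Hence a push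
    takes two steps, one to move left and one to write, and a pop erases and moves right; an empty
    stack is left alone by a pop. *)
Definition next_cont (K : cont) (tops : nat -> option bool) :
    option (cont * option (nat * option bool * move)) :=
  match K with
  | [::] | Stop :: _ => None
  | Skip :: K' => Some (K', None)
  | Push i b :: K' => Some (PushAt i b :: K', Some (i, tops i, MoveLeft))
  | PushAt i b :: K' => Some (K', Some (i, Some b, MoveStay))
  | Pop i :: K' =>
      Some (K', if tops i is Some _ then Some (i, None, MoveRight) else None)
  | Seq c1 c2 :: K' => Some (c1 :: c2 :: K', None)
  | If p i c1 c2 :: K' => Some ((if p (tops i) then c1 else c2) :: K', None)
  | While p i c :: K' => Some (if p (tops i) then c :: K else K', None)
  end.

Definition bit_of_sym (a : sym void) : option bool :=
  if a is Some (inl b) then Some b else None.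

Definition sym_of_bit (b : option bool) : sym void := omap inl b.

Lemma sym_of_bitK : cancel sym_of_bit bit_of_sym.
Proof. by case=> [[]|]. Qed.

Definition machine_state : finType := seq_sub all_conts.

Definition machine_trans (q : machine_state) (tops : {ffun 'I_k.+1 -> sym void}) :
    option (machine_state * {ffun 'I_k.+1 -> sym void * move}) :=
  if next_cont (ssval q) (fun i => bit_of_sym (tops (inord i))) is Some (K, a) then
    Some (insubd q K, [ffun i : 'I_k.+1 =>
      if a is Some (j, b, m) then
        if i == j :> nat then (sym_of_bit b, m) else (tops i, MoveStay)
      else (tops i, MoveStay)])
  else None.

Lemma start_contP : [:: c0] \in all_conts.
Proof. by rewrite mem_rcons inE conts_head orbT. Qed.

Definition machine : tm := {|
  ntapes := k;
  state := machine_state;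
  work := void;
  start := SeqSub start_contP;
  accepting := fun q => ssval q == [:: Stop];
  trans := machine_trans |}.

(** The [a] blanks on the left are cells vacated by pops, which later pushes reuse; they count
    against [B] because they stay listed. The trailing blank, at most one, is the cell on which the
    head rests when the stack is empty. *)
Definition holds_stack (B : nat) (l : seq bool) (t : tape void) : Prop :=
  exists a e, [/\ tape_left t = nseq a None,
    tape_head t :: tape_right t = [seq sym_of_bit (Some b) | b <- l] ++ nseq e None,
    a + size l <= B & e <= 1].

Definition holds B (s : stacks) (C : config machine) : Prop :=
  forall i : 'I_k.+1, holds_stack B (s i) (C.2 i).

Definition run_from (t : nat) (C : config machine) : config machine :=
  iter t (fun c => odflt c (step c)) C.

Arguments run_from : simpl never.

Lemma run_from_add t1 t2 C : run_from (t1 + t2) C = run_from t2 (run_from t1 C).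
Proof. by rewrite /run_from addnC iterD. Qed.

Lemma holds_top B s C (i : nat) : i < k.+1 -> holds B s C ->
  bit_of_sym (tape_head (C.2 (inord i))) = ohead (s i).
Proof.
move=> ik /(_ (inord i)); rewrite inordK // => -[a [e [_ + _ _]]].
by case: (s i) => [|b l] /=; case: e => [|e] //= [-> _].
Qed.

Lemma machine_step (C : config machine) K a s B :
  holds B s C -> max_stack (head Skip (ssval C.1)) <= k ->
  next_cont (ssval C.1) (fun i => ohead (s i)) = Some (K, a) -> K \in all_conts ->
  let C' := run_from 1 C in
  ssval C'.1 = K /\ forall i, C'.2 i =
    if a is Some (j, b, m) then
      if i == j :> nat then move_head m (write (sym_of_bit b) (C.2 i)) else C.2 i
    else C.2 i.
Proof.
move=> hC wf nx inK; rewrite /run_from /= /step /= /machine_trans.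
set nc := next_cont _ _.
have -> : nc = Some (K, a).
  rewrite -nx /nc; case: (ssval C.1) wf => [|[]] //= *; rewrite ?ffunE (holds_top _ hC) //;
  by rewrite ltnS; lia.
split=> [|i] /=.
  by rewrite /insubd insubT.
rewrite !ffunE; case: a {nx} => [[[j b] m]|]; last by rewrite /= ?ffunE; case: (C.2 i).
by case: eqP => _ //=; rewrite ?ffunE; case: (C.2 i).
Qed.

Lemma step_still B s (C : config machine) K :
  holds B s C -> max_stack (head Skip (ssval C.1)) <= k -> 
  next_cont (ssval C.1) (fun i => ohead (s i)) = Some (K, None) -> K \in all_conts ->
  ssval (run_from 1 C).1 = K /\ holds B s (run_from 1 C).
Proof.
move=> hC wf nx inK; have [-> eC] := machine_step hC wf nx inK.
by split=> // i; rewrite eC.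
Qed.

Lemma machine_ev B c s n s' : ev (fun m => m <= B) c s n s' ->
  forall K C, max_stack c <= k -> {subset conts c K <= all_conts} -> K \in all_conts ->
  ssval C.1 = c :: K -> holds B s C ->
  ssval (run_from n C).1 = K /\ holds B s' (run_from n C).
Proof.
elim=> {c s n s'}.
- move=> s K C wf sub inK eC hC.
  by apply: step_still; rewrite ?eC.
- move=> i b s okb K C wf sub inK eC hC.
  have inK' : PushAt i b :: K \in all_conts by apply: sub; rewrite !inE eqxx orbT.
  have [e1 h1] := @machine_step C (PushAt i b :: K) (Some (i, ohead (s i), MoveLeft)) s B
    hC ltac:(by rewrite eC) ltac:(by rewrite eC) inK'.
  set C1 := run_from 1 C in e1 h1 *.
  have -> : run_from 2 C = run_from 1 C1 by [].
  have top_i : forall j : 'I_k.+1, j = i :> nat -> sym_of_bit (ohead (s i)) = tape_head (C.2 j).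
    move=> j ji; have [a [e [_ + _ _]]] := hC j; rewrite ji.
    by case: (s i) => [|b' l] /=; case: e => [|e] //= [-> _].
  have nx : next_cont (ssval C1.1)
      (fun j => bit_of_sym (tape_head (C1.2 (inord j)))) = Some (K, Some (i, Some b, MoveStay)).
    by rewrite e1.
  have e2 : ssval (run_from 1 C1).1 = K /\ forall j, (run_from 1 C1).2 j =
      if j == i :> nat then write (sym_of_bit (Some b)) (C1.2 j) else C1.2 j.
    rewrite /run_from /= /step /= /machine_trans.
    set nc := next_cont _ _.
    have -> : nc = Some (K, Some (i, Some b, MoveStay)) by rewrite /nc e1.
    split=> [|j] /=; first by rewrite /insubd insubT.
    by rewrite !ffunE; case: eqP => // _ /=; rewrite ?ffunE; case: (C1.2 j).
  case: e2 => -> e2; split=> // j; rewrite e2 h1 updE; case: (altP (j =P i :> nat)) => [ji|_];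
    last exact: hC.
  have [a [e [+ eqr lea le1]]] := hC j; rewrite /holds_stack.
  move: (top_i j ji) eqr lea; rewrite ji; case: (C.2 j) => l h r /= eh eqr lea el.
  (* The push re-enters a vacated cell if there is one; otherwise the new height itself is at most
     [B] by [okb]. *)
  exists a.-1, e; rewrite el; split=> //=.
  + by case: (a).
  + congr (_ :: _); rewrite -eqr.
    by rewrite eh.
  + by move: okb lea; lia.
- move=> i s K C wf sub inK eC hC.
  case eo: (ohead (s i)) => [b|].
    have [-> e1] := @machine_step C K (Some (i, None, MoveRight)) s B hC
      ltac:(by rewrite eC) ltac:(by rewrite eC /= eo) inK.
    split=> // j; rewrite e1 updE; case: (altP (j =P i :> nat)) => [ji|_]; last exact: hC.
    have [a [e [+ + + le1]]] := hC j; rewrite /holds_stack.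
    rewrite ji; move: eo; case: (s i) => //= b' l _.
    case: (C.2 j) => tl h r /= -> [_ er] lea; exists a.+1.
    (* Popping the last bit puts the head on a blank, possibly on a cell that was not listed so
       far. *)
    exists (if l is [::] then 1 else e); split=> //=.
    + rewrite er; case: (l) => //=; case: e le1 {er} => [|[|]] //.
    + by move: lea; lia.
    + by case: (l).
  have [-> h1] := @step_still B s C K hC ltac:(by rewrite eC) ltac:(by rewrite eC /= eo) inK.
  split=> //; rewrite upd_id //.
  by case: (s i) eo.
- move=> c1 c2 s n1 s1 n2 s2 _ IH1 _ IH2 K C wf sub inK eC hC.
  have sub1 : {subset conts c1 (c2 :: K) <= all_conts}.
    by move=> x xin; apply: sub; rewrite /= inE mem_cat xin orbT.
  have sub2 : {subset conts c2 K <= all_conts}.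
    by move=> x xin; apply: sub; rewrite /= inE mem_cat xin !orbT.
  have [e1 h1] := @step_still B s C (c1 :: c2 :: K) hC ltac:(by rewrite eC)
    ltac:(by rewrite eC) (sub1 _ (conts_head _ _)).
  move: wf; rewrite /= geq_max => /andP[wf1 wf2].
  have [e2 h2] := IH1 _ _ wf1 sub1 (sub2 _ (conts_head _ _)) e1 h1.
  have [e3 h3] := IH2 _ _ wf2 sub2 inK e2 h2.
  by rewrite (run_from_add 1 (n1 + n2)) run_from_add.
- move=> p i c1 c2 s n s' _ IH K C wf sub inK eC hC.
  have sub' : {subset conts (if p (ohead (s i)) then c1 else c2) K <= all_conts}.
    by move=> x xin; apply: sub; rewrite /= inE mem_cat; case: ifP xin => _ ->; rewrite !orbT.
  have [e1 h1] := @step_still B s C _ hC ltac:(by rewrite eC)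
    ltac:(by rewrite eC) (sub' _ (conts_head _ _)).
  rewrite (run_from_add 1 n); apply: IH e1 h1 => //.
  by move: wf; rewrite /= !geq_max => /and3P[_ ? ?]; case: ifP.
- move=> p i c s n1 s1 n2 s2 pi _ IH1 _ IH2 K C wf sub inK eC hC.
  have sub' : {subset conts c (While p i c :: K) <= all_conts}.
    by move=> x xin; apply: sub; rewrite /= inE xin orbT.
  have [e1 h1] := @step_still B s C (c :: While p i c :: K) hC ltac:(by rewrite eC)
    ltac:(by rewrite eC /= pi) (sub' _ (conts_head _ _)).
  have wf' : max_stack c <= k by move: wf; rewrite /= geq_max => /andP[].
  have [e2 h2] := IH1 _ _ wf' sub' (sub _ (conts_head _ _)) e1 h1.
  have [e3 h3] := IH2 _ _ wf sub inK e2 h2.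
  by rewrite (run_from_add 1 (n1 + n2)) run_from_add.
- move=> p i c s npi K C wf sub inK eC hC.
  by apply: step_still; rewrite ?eC //= (negPf npi).
Qed.

Definition input_stacks (x : seq bool) : stacks := upd (fun=> [::]) 0 x.

Lemma holds_init B x : size x <= B -> holds B (input_stacks x) (init machine x).
Proof.
move=> xB i; rewrite /init ffunE /input_stacks updE -val_eqE /=.
set y := if _ then _ else _; have yB : size y <= B by rewrite /y; case: ifP.
exists 0, (nilp y); split=> //; last by case: (nilp y).
by case: (y) => [|b l] //=; rewrite cats0.
Qed.

Lemma holds_space B s C : holds B s C -> space_used C <= k.+1 * B.+1.
Proof.
move=> h; have -> : k.+1 * B.+1 = \sum_(i < k.+1) B.+1 by rewrite sum_nat_const card_ord.
apply: leq_sum => i _; have [a [e [el er lea le1]]] := h i.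
rewrite /tape_space el size_nseq.
have := congr1 size er; rewrite /= size_cat size_map size_nseq => esz.
by rewrite -addnS esz; lia.
Qed.

(** Listed cells stay listed, so the space at the halting time bounds the space at all earlier
    times. *)
Lemma space_step (M : tm) (C : config M) : space_used C <= space_used (odflt C (step C)).
Proof.
rewrite /step; case: trans => [[q act]|] //=.
apply: leq_sum => i _; rewrite ffunE /=.
case: (C.2 i) => l h r; case: (act i).2; rewrite /write /tape_space /=.
- by rewrite size_behead; lia.
- by [].
- by rewrite size_behead; lia.
Qed.

Lemma space_run_mono C t1 t2 : t1 <= t2 ->
  space_used (run_from t1 C) <= space_used (run_from t2 C).
Proof.
move/subnKC <-; elim: (t2 - t1) => [|d IH]; first by rewrite addn0.
by rewrite addnS /run_from iterS; apply: leq_trans IH (space_step _).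
Qed.

Lemma run_halted C t t' : step (run_from t C) = None -> t <= t' ->
  run_from t' C = run_from t C.
Proof.
move=> h /subnKC <-; elim: (t' - t) => [|d IH]; first by rewrite addn0.
by rewrite addnS {1}/run_from iterS -/(run_from _ _) IH h.
Qed.

End Compilation.

Lemma machine_halts k c C : ssval C.1 = [::] \/ ssval C.1 = [:: Stop] ->
  @step (machine k c) C = None.
Proof. by rewrite /step /= /machine_trans => -[]->. Qed.

Lemma init_conts c : {subset conts c [::] <= all_conts c}.
Proof. by move=> x xin; rewrite mem_rcons inE xin orbT. Qed.

Lemma nil_conts c : [::] \in all_conts c.
Proof. by rewrite mem_rcons inE eqxx. Qed.

Definition nonempty (o : option bool) := o != None.
Definition top_is (b : bool) (o : option bool) := o == Some b.

(** [Stop] has no rule in [ev]: the machine halts on it, and the continuation [[:: Stop]] is the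
    accepting state, while ordinary termination ends in [[::]]. *)
Definition decides (c : cmd) (r : nat) : cmd := c ;; If (top_is true) r Stop Skip.

Lemma pspace_program (c : cmd) (r : nat) (B : {poly nat}) (L : language) :
  (forall x : seq bool, size x <= B.[size x]%R) ->
  (forall x, exists n s, ev (fun m => m <= B.[size x]%R) c (input_stacks x) n s /\
                         (ohead (s r) == Some true <-> L x)) ->
  pspace L.
Proof.
move=> xB H.
set k := max_stack (decides c r).
exists (machine k (decides c r)), (k.+1%:P * (B + 1))%R => x _.
have [n [s [evc accE]]] := H x.
set C0 := init (machine k (decides c r)) x.
have h0 : holds B.[size x]%R (input_stacks x) C0 by exact: holds_init.
pose K1 := [:: c; If (top_is true) r Stop Skip].
pose If1 := If (top_is true) r Stop Skip.
have sub : {subset conts (decides c r) [::] <= all_conts (decides c r)} by exact: init_conts.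
have sub1 : {subset conts c [:: If1] <= all_conts (decides c r)}.
  by move=> y yin; apply: sub; rewrite /= inE mem_cat yin orbT.
have sub2 : {subset conts If1 [::] <= all_conts (decides c r)}.
  by move=> y yin; apply: sub; rewrite /= in yin *; rewrite inE mem_cat yin !orbT.
have [kc kr] : max_stack c <= k /\ r <= k.
  by rewrite /k /= !maxn0 leq_maxl leq_maxr.
have [e1 h1] := @step_still k (decides c r) _ _ C0 K1 h0 (leqnn _) erefl
  (sub1 _ (conts_head _ _)).
have [e2 h2] := machine_ev evc kc sub1 (sub2 _ (conts_head _ _)) e1 h1.
rewrite -run_from_add in e2 h2.
have [e3 h3] := @step_still k (decides c r) _ _ (run_from (1 + n) C0) 
  [:: if top_is true (ohead (s r)) then Stop else Skip] h2
  ltac:(by rewrite e2 /= !maxn0) ltac:(by rewrite e2)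
  ltac:(by apply: sub2; case: ifP => _; rewrite !inE eqxx ?orbT).
rewrite -run_from_add in e3 h3.
have runE t : run (machine k (decides c r)) x t = run_from t C0 by [].
have [T [hT haltT accT]] : exists T, [/\ holds B.[size x]%R s (run_from T C0),
    step (run_from T C0) = None
  & accepting (run_from T C0).1 = top_is true (ohead (s r))].
  case: ifP e3 => acc e3.
    exists (1 + n + 1); split=> //; first by apply: machine_halts; right.
    by rewrite /= e3 eqxx.
  have [e4 h4] := @step_still k (decides c r) _ _ _ [::] h3
    ltac:(by rewrite e3) ltac:(by rewrite e3) (nil_conts _).
  rewrite -run_from_add in e4 h4.
  exists (1 + n + 1 + 1); split=> //; first by apply: machine_halts; left.
  by rewrite /= e4.
split=> [t|].
  have -> : (k.+1%:P * (B + 1)).[size x]%R = k.+1 * B.[size x]%R.+1.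
    rewrite hornerM hornerC hornerD hornerE; move: (B.[_]%R) => b.
    by rewrite -[b.+1]addn1; reflexivity.
  rewrite runE; apply: leq_trans (holds_space hT).
  case: (leqP t T) => [le|lt]; first exact: space_run_mono.
  by rewrite (run_halted haltT (ltnW lt)).
exists T; rewrite /halted runE haltT; split=> //.
by rewrite accT.
Qed.

(** * Running times of basic programs and polynomial bounds *)

Definition runs (c : cmd) (s : stacks) (n : nat) (s' : stacks) : Prop :=
  exists2 n0, n0 <= n & ev predT c s n0 s'.

Lemma runs_seq c1 c2 s n1 s1 n2 s2 n :
  runs c1 s n1 s1 -> runs c2 s1 n2 s2 -> n1 + n2 < n -> runs (c1 ;; c2)%C s n s2.
Proof.
move=> [m1 le1 e1] [m2 le2 e2] lt; exists (m1 + m2).+1; first by lia.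
exact: EvSeq e1 e2.
Qed.

Lemma runs_le c s n n' s' : runs c s n s' -> n <= n' -> runs c s n' s'.
Proof. by move=> [m le e] le'; exists m => //; apply: leq_trans le'. Qed.

Lemma runs_skip s n : 0 < n -> runs Skip s n s.
Proof. by move=> lt; exists 1 => //; constructor. Qed.

Lemma runs_push s i b n : 1 < n -> runs (Push i b) s n (upd s i (b :: s i)).
Proof. by move=> lt; exists 2 => //; constructor. Qed.

Lemma runs_pop s i n : 0 < n -> runs (Pop i) s n (upd s i (behead (s i))).
Proof. by move=> lt; exists 1 => //; constructor. Qed.

Lemma runs_if (p : option bool -> bool) i c1 c2 s n s' :
  runs (if p (ohead (s i)) then c1 else c2) s n s' -> runs (If p i c1 c2) s n.+1 s'.
Proof. by move=> [m le e]; exists m.+1 => //; constructor. Qed.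

Lemma runs_while (p : option bool -> bool) i c s n1 s1 n2 s2 n :
  p (ohead (s i)) -> runs c s n1 s1 -> runs (While p i c) s1 n2 s2 ->
  n1 + n2 < n -> runs (While p i c) s n s2.
Proof.
move=> pi [m1 le1 e1] [m2 le2 e2] lt; exists (m1 + m2).+1; first by lia.
exact: EvWhileT e1 e2.
Qed.

Lemma runs_while_stop (p : option bool -> bool) i c s n :
  ~~ p (ohead (s i)) -> 0 < n -> runs (While p i c) s n s.
Proof. by move=> npi lt; exists 1 => //; constructor. Qed.

Definition loop i (body : cmd) : cmd := While nonempty i (Pop i ;; body).

(* [F m] is the state with [m] rounds to go. *)
Lemma runs_loop i body n v (F : nat -> stacks) :
  (forall m, m <= v -> F m i = nseq m true) ->
  (forall m, m < v -> runs body (upd (F m.+1) i (nseq m true)) n (F m)) ->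
  runs (loop i body) (F v) ((n + 3) * v + 1) (F 0).
Proof.
elim: v => [|v IH] Fi Fb.
  by apply: runs_while_stop; rewrite ?Fi // addn1.
apply: (runs_while (n1 := n + 2) (n2 := (n + 3) * v + 1) (s1 := F v)).
- by rewrite Fi.
- apply: (runs_seq (runs_pop _ _ (ltnSn 0)) (n2 := n) (s2 := F v)); last by lia.
  by rewrite Fi //=; apply: Fb.
- by apply: IH => m lt; [apply: Fi | apply: Fb]; lia.
- by lia.
Qed.

Definition foreach i (body : bool -> cmd) : cmd :=
  While nonempty i (If (top_is true) i (Pop i ;; body true) (Pop i ;; body false)).

(* In [F d l], [d] is the reversed list of the bits consumed so far and [l]
   is what is left. *)
Lemma runs_foreach i body n d l (F : seq bool -> seq bool -> stacks) :
  (forall d l, F d l i = l) ->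
  (forall d b l, runs (body b) (upd (F d (b :: l)) i l) n (F (b :: d) l)) ->
  runs (foreach i body) (F d l) ((n + 4) * size l + 1) (F (catrev l d) [::]).
Proof.
move=> Fi Fb; elim: l d => [|b l IH] d.
  by apply: runs_while_stop; rewrite ?Fi // addn1.
apply: (runs_while (n1 := n + 3) (n2 := (n + 4) * size l + 1) (s1 := F (b :: d) l)) => //=.
- by rewrite Fi.
- rewrite addn3; apply: runs_if; rewrite Fi /=.
  case: b; apply: (runs_seq (runs_pop _ _ (ltnSn 0)) (n2 := n) (s2 := F _ l));
    by rewrite ?Fi //=; lia.
- by lia.
Qed.

Ltac upds := apply/funext => ?; rewrite /upd;
  repeat (case: eqP => ?; subst => //=); try (exfalso; lia); auto.

Lemma runs_foreach0 i body n l (F : seq bool -> seq bool -> stacks) s s' :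
  (forall d l, F d l i = l) ->
  (forall d b l, runs (body b) (upd (F d (b :: l)) i l) n (F (b :: d) l)) ->
  s = F [::] l -> s' = F (rev l) [::] ->
  runs (foreach i body) s ((n + 4) * size l + 1) s'.
Proof. by move=> Fi Fb -> ->; apply: runs_foreach. Qed.

Definition transfer i j : cmd := foreach i (Push j).

Lemma runs_transfer i j s : i != j ->
  runs (transfer i j) s (6 * size (s i) + 1) (upd (upd s j (rev (s i) ++ s j)) i [::]).
Proof.
move=> ij; apply: (runs_foreach0 (n := 2) (F := fun d l => upd (upd s j (d ++ s j)) i l)).
- by move=> d l; rewrite upd_same.
- move=> d b l; rewrite /= upd_upd.
  have -> : upd (upd s j ((b :: d) ++ s j)) i l =
      upd (upd (upd s j (d ++ s j)) i l) j (b :: upd (upd s j (d ++ s j)) i l j).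
    by upds.
  exact: runs_push.
- by rewrite upd_id ?upd_id.
- by [].
Qed.

Definition transfer2 i j k : cmd := foreach i (fun b => Push j b ;; Push k b)%C.

Lemma runs_transfer2 i j k s : i != j -> i != k -> j != k ->
  runs (transfer2 i j k) s (9 * size (s i) + 1)
    (upd (upd (upd s j (rev (s i) ++ s j)) k (rev (s i) ++ s k)) i [::]).
Proof.
move=> ij ik jk; apply: (runs_foreach0 (n := 5)
  (F := fun d l => upd (upd (upd s j (d ++ s j)) k (d ++ s k)) i l)).
- by move=> d l; rewrite upd_same.
- move=> d b l /=.
  apply: runs_seq (runs_push _ _ _ (ltnSn 1)) _ (ltnSn 4).
  set t := upd _ j _; have -> : upd (upd (upd s j ((b :: d) ++ s j)) k ((b :: d) ++ s k)) i l =
      upd t k (b :: t k).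
    by rewrite /t; upds.
  exact: runs_push.
- by upds.
- by [].
Qed.

Definition count_into i j k : cmd := foreach i (fun b => Push j b ;; Push k true)%C.

Lemma runs_count_into i j k s : i != j -> i != k -> j != k ->
  runs (count_into i j k) s (9 * size (s i) + 1)
    (upd (upd (upd s j (rev (s i) ++ s j)) k (nseq (size (s i)) true ++ s k)) i [::]).
Proof.
move=> ij ik jk; apply: (runs_foreach0 (n := 5)
  (F := fun d l => upd (upd (upd s j (d ++ s j)) k (nseq (size d) true ++ s k)) i l)).
- by move=> d l; rewrite upd_same.
- move=> d b l /=.
  apply: runs_seq (runs_push _ _ _ (ltnSn 1)) _ (ltnSn 4).
  set t := upd _ j _; have -> : upd (upd (upd s j ((b :: d) ++ s j)) k
      (nseq (size (b :: d)) true ++ s k)) i l = upd t k (true :: t k).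
    by rewrite /t; upds.
  exact: runs_push.
- by upds.
- by rewrite size_rev.
Qed.

Definition copy i j k : cmd := transfer i k ;; transfer2 k i j.

Lemma runs_copy i j k s : i != j -> i != k -> j != k -> s k = [::] ->
  runs (copy i j k) s (15 * size (s i) + 3) (upd s j (s i ++ s j)).
Proof.
move=> ij ik jk sk; rewrite /copy.
apply: (runs_seq (runs_transfer _ ik) (n2 := 9 * size (s i) + 1)); last by lia.
set t := upd _ i _; have tk : t k = rev (s i).
  by rewrite /t upd_other 1?eq_sym // upd_same sk cats0.
have ki : k != i by rewrite eq_sym.
have kj : k != j by rewrite eq_sym.
have := @runs_transfer2 k i j t ki kj ij; rewrite tk size_rev revK.
by congr runs; rewrite /t; upds; rewrite ?cats0.
Qed.

Definition clear i : cmd := While nonempty i (Pop i).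

Lemma runs_clear i s : runs (clear i) s (2 * size (s i) + 1) (upd s i [::]).
Proof.
have [l e] : {l | s i = l} by exists (s i).
rewrite e; elim: l s e => [|b l IH] s e.
  by rewrite upd_id //; apply: runs_while_stop; rewrite ?e.
apply: (runs_while (n1 := 1) (n2 := 2 * size l + 1)); last by rewrite /=; lia.
- by rewrite e.
- exact: runs_pop.
- by have := IH (upd s i l); rewrite upd_same upd_upd e => /(_ erefl).
Qed.

(** One constant serves as summand and as exponent. The same shape later gives the number of cells
    of the simulated tape, which a term can compute from the input length. *)
Definition poly_bounded (f : nat -> nat) := exists c, forall m, f m <= (m + c) ^ c.

Lemma poly_bounded_le f g : (forall m, f m <= g m) -> poly_bounded g -> poly_bounded f.
Proof. by move=> le [c H]; exists c => m; apply: leq_trans (le m) (H m). Qed.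

Lemma poly_bounded_const a : poly_bounded (fun=> a).
Proof.
exists a.+1 => m; apply: (@leq_trans (m + a.+1)); first by lia.
by rewrite -{1}[m + _]expn1 leq_pexp2l // addnS.
Qed.

Lemma poly_bounded_id : poly_bounded id.
Proof. by exists 1 => m; rewrite expn1 leq_addr. Qed.

Lemma leq_expl e m n : m <= n -> m ^ e <= n ^ e.
Proof. by case: e => [|e] le //; rewrite leq_exp2r. Qed.

Lemma poly_bounded_mul f g : poly_bounded f -> poly_bounded g ->
  poly_bounded (fun m => f m * g m).
Proof.
move=> [a Ha] [b Hb]; exists (a + b) => m; rewrite expnD.
apply: leq_mul; [apply: leq_trans (Ha m) _ | apply: leq_trans (Hb m) _]; apply: leq_expl;
by lia.
Qed.

Lemma poly_bounded_add f g : poly_bounded f -> poly_bounded g ->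
  poly_bounded (fun m => f m + g m).
Proof.
have suc h : poly_bounded h -> poly_bounded (fun m => (h m).+1).
  case=> c H; exists c.+2 => m; apply: leq_ltn_trans (H m) _.
  have le : (m + c) ^ c <= (m + c.+2) ^ c by apply: leq_expl; lia.
  have gt0 : 0 < (m + c.+2) ^ c by rewrite expn_gt0; lia.
  by rewrite !expnS; nia.
move=> Hf Hg.
apply: (@poly_bounded_le _ (fun m => (f m).+1 * (g m).+1)) => [m|]; first by nia.
by apply: poly_bounded_mul; apply: suc.
Qed.

Lemma poly_bounded_S f : poly_bounded f -> poly_bounded (fun m => (f m).+1).
Proof.
move=> Hf; apply: (@poly_bounded_le _ (fun m => f m + 1)) => [m|]; first by rewrite addn1.
exact/poly_bounded_add/poly_bounded_const.
Qed.

Lemma poly_bounded_comp f g : poly_bounded f -> poly_bounded g ->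
  poly_bounded (fun m => f (g m)).
Proof.
move=> [a Ha] Hg; apply: (@poly_bounded_le _ (fun m => (g m + a) ^ a)) => [m|]; first exact: Ha.
have H : poly_bounded (fun m => g m + a) by exact/poly_bounded_add/poly_bounded_const.
suff aux e : poly_bounded (fun m => (g m + a) ^ e) by [].
elim: e => [|e IH].
  by apply: poly_bounded_le (poly_bounded_const 1) => m; rewrite expn0.
by apply: poly_bounded_le (poly_bounded_mul H IH) => m; rewrite expnS.
Qed.

Lemma poly_bounded_poly f : poly_bounded f ->
  exists p : {poly nat}, forall m, f m <= p.[m]%R.
Proof.
case=> c H; exists (('X + c%:P) ^+ c)%R => m.
by rewrite horner_exp hornerD hornerX hornerC.
Qed.

Lemma poly_bounded_horner (p : {poly nat}) : poly_bounded (fun m => p.[m]%R).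
Proof.
elim/poly_ind: p => [|p c IH].
  by apply: poly_bounded_le (poly_bounded_const 0) => m; rewrite horner0.
apply: poly_bounded_le (poly_bounded_add (poly_bounded_mul IH poly_bounded_id)
  (poly_bounded_const c)) => m.
by rewrite hornerD hornerC hornerMX.
Qed.

Ltac poly_bound := repeat first
  [ exact: poly_bounded_const | exact: poly_bounded_id | assumption
  | apply: poly_bounded_S | apply: poly_bounded_add | apply: poly_bounded_mul
  | apply: poly_bounded_horner
  | match goal with h : poly_bounded ?g |- poly_bounded (fun m => ?g _) =>
      apply: (poly_bounded_comp h) end ].

Lemma polytime_program (c : cmd) (o : nat) (f : seq bool -> seq bool) (T : nat -> nat) :
  poly_bounded T ->
  (forall x, exists2 s, runs c (input_stacks x) (T (size x)) s & s o = f x) ->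
  polytime_computable f.
Proof.
move=> polyT H.
set m := maxn (max_stack c) o.
(* The output is read from the last tape, so the result is moved to a fresh last stack; each
   transfer reverses it, hence two of them. They cost 6 steps per bit each, on at most [n + T n]
   bits. *)
pose c' := (c ;; transfer o m.+1 ;; transfer m.+1 m.+2)%C.
pose T' n := T n + 12 * (n + T n) + 5.
have [p pP] : exists p : {poly nat}, forall m, T' m <= p.[m]%R.
  by apply: poly_bounded_poly; rewrite /T'; poly_bound.
exists (machine m.+2 c'), p => x.
have [s [n0 n0T evc] so] := H x.
have [_ sB] := @ev_bounded _ _ _ _ (size x) evc
  (fun i => ltac:(by rewrite /input_stacks updE; case: ifP)).
have cm i : m < i -> s i = [::].
  move=> lt; rewrite (ev_untouched evc); last by rewrite /m in lt; lia.
  by rewrite /input_stacks upd_other //; case: i lt.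
have r1 := @runs_transfer o m.+1 s ltac:(by rewrite /m; lia).
set s1 := upd _ o _ in r1.
have r2 := @runs_transfer m.+1 m.+2 s1 ltac:(by lia).
set s2 := upd _ m.+1 _ in r2.
have s1m : s1 m.+1 = rev (f x).
  by rewrite /s1 upd_other ?upd_same ?so ?cm ?cats0 // /m; lia.
have s2m : s2 m.+2 = f x.
  rewrite /s2 upd_other ?upd_same; last by lia.
  by rewrite s1m revK /s1 !upd_other ?cm ?cats0 // /m; lia.
have rc : runs c (input_stacks x) n0 s by exists n0.
have [n nT evc'] : runs c' (input_stacks x) (T' (size x)) s2.
  apply: runs_seq rc (runs_seq r1 r2 (ltnSn _)) _.
  by rewrite s1m size_rev -so; have := sB o; rewrite /T'; lia.
have [evB _] := @ev_bounded _ _ _ _ (size x) evc'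
  (fun i => ltac:(by rewrite /input_stacks updE; case: ifP)).
set B := size x + n in evB.
have h0 : holds B (input_stacks x) (init (machine m.+2 c') x).
  by apply: holds_init; rewrite leq_addr.
have wf : max_stack c' <= m.+2 by rewrite /c' /= /m; lia.
have e0 : ssval (init (machine m.+2 c') x).1 = [:: c'] by [].
have [e1 h1] := machine_ev evB wf (@init_conts c') (nil_conts c') e0 h0.
exists n; split.
- exact: leq_trans nT (pP _).
- by rewrite /halted machine_halts //; left.
rewrite /output.
have [a [e [_ + _ _]]] := h1 ord_max; rewrite [X in s2 X]/= s2m /bits_of_tape => ->.
by elim: (f x) => [|b l IH] /=; [case: (e) | rewrite IH].
Qed.

(** * Bounded arithmetic terms and their compilation to programs *)

Notation unary n := (nseq n true).

(* [TFold cap n b] folds [b], in which variable 0 is the index and variable 1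
   the accumulator, over the indices below [n], the largest first; the
   accumulator starts at 0 and is cut at [cap] in every round, which keeps all
   values polynomial. [TLen r] and [TBit r t] read the bit string on stack [r]. *)
Inductive term :=
  | TVar of nat
  | TConst of nat
  | TAdd of term & term
  | TSub of term & term
  | TMul of term & term
  | TLen of nat
  | TBit of nat & term
  | TFold of term & term & term.

Fixpoint den (S : stacks) (env : seq nat) (t : term) : nat :=
  match t with
  | TVar i => nth 0 env i
  | TConst c => c
  | TAdd t1 t2 => den S env t1 + den S env t2
  | TSub t1 t2 => den S env t1 - den S env t2
  | TMul t1 t2 => den S env t1 * den S env t2
  | TLen r => size (S r)
  | TBit r t1 => nth false (S r) (den S env t1)
  | TFold cap n b =>
      foldr (fun i acc => minn (den S env cap) (den S (i :: acc :: env) b)) 0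
        (iota 0 (den S env n))
  end.

Fixpoint term_ok (D k : nat) (t : term) : bool :=
  match t with
  | TVar i => i < k
  | TConst _ => true
  | TAdd t1 t2 | TSub t1 t2 | TMul t1 t2 => term_ok D k t1 && term_ok D k t2
  | TLen r => r < D
  | TBit r t1 => (r < D) && term_ok D k t1
  | TFold cap n b => [&& term_ok D k cap, term_ok D k n & term_ok D k.+2 b]
  end.

Definition move_bit i j : cmd :=
  If nonempty i (If (top_is true) i (Pop i ;; Push j true) (Pop i ;; Push j false)) Skip.

(* Leaves the unary value of the term on stack [d]; the variables are on the
   stacks listed in [rho], and the stacks above [d] serve as scratch space. *)
Fixpoint compile (t : term) (rho : seq nat) (d : nat) : cmd :=
  match t with
  | TVar i => copy (nth 0 rho i) d d.+1
  | TConst c => iter c (fun p => p ;; Push d true) Skip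
  | TAdd t1 t2 => compile t1 rho d ;; compile t2 rho d.+1 ;; transfer d.+1 d
  | TSub t1 t2 => compile t1 rho d ;; compile t2 rho d.+1 ;; loop d.+1 (Pop d)
  | TMul t1 t2 =>
      compile t1 rho d ;; compile t2 rho d.+1 ;; loop d.+1 (copy d d.+2 d.+3) ;;
      clear d ;; transfer d.+2 d
  | TLen r => transfer r d.+1 ;; count_into d.+1 r d
  | TBit r t1 =>
      compile t1 rho d ;; loop d (move_bit r d.+1) ;;
      If (top_is true) r (Push d true) Skip ;; transfer d.+1 r
  | TFold cap n b =>
      compile n rho d.+1 ;;
      loop d.+1 (compile b [:: d.+1, d & rho] d.+2 ;; clear d ;;
        compile cap rho d.+3 ;;
        loop d.+2 (If nonempty d.+3 (Pop d.+3 ;; Push d true) Skip) ;; clear d.+3)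
  end%C.

(** The registers below [D] hold the strings that terms may read. [M] bounds their lengths and the
    values of all variables, so that costs can be stated as functions of [M] alone. *)
Record layout (D M : nat) (S : stacks) (env rho : seq nat) (d : nat) (s : stacks) : Prop := {
  layout_reg : forall r, r < D -> s r = S r;
  layout_regM : forall r, r < D -> size (S r) <= M;
  layout_le : D <= d;
  layout_size : size rho = size env;
  layout_rho : forall i, i < size env -> nth 0 rho i < d;
  layout_var : forall i, i < size env -> s (nth 0 rho i) = unary (nth 0 env i);
  layout_envM : forall i, i < size env -> nth 0 env i <= M;
  layout_free : forall i, d <= i -> s i = [::] }.

Lemma layout_push D M S env rho d s l :
  layout D M S env rho d s -> layout D M S env rho d.+1 (upd s d l).
Proof.
case=> reg regM le sz rd var eM free; split=> //; first by move=> r lt; rewrite upd_other ?reg //; lia.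
- by lia.
- by move=> i lt; have := rd i lt; lia.
- by move=> i lt; rewrite upd_other ?var //; have := rd i lt; lia.
- by move=> i lt; rewrite upd_other ?free //; lia.
Qed.

Lemma layout_bind D M S env rho d s v : v <= M ->
  layout D M S env rho d s -> layout D M S (v :: env) (d :: rho) d.+1 (upd s d (unary v)).
Proof.
move=> vM [reg regM le sz rd var eM free]; split=> //.
- by move=> r lt; rewrite upd_other ?reg //; lia.
- by lia.
- by rewrite /= sz.
- by move=> [|i] //= lt; have := rd i lt; lia.
- move=> [|i] /= lt; first by rewrite upd_same.
  by rewrite upd_other ?var //; have := rd i lt; lia.
- by move=> [|i] //= lt; apply: eM.
- by move=> i lt; rewrite upd_other ?free //; lia.
Qed.

Lemma layout_mono D M M' S env rho d s :
  M <= M' -> layout D M S env rho d s -> layout D M' S env rho d s.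
Proof.
move=> le [reg regM lD sz rd var eM free]; split=> //.
- by move=> r lt; apply: leq_trans le; apply: regM.
- by move=> i lt; apply: leq_trans le; apply: eM.
Qed.

Lemma runs_eq c s n n' s' s'' :
  runs c s n s' -> s' = s'' -> n <= n' -> runs c s n' s''.
Proof. by move=> r <-; apply: runs_le. Qed.

Lemma runs_from_eq c s t n s' : runs c s n s' -> s = t -> runs c t n s'.
Proof. by move=> r <-. Qed.

Ltac cells L := rewrite /upd;
  repeat (case: eqP => ?; subst => //=); try (exfalso; lia);
  repeat match type of L with layout _ _ _ _ _ _ ?s =>
    match goal with |- context [s ?i] =>
      rewrite (@layout_free _ _ _ _ _ _ _ L i); [ | by lia] end end;
  rewrite ?cats0 ?rev_nseq ?size_nseq ?revK -?nseqD //; try lia; auto.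

Ltac states L := apply/funext => ?; cells L.

Ltac then_run H := eapply runs_seq; [eapply H | | refine (ltnSn _)].

Section Compile.
Variable D : nat.

(** One function bounds both value and time; values are in unary, so the value of a subterm also
    bounds the cost of processing it. *)
Definition computes (f : nat -> nat) (t : term) : Prop :=
  forall M S env rho d s, term_ok D (size env) t -> layout D M S env rho d s ->
  den S env t <= f M /\
  runs (compile t rho d) s (f M) (upd s d (unary (den S env t))).

Lemma computes_add f1 f2 t1 t2 : computes f1 t1 -> computes f2 t2 ->
  computes (fun M => f1 M + 7 * f2 M + 3) (TAdd t1 t2).
Proof.
move=> c1 c2 M S env rho d s /= /andP[ok1 ok2] L.
have [v1 r1] := c1 _ _ _ _ _ _ ok1 L.
have [v2 r2] := c2 _ _ _ _ _ _ ok2 (layout_push (unary (den S env t1)) L).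
split; first by lia.
apply: runs_eq (runs_seq r1 (runs_seq r2 (runs_transfer _ _) (ltnSn _)) (ltnSn _)) _ _.
- by lia.
- by states L; rewrite addnC.
- by rewrite upd_same size_nseq; lia.
Qed.

Lemma computes_sub f1 f2 t1 t2 : computes f1 t1 -> computes f2 t2 ->
  computes (fun M => f1 M + 5 * f2 M + 3) (TSub t1 t2).
Proof.
move=> c1 c2 M S env rho d s /= /andP[ok1 ok2] L.
have [v1 r1] := c1 _ _ _ _ _ _ ok1 L.
have [v2 r2] := c2 _ _ _ _ _ _ ok2 (layout_push (unary (den S env t1)) L).
set n1 := den S env t1 in v1 r1 r2 *; set n2 := den S env t2 in v2 r2 *.
split; first by lia.
eapply runs_eq.
- then_run r1; then_run r2.
  apply: runs_from_eq (@runs_loop d.+1 (Pop d) 1 n2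
    (fun m => upd (upd s d (unary (n1 - (n2 - m)))) d.+1 (unary m)) _ _) _.
  + by move=> m _; rewrite upd_same.
  + move=> m lt /=; apply: runs_eq (runs_pop _ _ (ltnSn 0)) _ (leqnn _); states L.
    have -> : n1 - (n2 - m) = (n1 - (n2 - m.+1)).-1 by lia.
    by case: (_ - _).
  + by states L; rewrite subnn subn0.
- by states L; rewrite subn0.
- by lia.
Qed.

Lemma computes_mul f1 f2 t1 t2 : computes f1 t1 -> computes f2 t2 ->
  computes (fun M => f1 M + f2 M * (15 * f1 M + 6) + 6 * (f1 M * f2 M) + 2 * f1 M + f2 M + 10) (TMul t1 t2).
Proof.
move=> c1 c2 M S env rho d s /= /andP[ok1 ok2] L.
have [v1 r1] := c1 _ _ _ _ _ _ ok1 L.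
have [v2 r2] := c2 _ _ _ _ _ _ ok2 (layout_push (unary (den S env t1)) L).
set n1 := den S env t1 in v1 r1 r2 *; set n2 := den S env t2 in v2 r2 *.
have v12 : n1 * n2 <= f1 M * f2 M by apply: leq_mul.
split; first by lia.
eapply runs_eq.
- then_run r1; then_run r2.
  eapply runs_seq; [ | | refine (ltnSn _)].
    apply: runs_from_eq (@runs_loop d.+1 (copy d d.+2 d.+3) (15 * n1 + 3) n2
      (fun m => upd (upd (upd s d (unary n1)) d.+1 (unary m)) d.+2 (unary ((n2 - m) * n1)))
      _ _) _.
    + by move=> m _; cells L.
    + move=> m lt /=; apply: runs_eq (runs_copy _ _ _ _) _ _; try lia.
      * by cells L.
      * by states L; congr nseq; nia.
      * by rewrite /upd; repeat case: eqP => ?; try lia; rewrite size_nseq.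
    + by states L; rewrite subnn.
  then_run runs_clear; apply: runs_transfer; lia.
- by states L; rewrite subn0 mulnC.
- by rewrite /upd; repeat (case: eqP => ?; try (exfalso; lia)); rewrite !size_nseq; nia.
Qed.

Lemma computes_const c : computes (fun=> 3 * c + 1) (TConst c).
Proof.
move=> M S env rho d s _ L /=; split; first by lia.
elim: c => [|c IH] /=; first by rewrite upd_id ?(layout_free L) //; apply: runs_skip.
eapply runs_eq; first by then_run IH; apply: runs_push (ltnSn _).
- by states L.
- by lia.
Qed.

Lemma computes_var i : computes (fun M => 15 * M + 3) (TVar i).
Proof.
move=> M S env rho d s /= ik L; have eM := layout_envM L ik; split; first by lia.
have lt := layout_rho L ik.
apply: runs_eq (runs_copy _ _ _ _) _ _; try lia.
- by rewrite (layout_free L).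
- by rewrite (layout_var L) //; states L.
- by rewrite (layout_var L) // size_nseq; lia.
Qed.

Lemma computes_len r : computes (fun M => 15 * M + 3) (TLen r).
Proof.
move=> M S env rho d s /= rD L; have rM := layout_regM L rD; split; first by lia.
have le := layout_le L; have er := layout_reg L rD.
eapply runs_eq.
- then_run runs_transfer; first by lia.
  by apply: runs_count_into; lia.
- by rewrite er; states L; rewrite ?size_rev ?er.
- by cells L; rewrite ?size_rev er; lia.
Qed.

Lemma runs_move_bit i j s : i != j ->
  runs (move_bit i j) s 6 (if s i is b :: l then upd (upd s j (b :: s j)) i l else s).
Proof.
move=> ij; apply: runs_if; case e: (s i) => [|b l] /=; first exact: runs_skip.
apply: runs_if; rewrite e; case: b e => e /=.
all: eapply runs_eq; [by then_run (@runs_pop s i 1 isT); apply: runs_push (ltnSn _) | | by []].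
all: by rewrite e /=; upds.
Qed.

Lemma computes_bit f r t : computes f t ->
  computes (fun M => 10 * f M + 6 * M + 20) (TBit r t).
Proof.
move=> ct M S env rho d s /= /andP[rD ok] L; have [v1 r1] := ct _ _ _ _ _ _ ok L.
set n := den S env t in v1 r1 *; split; first by case: nth; lia.
have le := layout_le L; have er := layout_reg L rD; have rM := layout_regM L rD.
eapply runs_eq.
- then_run r1.
  eapply runs_seq; [ | | refine (ltnSn _)].
    apply: runs_from_eq (@runs_loop d (move_bit r d.+1) 6 n
      (fun m => upd (upd (upd s d (unary m)) r (drop (n - m) (S r))) d.+1
        (rev (take (n - m) (S r)))) _ _) _.
    + by move=> m _; cells L.
    + move=> m lt /=; apply: runs_eq (runs_move_bit _ _) _ (leqnn _); first by lia.
      have -> : n - m = (n - m.+1).+1 by lia.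
      set t1 := upd _ d _.
      have tr : t1 r = drop (n - m.+1) (S r) by rewrite /t1; cells L.
      have tj : t1 d.+1 = rev (take (n - m.+1) (S r)) by rewrite /t1; cells L.
      rewrite tr tj /t1; case: (ltnP (n - m.+1) (size (S r))) => sz.
        by rewrite (drop_nth false sz) (take_nth false sz) rev_rcons; states L.
      rewrite !drop_oversize ?take_oversize //; try lia; by states L.
    + by states L; rewrite subnn ?drop0 ?take0.
  rewrite subn0; set t2 := upd _ d.+1 _.
  have rI : runs (If (top_is true) r (Push d true) Skip) t2 3
      (upd t2 d (unary (nth false (S r) n))).
    apply: runs_if; have -> : t2 r = drop n (S r) by rewrite /t2; cells L.
    have td : t2 d = [::] by rewrite /t2; cells L.
    case: (ltnP n (size (S r))) => sz.
      rewrite (drop_nth false sz) /=; case: (nth _ _ _) => /=.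
        by apply: runs_eq (runs_push _ _ _ (ltnSn _)) _ (leqnn _); rewrite td.
      by apply: runs_eq (runs_skip _ (ltnSn _)) _ _ => //; rewrite upd_id.
    rewrite drop_oversize // nth_default // upd_id //.
    exact: runs_skip.
  move: rI; rewrite {}/t2 => rI.
  by then_run rI; apply: runs_transfer; lia.
- by states L; rewrite cat_take_drop.
- by cells L; rewrite size_rev size_take; case: ifP; lia.
Qed.

(** The cut in a fold: each unit of [z] is paid for with a unit of the cap [c], and is lost once the
    cap is used up. *)
Lemma runs_min_loop d s z c : s d = [::] -> s d.+2 = unary z -> s d.+3 = unary c ->
  runs (loop d.+2 (If nonempty d.+3 (Pop d.+3 ;; Push d true) Skip) ;; clear d.+3) s
    (8 * z + 2 * c + 3) (upd (upd (upd s d (unary (minn c z))) d.+2 [::]) d.+3 [::]).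
Proof.
move=> s0 s2 s3; eapply runs_eq.
- eapply runs_seq; [ | exact: runs_clear | refine (ltnSn _)].
  apply: runs_from_eq (@runs_loop d.+2 _ 5 z (fun m => upd (upd (upd s d
    (unary (minn c (z - m)))) d.+2 (unary m)) d.+3 (unary (c - (z - m)))) _ _) _.
  + by move=> m _; rewrite /upd; repeat case: eqP => ?; try lia.
  + move=> m lt /=; apply: runs_if.
    set t := upd _ d.+2 _; have t3 : t d.+3 = unary (c - (z - m.+1)).
      by rewrite /t /upd; repeat (case: eqP => ?; try (exfalso; lia)).
    rewrite t3; case: (leqP c (z - m.+1)) => le.
      have -> : c - (z - m.+1) = 0 by lia.
      apply: runs_eq (runs_skip _ (ltn0Sn 3)) _ _ => //.
      by rewrite /t; upds; congr nseq; lia.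
    have e : c - (z - m.+1) = (c - (z - m)).+1 by lia.
    rewrite e; eapply runs_eq; [by then_run (@runs_pop t d.+3 1 isT); apply: runs_push (ltnSn _) | | by []].
    rewrite t3 e /t; upds.
    have -> : minn c (z - m) = (minn c (z - m.+1)).+1 by lia.
    by [].
  + by upds; rewrite ?s0 ?s2 ?s3 ?subnn ?minn0 ?subn0 //; congr nseq; lia.
- by upds; rewrite subn0.
- rewrite upd_same size_nseq; lia.
Qed.

(** Because of the cap, index and accumulator stay below [M + fn M + fc M] in every round, so the
    cost of the body is bounded uniformly and iterating it does not iterate its growth. *)
Lemma computes_fold fc fn fb cap n b : computes fc cap -> computes fn n -> computes fb b ->
  computes (fun M => let B := fb (M + fn M + fc M) in
    fn M + (9 * B + 5 * fc M + 20) * fn M + fc M + 10) (TFold cap n b).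
Proof.
move=> cc cn cb M S env rho d s /= /and3P[okc okn okb] L.
have [vn rn] := cn _ _ _ _ _ _ okn (layout_push [::] L).
have [vc _] := cc _ _ _ _ _ _ okc L.
set v := den S env n in vn rn *; set c := den S env cap in vc *.
set M' := M + fn M + fc M; set B := fb M'.
pose g i acc := minn c (den S (i :: acc :: env) b).
rewrite -/g; pose acc m := foldr g 0 (iota m (v - m)).
have acc_c m : acc m <= c by rewrite /acc; case: (iota _ _) => //= *; apply: geq_minl.
have acc_step m : m < v -> acc m = g m (acc m.+1).
  by move=> lt; rewrite /acc (_ : v - m = (v - m.+1).+1) //; lia.
have -> : foldr g 0 (iota 0 v) = acc 0 by rewrite /acc subn0.
split; first by have := acc_c 0; lia.
have sd : upd s d [::] = s by rewrite upd_id // (layout_free L).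
rewrite sd in rn.
eapply runs_eq.
- then_run rn.
  apply: runs_from_eq (@runs_loop d.+1 _ (9 * B + 5 * fc M + 17) v
    (fun m => upd (upd s d (unary (acc m))) d.+1 (unary m)) _ _) _.
  + by move=> m _; cells L.
  + move=> m lt /=; rewrite upd_upd.
    set s1 := upd _ d.+1 _.
    have am : acc m.+1 <= M' by have := acc_c m.+1; rewrite /M'; lia.
    have mM : m <= M' by rewrite /M'; lia.
    have L1 : layout D M' S [:: m, acc m.+1 & env] [:: d.+1, d & rho] d.+2 s1.
      apply: layout_bind => //; apply: layout_bind => //.
      by apply: layout_mono L; rewrite /M'; lia.
    have [vb rb] := cb M' S [:: m, acc m.+1 & env] _ _ _ okb L1; rewrite -/B in vb rb.
    set z := den S _ b in vb rb.
    have L2 : layout D M S env rho d.+3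
        (upd (upd (upd s d [::]) d.+1 (unary m)) d.+2 (unary z)).
      by do !apply: layout_push.
    have [_ rc] := cc _ _ _ _ _ _ okc L2; rewrite -/c in rc.
    eapply runs_eq.
    * then_run rb; eapply runs_seq; [ | | refine (ltnSn _)].
        apply: runs_eq (runs_clear d _) (_ : _ = upd (upd (upd s d [::]) d.+1 (unary m)) d.+2 (unary z)) (leqnn _).
        by rewrite /s1; upds.
      by then_run rc; apply: (@runs_min_loop d _ z c); cells L.
    * rewrite acc_step // -/(g m (acc m.+1)) /g -/z; states L.
    * rewrite /s1 /upd; repeat (case: eqP => ?; try (exfalso; lia)); rewrite size_nseq.
      by have := acc_c m.+1; lia.
  + by states L; rewrite /acc subnn.
- by states L.
- by rewrite /= -/M' -/B; nia.
Qed.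

Theorem compile_correct t : exists2 f, poly_bounded f & computes f t.
Proof.
elim: t => [i|c|t1 [f1 p1 c1] t2 [f2 p2 c2]|t1 [f1 p1 c1] t2 [f2 p2 c2]
  |t1 [f1 p1 c1] t2 [f2 p2 c2]|r|r t [f p c]|cap [fc pc cc] n [fn pn cn] b [fb pb cb]].
- by exists (fun M => 15 * M + 3); [poly_bound | exact: computes_var].
- by exists (fun=> 3 * c + 1); [poly_bound | exact: computes_const].
- by eexists; [ | exact: computes_add c1 c2]; poly_bound.
- by eexists; [ | exact: computes_sub c1 c2]; poly_bound.
- by eexists; [ | exact: computes_mul c1 c2]; poly_bound.
- by exists (fun M => 15 * M + 3); [poly_bound | exact: computes_len].
- by eexists; [ | exact: computes_bit c]; poly_bound.
- by eexists; [ | exact: computes_fold cc cn cb]; rewrite /=; poly_bound.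
Qed.
End Compile.

(** * Programs that print bit strings *)

Inductive out :=
  | OEmit of term
  | OSeq of out & out
  | OFor of term & out.

Fixpoint emitted (S : stacks) (env : seq nat) (o : out) : seq bool :=
  match o with
  | OEmit t => [:: 0 < den S env t]
  | OSeq o1 o2 => emitted S env o1 ++ emitted S env o2
  | OFor n o1 => flatten [seq emitted S (i :: env) o1 | i <- iota 0 (den S env n)]
  end.

Fixpoint out_ok (D k : nat) (o : out) : bool :=
  match o with
  | OEmit t => term_ok D k t
  | OSeq o1 o2 => out_ok D k o1 && out_ok D k o2
  | OFor n o1 => term_ok D k n && out_ok D k.+1 o1
  end.

(* The output is pushed onto stack [q], hence produced from its end. *)
Fixpoint compile_out (q : nat) (o : out) (rho : seq nat) (d : nat) : cmd :=
  match o with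
  | OEmit t => compile t rho d ;; If nonempty d (Push q true) (Push q false) ;; clear d
  | OSeq o1 o2 => compile_out q o2 rho d ;; compile_out q o1 rho d
  | OFor n o1 => compile n rho d ;; loop d (compile_out q o1 (d :: rho) d.+1)
  end%C.

Section Output.
Variables (D q : nat).
Hypothesis Dq : D <= q.

Lemma layout_output M S env rho d s l : q \notin rho ->
  layout D M S env rho d s -> q < d -> layout D M S env rho d (upd s q l).
Proof.
move=> qrho [reg regM le sz rd var eM free] qd; split=> //.
- by move=> r lt; rewrite upd_other ?reg //; lia.
- move=> i lt; rewrite upd_other ?var //; apply: contraNneq qrho => <-.
  by apply: mem_nth; rewrite sz.
- by move=> i lt; rewrite upd_other ?free //; lia.
Qed.

Lemma compile_out_correct o : exists2 f, poly_bounded f &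
  forall M S env rho d s, out_ok D (size env) o -> layout D M S env rho d s ->
  q < d -> q \notin rho ->
  runs (compile_out q o rho d) s (f M) (upd s q (emitted S env o ++ s q)).
Proof.
elim: o => [t|o1 [f1 p1 c1] o2 [f2 p2 c2]|n o [f pf cf]].
- have [f pf cf] := compile_correct D t.
  exists (fun M => 3 * f M + 10); first by poly_bound.
  move=> M S env rho d s /= ok L qd qrho; have [v r] := cf _ _ _ _ _ _ ok L.
  set n := den S env t in v r *.
  eapply runs_eq.
  + then_run r; eapply runs_seq; [ | exact: runs_clear | refine (ltnSn _)].
    apply: runs_eq (runs_if (n := 2) (s' := upd (upd s d (unary n)) q ((0 < n) :: s q)) _) erefl (leqnn _).
    have e b : upd (upd s d (unary n)) q (b :: s q) =
        upd (upd s d (unary n)) q (b :: upd s d (unary n) q).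
      by rewrite [in RHS]upd_other //; lia.
    by rewrite upd_same; case: n e {v r} => [|n] e; rewrite e; apply: runs_push.
  + by states L.
  + by cells L.
- exists (fun M => f1 M + f2 M + 1); first by poly_bound.
  move=> M S env rho d s /= /andP[ok1 ok2] L qd qrho.
  eapply runs_eq.
  + then_run (c2 _ _ _ _ _ _ ok2 L qd qrho).
    exact: (c1 _ _ _ _ _ _ ok1 (layout_output _ qrho L qd) qd qrho).
  + by rewrite upd_same upd_upd catA.
  + by lia.
- have [g pg cg] := compile_correct D n.
  exists (fun M => g M + (f (M + g M) + 3) * g M + 2); first by poly_bound.
  move=> M S env rho d s /= /andP[okn ok] L qd qrho.
  have [v r] := cg _ _ _ _ _ _ okn L.
  set k := den S env n in v r *.
  pose E m := flatten [seq emitted S (i :: env) o | i <- iota m (k - m)].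
  eapply runs_eq.
  + then_run r.
    apply: runs_from_eq (@runs_loop d _ (f (M + g M)) k
      (fun m => upd (upd s q (E m ++ s q)) d (unary m)) _ _) _.
    * by move=> m _; rewrite upd_same.
    * move=> m lt /=; rewrite upd_upd.
      have L1 : layout D (M + g M) S (m :: env) (d :: rho) d.+1
          (upd (upd s q (E m.+1 ++ s q)) d (unary m)).
        apply: layout_bind; first by lia.
        by apply: layout_mono (layout_output _ qrho L qd); lia.
      apply: runs_eq (cf _ S (m :: env) _ _ _ ok L1 _ _) _ (leqnn _); first by lia.
        by rewrite inE negb_or qrho andbT; lia.
      rewrite [in X in upd _ _ X]upd_other ?upd_same; last by lia.
      have -> : E m = emitted S (m :: env) o ++ E m.+1.
        by rewrite /E (_ : k - m = (k - m.+1).+1) //; lia.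
      by states L; rewrite catA.
    * by states L; rewrite /E subnn.
  + by rewrite /E subn0; states L.
  + by nia.
Qed.

Fixpoint increment (l : seq bool) : seq bool :=
  match l with
  | [::] => [:: true]
  | false :: l' => true :: l'
  | true :: l' => false :: increment l'
  end.

Lemma size_increment l : size (increment l) <= (size l).+1.
Proof. by elim: l => [|[] l IH] //=. Qed.

Definition increment_cmd (d : nat) : cmd :=
  While (top_is true) q (Pop q ;; Push d true) ;;
  If (top_is false) q (Pop q) Skip ;; Push q true ;; loop d (Push q false).

(** The low bit is on top. The carry runs through the leading ones, whose number [k] is kept on [d]
    until they come back as zeros. *)
Lemma runs_increment d s : q != d -> s d = [::] ->
  runs (increment_cmd d) s (20 * (size (s q)).+1) (upd s q (increment (s q))).
Proof.
move=> qd sd; have dq : (d == q) = false by rewrite eq_sym (negPf qd).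
have [l el] : {l | s q = l} by exists (s q).
pose k := find negb l.
have tk : take k l = unary k.
  rewrite /k; elim: (l) => [|[] l' IH] //=; by rewrite IH.
have kl : k <= size l by apply: find_size.
have incE : increment l = nseq k false ++ true :: drop k.+1 l.
  by rewrite /k; elim: (l) => [|[] l' IH] //=; rewrite ?IH ?drop0.
have top : ohead (drop k l) = Some false \/ drop k l = [::].
  by rewrite /k; elim: (l) => [|[] l' IH] /=; rewrite ?drop0; auto.
have r1 : runs (While (top_is true) q (Pop q ;; Push d true)) s (5 * k + 1)
    (upd (upd s q (drop k l)) d (unary k)).
  suff aux j : j <= k -> runs (While (top_is true) q (Pop q ;; Push d true))
      (upd (upd s q (drop (k - j) l)) d (unary (k - j))) (5 * j + 1)
      (upd (upd s q (drop k l)) d (unary k)).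
    have := aux k (leqnn _); rewrite subnn drop0 [upd _ d [::]]upd_id; last by rewrite upd_other // eq_sym.
    by rewrite upd_id.
  elim: j => [|j IH] jk.
    rewrite subn0; apply: runs_while_stop => //; rewrite upd_other // upd_same.
    by case: top => ->.
  have lt : k - j.+1 < k by lia.
  have dE : drop (k - j.+1) l = true :: drop (k - j) l.
    rewrite (drop_nth true); last by lia.
    have -> : nth true l (k - j.+1) = true.
      by have := nth_take true lt l; rewrite tk nth_nseq lt.
    by rewrite (_ : (k - j.+1).+1 = k - j) //; lia.
  apply: (runs_while (n1 := 4) (n2 := 5 * j + 1) _ _ (IH _)); try lia.
  - by rewrite upd_other // upd_same dE.
  - eapply runs_eq; first by then_run (@runs_pop (upd (upd s q (drop (k - j.+1) l)) d
      (unary (k - j.+1))) q 1 isT); apply: runs_push (ltnSn _).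
      rewrite upd_other // upd_same dE /=.
      by upds; rewrite (_ : k - j = (k - j.+1).+1) //; lia.
    by [].
rewrite el; eapply runs_eq.
- then_run r1.
  eapply runs_seq; [ | | refine (ltnSn _)].
    apply: (@runs_if _ _ _ _ _ 1 (upd (upd s q (drop k.+1 l)) d (unary k))).
    rewrite upd_other // upd_same; case: top => [|e].
      case e: (drop k l) => [|b l'] //= [->] /=.
      apply: runs_eq (runs_pop _ _ (ltnSn _)) _ (leqnn _).
      have -> : drop k.+1 l = l' by rewrite -add1n -drop_drop e drop1.
      by upds.
    rewrite e /=; apply: runs_eq (runs_skip _ (ltnSn _)) _ (leqnn _).
    have -> : drop k.+1 l = [::] by rewrite -add1n -drop_drop e.
    by [].
  then_run (@runs_push (upd (upd s q (drop k.+1 l)) d (unary k)) q true 2 isT).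
  apply: runs_from_eq (@runs_loop d (Push q false) 2 k (fun m => upd (upd s q
    (nseq (k - m) false ++ true :: drop k.+1 l)) d (unary m)) _ _) _.
  + by move=> m _; rewrite upd_same.
  + move=> m lt /=; apply: runs_eq (runs_push _ _ _ (ltnSn _)) _ (leqnn _).
    by upds; rewrite (_ : k - m = (k - m.+1).+1) //; lia.
  + by rewrite subnn; upds.
- by rewrite subn0 -incE; upds.
- by lia.
Qed.

(** The output ends with [K] in binary. As output is produced from its end, these digits come first,
    by [K] increments of the empty string, and the bits of [o] are then pushed on top. *)
Definition printer (K : term) (o : out) : cmd :=
  compile K [::] q.+1 ;; loop q.+1 (increment_cmd q.+2) ;; compile_out q o [::] q.+1.

Lemma runs_printer K o : term_ok D 0 K -> out_ok D 0 o ->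
  exists2 f, poly_bounded f &
  forall M S s, layout D M S [::] [::] q s ->
  runs (printer K o) s (f M)
    (upd s q (emitted S [::] o ++ iter (den S [::] K) increment [::])).
Proof.
move=> okK oko.
have [f pf cf] := compile_correct D K; have [g pg cg] := compile_out_correct o.
exists (fun M => f M + (20 * (f M).+2 + 3) * f M + g M + 10); first by poly_bound.
move=> M S s L.
have sE : upd s q [::] = s by rewrite upd_id // (layout_free L).
have L1 l : layout D M S [::] [::] q.+1 (upd s q l) by apply: layout_push.
have [v r] := cf M S [::] [::] q.+1 s okK ltac:(by rewrite -sE; apply: L1).
set k := den _ _ K in v r *.
pose I i := iter i increment [::].
have sI i : size (I i) <= i.
  by elim: i => // i IH; apply: leq_trans (size_increment _) _.
eapply runs_eq.
- then_run r; eapply runs_seq; [ | | refine (ltnSn _)].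
    apply: runs_from_eq (@runs_loop q.+1 _ (20 * k.+1) k
      (fun m => upd (upd s q (I (k - m))) q.+1 (unary m)) _ _) _.
    + by move=> m _; rewrite upd_same.
    + move=> m lt /=.
      apply: runs_eq (runs_increment _ _) _ _; first by lia.
      * by cells L.
      * by rewrite (_ : k - m = (k - m.+1).+1); [states L | lia].
      * by cells L; have := sI (k - m.+1); lia.
    + by rewrite subnn; states L.
  apply: (cg M S [::]) => //.
  rewrite [upd _ q.+1 _]upd_id; last by cells L.
  exact: L1.
- by rewrite subn0; states L.
- by nia.
Qed.

End Output.

(** * Evaluation of quantified formulas in polynomial space *)

(* The value of a quantified formula in [r] more bits, where [W] lists the bits
   already chosen, the last one first, and [u W] tells whether the next bit is
   universal. *)
Fixpoint qbf_value (f u : seq bool -> bool) (r : nat) (W : seq bool) : bool :=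
  if r is r'.+1 then
    let v := qbf_value f u r' (false :: W) in
    if v == u W then qbf_value f u r' (true :: W) else v
  else f W.

Definition registers (x W : seq bool) : stacks := upd (upd (fun=> [::]) 0 x) 1 W.

Definition holdsb (t : term) (x W : seq bool) : bool := 0 < den (registers x W) [::] t.

Section Evaluator.
Variables (phi univ len : term).
Hypotheses (phi_ok : term_ok 2 0 phi) (univ_ok : term_ok 2 0 univ)
  (len_ok : term_ok 2 0 len).

(* Stack 0: input, 1: chosen bits, 2: number of bits to choose, 3: value,
   4: running, 5: backtracking. *)
Definition search_state x W r (v c run : bool) : stacks :=
  fun i => match i with
  | 0 => x | 1 => W | 2 => unary r | 3 => unary v | 4 => unary run | 5 => unary c
  | _ => [::]
  end.

Definition retry : cmd := Push 1 true ;; Pop 5 ;; Pop 3.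

(** The list of chosen bits is the whole memory of a depth-first search. On return from a [false]
    branch, the [true] branch is tried exactly when the value found equals the value of [univ], that
    is for a false existential or a true universal bit; otherwise the value is passed up. *)
Definition backtrack : cmd :=
  If nonempty 1
    (If (top_is true) 1 (Pop 1 ;; Push 2 true)
      (Pop 1 ;; compile univ [::] 6 ;;
        If nonempty 6 (clear 6 ;; If nonempty 3 retry (Push 2 true))
          (If nonempty 3 (Push 2 true) retry)))
    (Pop 4).

Definition descend : cmd :=
  If nonempty 2 (Pop 2 ;; Push 1 false)
    (compile phi [::] 6 ;; If nonempty 6 (Push 3 true) Skip ;; clear 6 ;; Push 5 true).

Definition search_round : cmd := If nonempty 5 backtrack descend.

Definition evaluator : cmd :=
  (compile len [::] 6 ;; transfer 6 2) ;; Push 4 true ;; While nonempty 4 search_round.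

Lemma search_layout x W r v c run M : size x <= M -> size W <= M ->
  layout 2 M (registers x W) [::] [::] 6 (search_state x W r v c run).
Proof.
move=> xM WM; split=> //; first by do 2 case=> //.
- by do 2 case=> //.
- by do 6 case=> //.
Qed.

Ltac cases_stack := apply/funext => -[|[|[|[|[|[|[|i]]]]]]] //=.

(** The five kinds of round: going down, evaluating a leaf, ending at the root, and returning from a
    [true] or from a [false] branch. *)
Lemma search_roundP : exists2 G, poly_bounded G &
  forall M x W r v, size x <= M -> size W <= M ->
    [/\ runs search_round (search_state x W r.+1 false false true) (G M)
          (search_state x (false :: W) r false false true),
        runs search_round (search_state x W 0 false false true) (G M)
          (search_state x W 0 (holdsb phi x W) true true),
        runs search_round (search_state x [::] r v true true) (G M)
          (search_state x [::] r v true false),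
        runs search_round (search_state x (true :: W) r v true true) (G M)
          (search_state x W r.+1 v true true) &
        runs search_round (search_state x (false :: W) r v true true) (G M)
          (if v == holdsb univ x W then search_state x (true :: W) r false false true
           else search_state x W r.+1 v true true)].
Proof.
have [f pf cf] := compile_correct 2 phi; have [g pg cg] := compile_correct 2 univ.
exists (fun M => (3 * f M + 3 * g M + 20).+3); first by poly_bound.
move=> M x W r v xM WM; rewrite /search_round /descend /backtrack; split.
- apply: runs_if; apply: runs_if => /=.
  eapply runs_eq; first by then_run (@runs_pop (search_state x W r.+1 false false true) 2 1 isT);
    apply: runs_push (ltnSn _).
    by cases_stack.
  by lia.
- apply: runs_if; apply: runs_if => /=.
  have L := search_layout 0 false false true xM WM.
  have [vn rn] := cf _ _ [::] _ _ _ phi_ok L.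
  rewrite /holdsb; set k := den _ _ phi in vn rn *.
  eapply runs_eq.
  + then_run rn; set s1 := upd _ 6 _.
    have rI : runs (If nonempty 6 (Push 3 true) Skip) s1 3 (upd s1 3 (unary (0 < k))).
      apply: runs_if; case: k @s1 {vn rn} => [|k] s1 /=; last exact: runs_push.
      by apply: runs_eq (runs_skip _ (ltnSn _)) _ _ => //; rewrite upd_id.
    move: rI; rewrite {}/s1 => rI; then_run rI; then_run runs_clear.
    exact: runs_push (ltnSn _).
  + by cases_stack.
  + by rewrite upd_other // upd_same size_nseq; lia.
- apply: runs_if; apply: runs_if => /=.
  apply: runs_eq (runs_pop _ _ (ltnSn _)) _ _; last by lia.
  by cases_stack.
- do 3 apply: runs_if; rewrite /=.
  eapply runs_eq; first by then_run (@runs_pop (search_state x (true :: W) r v true true) 1 1 isT);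
    apply: runs_push (ltnSn _).
    by cases_stack.
  by lia.
- do 3 apply: runs_if; rewrite /=.
  have L : layout 2 M (registers x W) [::] [::] 6
      (upd (search_state x (false :: W) r v true true) 1 W).
    have -> : upd (search_state x (false :: W) r v true true) 1 W = search_state x W r v true true.
      by cases_stack.
    exact: search_layout.
  have [vn rn] := cg _ _ [::] _ _ _ univ_ok L.
  rewrite /holdsb; set k := den _ _ univ in vn rn *.
  set t := search_state x (false :: W) r v true true in L rn *.
  have rR b : runs retry (upd (upd t 1 W) 6 (unary b)) 6
      (upd (search_state x (true :: W) r false false true) 6 (unary b)).
    set t1 := upd _ 6 _.
    eapply runs_eq.
    + then_run (@runs_push t1 1 true 2 isT).
      by then_run (@runs_pop (upd t1 1 (true :: t1 1)) 5 1 isT); apply: runs_pop (ltnSn 0).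
    + by rewrite /t1 /t; case: v {rn L t1 t} => /=; cases_stack.
    + by [].
  have rU b : runs (Push 2 true) (upd (upd t 1 W) 6 (unary b)) 6
      (upd (search_state x W r.+1 v true true) 6 (unary b)).
    by apply: runs_eq (runs_push _ _ _ (ltnSn _)) _ _ => //; rewrite /t; cases_stack.
  have e0 s : s 6 = [::] -> upd s 6 [::] = s by move=> ?; rewrite upd_id.
  have rF : runs (If nonempty 6 (clear 6 ;; If nonempty 3 retry (Push 2 true))
          (If nonempty 3 (Push 2 true) retry)) (upd (upd t 1 W) 6 (unary k)) (2 * k + 12)
       (if v == (0 < k) then search_state x (true :: W) r false false true
           else search_state x W r.+1 v true true).
    apply: (@runs_le _ _ (2 * k + 11).+1); last by lia.
    apply: runs_if; rewrite upd_same.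
    case: k {vn rn} => [|k] /=.
      apply: (@runs_le _ _ 7); last by lia.
      apply: runs_if.
      rewrite !upd_other // /t /=.
      by case: v {L} @t rR rU => t rR rU /=; [have := rU 0 | have := rR 0]; rewrite /= !e0.
    eapply (runs_seq (n2 := 7)); [apply: runs_clear | | ]; last first.
      by rewrite upd_same /= size_nseq; lia.
    rewrite upd_upd; apply: runs_if; rewrite !upd_other // /t /=.
    by case: v {L} @t rR rU => t rR rU /=; [have := rR 0 | have := rU 0]; rewrite /= !e0.
  eapply runs_eq.
  + by then_run (@runs_pop t 1 1 isT); then_run rn; exact: rF.
  + by [].
  + by lia.
Qed.

Lemma search_size x W r v c run M i : size x <= M -> size W <= M -> r <= M -> 0 < M ->
  size (search_state x W r v c run i) <= M.
Proof.
by move=> *; case: i => [|[|[|[|[|[|i]]]]]] //=; rewrite size_nseq //;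
  apply: leq_trans (leq_b1 _) _.
Qed.

(** The number of rounds may be exponential, but each round starts from stacks of polynomial height
    and takes polynomial time, so [ev_bounded], applied to one round at a time, bounds the heights
    throughout. *)
Lemma evaluatorP : exists2 B, poly_bounded B & forall x, exists n s,
  [/\ size x <= B (size x), ev (fun m => m <= B (size x)) evaluator (input_stacks x) n s &
      (ohead (s 3) == Some true) =
      qbf_value (holdsb phi x) (holdsb univ x) (den (registers x [::]) [::] len) [::]].
Proof.
have [G pG HG] := search_roundP; have [h ph ch] := compile_correct 2 len.
pose M n := n + h n + 2.
exists (fun n => M n + G (M n) + 10 * h n + 20); first by rewrite /M; poly_bound.
move=> x; set m := M (size x); set B := _ + 20.
have xm : size x <= m by rewrite /m /M; lia.
have L0 : layout 2 (size x) (registers x [::]) [::] [::] 6 (input_stacks x).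
  by split=> //; do 2 (case=> //).
have [vn rn] := ch _ _ [::] _ _ _ len_ok L0.
set k := den _ _ len in vn rn *.
have km : k.+1 < m by rewrite /m /M; lia.
pose fin v := search_state x [::] k v true false.
pose done v s := exists n, ev (fun m => m <= B) (While nonempty 4 search_round) s n (fin v).
have back W r v c s v' : size W + r <= k ->
    runs search_round (search_state x W r v c true) (G m) s ->
    done v' s -> done v' (search_state x W r v c true).
  move=> Wr [n le e] [n' e'].
  have [|e1 _] := @ev_bounded _ _ _ _ m e.
    by move=> i; apply: search_size => //; rewrite /m /M; lia.
  exists (n + n').+1; apply: EvWhileT e' => //.
  by apply: ev_mono e1 => j; rewrite /B -/m; lia.
(* Stated with a continuation: if the search ends well after returning from [W] with its value, then
   it does so after entering [W]. The induction composes the two branches in this way. *)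
have main r W v : size W + r <= k ->
    v = qbf_value (holdsb phi x) (holdsb univ x) r W ->
    forall v', done v' (search_state x W r v true true) ->
    done v' (search_state x W r false false true).
  elim: r W v => [|r IH] W v Wr -> v' d.
    have [||_ H _ _ _] := HG m x W 0 false; [done | by lia |].
    exact: (back _ _ _ _ _ _ _ H d).
  have Wm : size W <= m by lia.
  have [H _ _ _ _] := HG m x W r false xm Wm; apply: (back _ _ _ _ _ _ _ H); first by lia.
  have W1 : size (false :: W) + r <= k by rewrite /=; lia.
  apply: (IH _ _ W1 erefl).
  set v0 := qbf_value _ _ r (false :: W).
  have [_ _ _ _ H5] := HG m x W r v0 xm Wm; apply: (back _ _ _ _ _ _ _ H5) => //.
  move: d; rewrite /= -/v0; case: ifP => _ d //.
  apply: (IH (true :: W) _ W1 erefl).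
  have [_ _ _ H4 _] := HG m x W r (qbf_value (holdsb phi x) (holdsb univ x) r (true :: W)) xm Wm.
  exact: (back _ _ _ _ _ _ _ H4 d).
set v := qbf_value _ _ _ _.
have [n1 e1] : done v (search_state x [::] k false false true).
  apply: (main k [::] v) => //.
  have [//|//|_ _ H3 _ _] := HG m x [::] k v.
  apply: (back _ _ _ _ _ _ _ H3) => //.
  by exists 1; apply: EvWhileF.
have rT : runs (compile len [::] 6 ;; transfer 6 2) (input_stacks x) (7 * h (size x) + 3)
    (search_state x [::] k false false false).
  eapply runs_eq.
  - by then_run rn; apply: runs_transfer.
  - by rewrite upd_same rev_nseq; cases_stack; rewrite /upd /= cats0.
  - by rewrite upd_same size_nseq; lia.
case: rT => n0 n0le e0.
have [|e0' _] := @ev_bounded _ _ _ _ (size x) e0.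
  by rewrite /input_stacks => i; rewrite updE; case: ifP.
exists (n0 + (2 + n1).+1).+1, (fin v); split.
- by rewrite /B -/m; lia.
- apply: EvSeq (_ : ev _ _ _ _ (search_state x [::] k false false false)) _.
    by apply: ev_mono e0' => j; rewrite /B -/m; lia.
  apply: EvSeq (_ : ev _ _ _ _ (search_state x [::] k false false true)) e1.
  have -> : search_state x [::] k false false true =
      upd (search_state x [::] k false false false) 4 [:: true] by cases_stack.
  by apply: EvPush; rewrite /B -/m /=; lia.
- by rewrite /=; case: (v).
Qed.

Theorem pspace_qbf (L : language) :
  (forall x, L x <->
     qbf_value (holdsb phi x) (holdsb univ x) (den (registers x [::]) [::] len) [::]) ->
  pspace L.
Proof.
have [B pB HB] := evaluatorP => LE.
have [p pP] := poly_bounded_poly pB.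
apply: (@pspace_program evaluator 3 p) => x; have [n [s [xB e accE]]] := HB x.
  exact: leq_trans xB (pP _).
exists n, s; split; last by rewrite LE -accE.
by apply: ev_mono e => m /leq_trans; apply.
Qed.

End Evaluator.

(** * From flips of satisfying assignments to dominating sets *)

Inductive reach (A : Type) (R : A -> A -> Prop) : A -> A -> Prop :=
  | reach_refl x : reach R x x
  | reach_step x y z : R x y -> reach R y z -> reach R x z.

Lemma reach_trans (A : Type) (R : A -> A -> Prop) x y z :
  reach R x y -> reach R y z -> reach R x z.
Proof. by elim=> // {}x x' {}y xx' _ IH /IH; apply: reach_step. Qed.

Lemma reach_last (A : Type) (R : A -> A -> Prop) x y z :
  reach R x y -> R y z -> reach R x z.
Proof. by move=> xy yz; apply: reach_trans xy (reach_step yz (reach_refl _ _)). Qed.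

Lemma reach_sym (A : Type) (R : A -> A -> Prop) x y :
  (forall a b, R a b -> R b a) -> reach R x y -> reach R y x.
Proof.
move=> RC; elim=> [z|a b c ab _ IH]; first exact: reach_refl.
exact: reach_last IH (RC _ _ ab).
Qed.

Lemma tar_reachable_trans (T : finType) (adj : rel T) k D1 D2 D3 :
  tar_reachable adj k D1 D2 -> tar_reachable adj k D2 D3 -> tar_reachable adj k D1 D3.
Proof.
case=> s1 [p1 l1 h1] [s2 [p2 l2 h2]]; exists (s1 ++ s2); split.
- by rewrite cat_path p1 l1.
- by rewrite last_cat l1.
- move=> D; rewrite inE mem_cat => /or3P[/eqP->|in1|in2].
  + by apply: h1; rewrite mem_head.
  + by apply: h1; rewrite inE in1 orbT.
  + by apply: h2; rewrite inE in2 orbT.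
Qed.

Section Satisfiability.
Variables (U Cl : eqType) (inU : pred U) (inC : pred Cl) (occ : Cl -> U -> bool -> bool).

Definition satisfies (a : U -> bool) : Prop :=
  forall c, inC c -> exists2 u, inU u & occ c u (a u).

Definition flip (a : U -> bool) u : U -> bool := fun v => if v == u then ~~ a u else a v.

Definition flip_step (a a' : U -> bool) : Prop :=
  [/\ satisfies a, satisfies a' & exists2 u, inU u & a' = flip a u].

Lemma flipK a u : flip (flip a u) u = a.
Proof. by apply/funext => v; rewrite /flip eqxx negbK; case: eqP => // ->. Qed.

Lemma flip_step_sym a a' : flip_step a a' -> flip_step a' a.
Proof.
by case=> sa sa' [u uin e]; subst a'; split=> //; exists u; rewrite ?flipK.
Qed.

Definition node : eqType := ((U * bool + U) + Cl)%type.
Definition lit u b : node := inl (inl (u, b)).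
Definition tip u : node := inl (inr u).
Definition cls c : node := inr c.

(* Each variable is a triangle formed by its two literals and a tip, and each
   clause is a vertex joined to its literals. *)
Definition node_adj (x y : node) : bool :=
  match x, y with
  | inl (inl (u, b)), inl (inl (u', b')) => (u == u') && (b != b')
  | inl (inl (u, _)), inl (inr u') => u == u'
  | inl (inr u'), inl (inl (u, _)) => u == u'
  | inl (inl (u, b)), inr c => occ c u b
  | inr c, inl (inl (u, b)) => occ c u b
  | _, _ => false
  end.

Lemma node_adj_sym : symmetric node_adj.
Proof.
move=> [[[u b]|u]|c] [[[u' b']|u']|c'] //=.
by congr (_ && ~~ _); apply: eq_sym.
Qed.

Lemma node_adj_irr : irreflexive node_adj.
Proof. by move=> [[[u b]|u]|c] //=; rewrite !eqxx. Qed.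

Definition in_range (x : node) : bool :=
  match x with
  | inl (inl (u, _)) => inU u
  | inl (inr u) => inU u
  | inr c => inC c
  end.

Section Domination.
Variables (T : finType) (dec : T -> node) (enc : node -> T).
Hypotheses (decK : cancel dec enc) (encK : forall x, in_range x -> dec (enc x) = x)
  (dec_range : forall t, in_range (dec t)).

Definition sat_adj : rel T := fun t t' => node_adj (dec t) (dec t').

Definition is_tip (x : node) : bool := if x is inl (inr _) then true else false.

Definition nb_vars : nat := #|[set t | is_tip (dec t)]|.

Definition true_lit (a : U -> bool) (x : node) : bool :=
  if x is inl (inl (u, b)) then a u == b else false.

Definition chosen (a : U -> bool) : {set T} := [set t | true_lit a (dec t)].

Lemma in_chosen a u b : inU u -> (enc (lit u b) \in chosen a) = (a u == b).
Proof. by move=> uin; rewrite inE encK. Qed.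

Lemma card_chosen a : #|chosen a| = nb_vars.
Proof.
pose f t := if dec t is inl (inr u) then enc (lit u (a u)) else t.
have -> : chosen a = f @: [set t | is_tip (dec t)].
  apply/setP => t; apply/idP/imsetP => [|[t']].
    rewrite inE; case e: (dec t) => [[[u b]|u]|c] //= /eqP ab.
    have uin : inU u by have := dec_range t; rewrite e.
    exists (enc (tip u)); first by rewrite inE encK.
    by rewrite /f encK //= -[LHS]decK e ab.
  rewrite inE; case e: (dec t') => [[[u b]|u]|c] // _ ->.
  have uin : inU u by have := dec_range t'; rewrite e.
  by rewrite inE /f e encK //= eqxx.
rewrite card_in_imset // => t t'; rewrite !inE /f.
case e: (dec t) => [[[u b]|u]|c] // _; case e': (dec t') => [[[u' b']|u']|c'] // _.
have uin : inU u by have := dec_range t; rewrite e.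
have uin' : inU u' by have := dec_range t'; rewrite e'.
move/(congr1 dec); rewrite !encK // => -[uu' _].
by rewrite -[t]decK -[t']decK e e' uu'.
Qed.

Lemma dominatingP (D : {set T}) :
  reflect (forall v, v \notin D -> exists2 u, u \in D & sat_adj u v) (dominating sat_adj D).
Proof.
apply: (iffP forallP) => H v; last first.
  by apply/implyP => /H[u uD uv]; apply/existsP; exists u; rewrite uD.
by move=> vD; have /implyP/(_ vD)/existsP[u /andP[uD uv]] := H v; exists u.
Qed.

Lemma dominating_chosen a : satisfies a -> dominating sat_adj (chosen a).
Proof.
move=> sa; apply/dominatingP => v; rewrite inE.
have := dec_range v; case e: (dec v) => [[[u b]|u]|c] /= vin.
- move=> ab; exists (enc (lit u (a u))); first by rewrite in_chosen.
  by rewrite /sat_adj encK // e /= eqxx.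
- move=> _; exists (enc (lit u (a u))); first by rewrite in_chosen.
  by rewrite /sat_adj encK // e /= eqxx.
- move=> _; have [u uin uc] := sa c vin.
  by exists (enc (lit u (a u))); rewrite ?in_chosen // /sat_adj encK // e.
Qed.

Lemma dominatingS (D D' : {set T}) :
  D \subset D' -> dominating sat_adj D -> dominating sat_adj D'.
Proof.
move=> /subsetP sub /dominatingP dD; apply/dominatingP => v vD'.
have vD : v \notin D by apply: contra vD'; apply: sub.
by have [u uD uv] := dD v vD; exists u => //; apply: sub.
Qed.

Let k : int := (nb_vars.+1)%:Z%R.

(** The new literal is added before the old one is removed, which is why the threshold exceeds the
    number of variables by one. *)
Lemma flip_reachable a a' : flip_step a a' -> tar_reachable sat_adj k (chosen a) (chosen a').
Proof.
case=> sa sa' [u uin ea'].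
pose v := enc (lit u (~~ a u)); pose w := enc (lit u (a u)).
have vn : v \notin chosen a by rewrite in_chosen //; case: (a u).
have a'E : chosen a' = (v |: chosen a) :\ w.
  apply/setP => t; rewrite !inE ea' /true_lit -[t == w](inj_eq (can_inj decK)).
  rewrite -[t == v](inj_eq (can_inj decK)) !encK //.
  case: (dec t) => [[[u' b]|u']|c] //=; rewrite /lit /eq_op /= /eq_op /= /eq_op /= /flip.
  by case: (u' =P u) => [->|_]; rewrite ?andbF //; case: (a u); case: b.
exists [:: v |: chosen a; chosen a']; split=> //.
- rewrite /= andbT; apply/andP; split; apply/orP; [left | right]; apply/existsP.
    by exists v; rewrite vn eqxx.
  exists w; rewrite a'E eqxx andbT !inE encK //= eqxx orbT //.
- move=> D; rewrite !inE => /or3P[]/eqP->; split.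
  + exact: dominating_chosen.
  + by rewrite card_chosen lez_nat.
  + by apply: dominatingS (dominating_chosen sa); rewrite subsetUr.
  + by rewrite cardsU1 vn card_chosen lez_nat.
  + exact: dominating_chosen.
  + by rewrite card_chosen lez_nat.
Qed.

Lemma reach_dominating a a' : satisfies a ->
  reach flip_step a a' -> tar_reachable sat_adj k (chosen a) (chosen a').
Proof.
move=> sa r; elim: r sa => {a a'} [a|a a1 a' s _ IH] sa.
  exists [::]; split=> // D; rewrite inE => /eqP->.
  by rewrite dominating_chosen // card_chosen lez_nat.
have [_ sa1 _] := s.
exact: tar_reachable_trans (flip_reachable s) (IH sa1).
Qed.

Definition is_var (x : node) : bool := if x is inl _ then true else false.

Definition to_tip (t : T) : T :=
  match dec t with
  | inl (inl (u, _)) => enc (tip u)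
  | inl (inr u) => enc (tip u)
  | _ => t
  end.

(** A tip is dominated only from within its triangle, and triangles are disjoint, so [D] meets each
    of them. If it has no further vertices, it contains no clause vertex and exactly one vertex of
    each triangle, which is the injectivity of [to_tip]. *)
Lemma dominating_card (D : {set T}) : dominating sat_adj D ->
  nb_vars <= #|D| /\
  (#|D| = nb_vars -> (forall t, t \in D -> is_var (dec t)) /\ {in D &, injective to_tip}).
Proof.
move/dominatingP => dD; pose V := [set t in D | is_var (dec t)].
have sub : [set t | is_tip (dec t)] \subset to_tip @: V.
  apply/subsetP => t; rewrite inE; case e: (dec t) => [[[u b]|u]|c] // _.
  have [tD|tD] := boolP (t \in D).
    apply/imsetP; exists t; first by rewrite inE tD e.
    by rewrite /to_tip e -[LHS]decK e.
  have [t' t'D] := dD t tD; rewrite /sat_adj e.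
  case e': (dec t') => [[[u' b]|u']|c'] //= /eqP uu'.
  apply/imsetP; exists t'; first by rewrite inE t'D e'.
  by rewrite /to_tip e' -[LHS]decK e uu'.
have VD : V \subset D by apply/subsetP => t; rewrite inE => /andP[].
have le1 := subset_leq_card sub; have le2 := leq_imset_card to_tip V.
have le3 := subset_leq_card VD.
split; first exact: leq_trans le1 (leq_trans le2 le3).
move=> eD; have VE : V = D.
  by apply/eqP; rewrite eqEcard VD eD (leq_trans le1).
split=> [t|]; first by rewrite -VE inE => /andP[].
by apply/imset_injP; move: le1 le2; rewrite VE eqn_leq => le1 ->; rewrite eD.
Qed.

(** A dominating set need not come from an assignment. Where it contains both literals of a
    variable, or none, both values are compatible with it. *)
Definition compatible (a : U -> bool) (D : {set T}) : Prop :=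
  forall u b, inU u -> enc (lit u b) \in D -> enc (lit u (a u)) \in D.

Lemma compatible_satisfies a (D : {set T}) : dominating sat_adj D -> #|D| = nb_vars ->
  compatible a D -> satisfies a.
Proof.
move=> dD eD cD; have [_ /(_ eD)[Dvar inj]] := dominating_card dD.
move=> c cin; have cn : enc (cls c) \notin D.
  by apply/negP => /Dvar; rewrite encK.
have [t tD] := dominatingP _ dD _ cn; rewrite /sat_adj encK //.
have := dec_range t; case e: (dec t) => [[[u b]|u]|c'] //= uin ucb.
exists u => //; have tE : t = enc (lit u b) by rewrite -[LHS]decK e.
have l1 : enc (lit u b) \in D by rewrite -tE.
have l2 := cD _ _ uin l1.
have := inj _ _ l1 l2; rewrite /to_tip !encK // => /(_ erefl)/(congr1 dec).
by rewrite !encK // => -[<-].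
Qed.

Variable a0 : U -> bool.

(** The invariant along a reconfiguration sequence. Values outside the range [inU] are pinned to
    those of [a0], as no flip changes them. *)
Definition tracked (D : {set T}) : Prop := forall a,
  (forall u, ~~ inU u -> a u = a0 u) -> compatible a D -> satisfies a ->
  reach flip_step a0 a.

Lemma flip_agree a u : inU u -> (forall v, ~~ inU v -> a v = a0 v) ->
  forall v, ~~ inU v -> flip a u v = a0 v.
Proof. by move=> uin aout v vout; rewrite /flip; case: eqP vout => [->|_ /aout //]; rewrite uin. Qed.

Lemma enc_lit_inj u b u' b' : inU u -> inU u' -> enc (lit u b) = enc (lit u' b') ->
  (u, b) = (u', b').
Proof. by move=> uin uin' /(congr1 dec); rewrite !encK // => -[-> ->]. Qed.

(** If [a] is compatible with [D'] but not with [D], then the step added or removed a literal of one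
    variable [u]. In that case [flip a u] is compatible with [D] and with the smaller of the two
    sets; the latter has one vertex per triangle, so [flip a u] satisfies all clauses. It is
    reachable by the invariant, and [a] is one flip away from it. *)
Lemma tracked_step D D' : dominating sat_adj D -> dominating sat_adj D' ->
  #|D| <= nb_vars.+1 -> #|D'| <= nb_vars.+1 -> tar_step D D' -> tracked D -> tracked D'.
Proof.
move=> dD dD' leD leD' st tD a aout cD' sa.
have [gD _] := dominating_card dD; have [gD' _] := dominating_card dD'.
have [cD|ncD] := EM (compatible a D); first exact: tD.
have [u [b [uin ubD uaD]]] : exists u b, [/\ inU u, enc (lit u b) \in D & enc (lit u (a u)) \notin D].
  apply: contrapT => H; apply: ncD => u b uin ubD; apply/negPn/negP => ua; apply: H.
  by exists u, b.
have bE : b = ~~ a u.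
  by case: (b =P a u) ubD uaD => [->->//|]; case: (b); case: (a u).
have fcomp (E : {set T}) : (forall v b', inU v -> v != u -> enc (lit v b') \in E -> enc (lit v (a v)) \in E) ->
    (forall b', enc (lit u b') \in E -> enc (lit u b) \in E) -> compatible (flip a u) E.
  move=> H1 H2 v b' vin vE; rewrite /flip; case: (v =P u) vE => [->|/eqP nvu] vE.
    by rewrite -bE; apply: H2 vE.
  exact: H1 vin nvu vE.
have fin : satisfies (flip a u) -> compatible (flip a u) D -> reach flip_step a0 a.
  move=> sf cf; apply: reach_last (tD _ (flip_agree uin aout) cf sf) _.
  by split=> //; exists u; rewrite ?flipK.
case/orP: st => /existsP[v /andP[vD /eqP eD']].
- have eD : #|D| = nb_vars by move: leD'; rewrite eD' cardsU1 vD; lia.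
  have uv : v = enc (lit u (a u)).
    have: enc (lit u b) \in D' by rewrite eD' inE ubD orbT.
    by move/(cD' _ _ uin); rewrite eD' !inE (negPf uaD) orbF => /eqP.
  have cf : compatible (flip a u) D.
    apply: fcomp => // w b' win nwu wD.
    have : enc (lit w b') \in D' by rewrite eD' inE wD orbT.
    move/(cD' _ _ win); rewrite eD' !inE => /orP[/eqP|//].
    by rewrite uv => /(enc_lit_inj win uin)[e]; rewrite e eqxx in nwu.
  exact: fin (compatible_satisfies dD eD cf) cf.
- have eD : #|D'| = nb_vars by move: leD gD'; rewrite eD' (cardsD1 v D) vD; lia.
  have uaD' : enc (lit u (a u)) \notin D' by rewrite eD' inE (negPf uaD) andbF.
  have noD' b' : enc (lit u b') \notin D'.
    by apply: contra uaD'; apply: cD'.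
  have uv : v = enc (lit u b).
    by apply/eqP; have := noD' b; rewrite eD' !inE ubD andbT negbK eq_sym.
  have cf' : compatible (flip a u) D'.
    apply: fcomp => [w b' win _|b']; first exact: cD'.
    by rewrite (negPf (noD' b')).
  apply: fin (compatible_satisfies dD' eD cf') _.
  apply: fcomp => // w b' win nwu wD.
  have : enc (lit w b') \in D'.
    rewrite eD' !inE wD andbT uv; apply/eqP => /(enc_lit_inj win uin)[e].
    by rewrite e eqxx in nwu.
  by move/(cD' _ _ win); rewrite eD' inE => /andP[].
Qed.

Lemma dominating_reach a : (forall u, ~~ inU u -> a u = a0 u) -> satisfies a -> satisfies a0 ->
  tar_reachable sat_adj k (chosen a0) (chosen a) -> reach flip_step a0 a.
Proof.
move=> aout sa sa0 [s [p l h]].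
have comp_chosen a1 a2 : (forall u, ~~ inU u -> a1 u = a2 u) -> compatible a1 (chosen a2) -> a1 = a2.
  move=> out c; apply/funext => u; have [uin|/out //] := boolP (inU u).
  have := c u (a2 u) uin; rewrite !in_chosen // eqxx => /(_ isT)/eqP; exact: esym.
have t0 : tracked (chosen a0).
  move=> a1 out /(comp_chosen _ _ out)-> _; exact: reach_refl.
have : tracked (chosen a).
  rewrite -l; elim: s (chosen a0) p h t0 {l} => //= D' s IH D /andP[st p] h tD.
  have [dD leD] := h D (mem_head _ _).
  have [dD' leD'] : dominating sat_adj D' /\ (#|D'|%:Z <= k)%R.
    by apply: h; rewrite !inE eqxx orbT.
  apply: IH p _ _; first by move=> E Ein; apply: h; rewrite inE Ein orbT.
  exact: tracked_step dD dD' leD leD' st tD.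
apply=> // u b uin; rewrite !in_chosen // eqxx.
Qed.

End Domination.
End Satisfiability.

(** * Flipping variables in the order of a rank *)

Section Ranked.
Variables (U Cl : eqType) (inU : pred U) (inC : pred Cl) (occ : Cl -> U -> bool -> bool).
Variables (L : seq U) (rank : U -> nat) (a a' : U -> bool).
Hypothesis inL : forall u, inU u -> u \in L.
Hypothesis agree : forall u, ~~ inU u -> a u = a' u.
(* Flipping the variables by increasing rank is safe if no clause loses its
   old witness before it has its new one. *)
Hypothesis ranked : forall c, inC c ->
  (exists u, [/\ inU u, occ c u (a u) & occ c u (a' u)]) \/
  (exists u u', [/\ inU u /\ occ c u (a u), inU u' /\ occ c u' (a' u') & rank u' < rank u]).

(** The assignments met on the way: a variable may have been flipped only if all those of smaller
    rank have their final values. *)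
Let mixed (b : U -> bool) : Prop :=
  (forall u, b u = a u \/ b u = a' u) /\
  (forall u u', inU u' -> b u != a u -> rank u' < rank u -> b u' = a' u').

Let mixed_satisfies b : mixed b -> satisfies inU inC occ b.
Proof.
move=> [mix low] c /ranked[[u [uin o1 o2]]|[u [u' [[uin o1] [uin' o2] lt]]]].
  by exists u => //; case: (mix u) => ->.
have [e|ne] := eqVneq (b u) (a u); first by exists u; rewrite ?e.
by exists u' => //; rewrite (low u).
Qed.

Lemma ranked_reach : reach (flip_step inU inC occ) a a'.
Proof.
have m0 : mixed a by split=> [u|u u' _]; [left | rewrite eqxx].
pose left_of b := [seq u <- L | b u != a' u].
suff gen n b : mixed b -> size (left_of b) < n -> reach (flip_step inU inC occ) b a'.
  exact: gen m0 (ltnSn _).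
elim: n b => // n IH b mb lt.
have [e|/hasPn none] := boolP (has (fun u => b u != a' u) L); last first.
  have -> : b = a'; last exact: reach_refl.
  apply/funext => u; have [uin|uout] := boolP (inU u).
    by have := none u (inL uin); rewrite negbK => /eqP.
  by case: (mb.1 u) => // ->; apply: agree.
have exr : exists r, has (fun u => (b u != a' u) && (rank u == r)) L.
  by have /hasP[u uL nu] := e; exists (rank u); apply/hasP; exists u; rewrite // nu eqxx.
(* The next variable to flip has least rank among those that still differ from [a']. *)
case: (ex_minnP exr) => r /hasP[u uL /andP[nu /eqP ru]] minr.
have bu : b u = a u by case: (mb.1 u) nu => // ->; rewrite eqxx.
have uin : inU u by apply/negPn/negP => /agree e'; rewrite bu e' eqxx in nu.
have fu : flip b u u = a' u.
  by rewrite /flip eqxx; move: nu; case: (b u); case: (a' u).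
have mb' : mixed (flip b u).
  split=> [v|v w win].
    by have [->|nv] := eqVneq v u; [right | rewrite /flip (negPf nv); apply: mb.1].
  have low z : inU z -> rank z < r -> b z = a' z.
    move=> zin zr; apply/eqP/negPn/negP => nz.
    suff : r <= rank z by lia.
    by apply: minr; apply/hasP; exists z; rewrite ?inL // nz eqxx.
  have [->|nv] := eqVneq v u => nb lt'.
    by rewrite /flip; case: eqP lt' => [->|_ lt']; [lia | apply: low; rewrite -?ru].
  rewrite /flip (negPf nv) in nb.
  have := mb.2 _ _ win nb lt'; rewrite /flip; case: eqP => // e' bw.
  by rewrite -e' bw eqxx in nu.
apply: reach_step (IH _ mb' _).
  by split; [apply: mixed_satisfies | apply: mixed_satisfies | exists u].
have sub v : (flip b u v != a' v) = (b v != a' v) && (v != u).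
  rewrite /flip; case: (eqVneq v u) => [->|_]; last by rewrite andbT.
  by rewrite andbF; move: nu; case: (b u); case: (a' u).
have -> : left_of (flip b u) = [seq v <- left_of b | v != u].
  by rewrite /left_of -filter_predI; apply: eq_filter => v; rewrite /= andbC sub.
rewrite size_filter; apply: leq_trans (_ : size (left_of b) <= n); last by [].
rewrite -(count_predC (fun v => v != u) (left_of b)) -{1}[count _ _]addn0 ltn_add2l.
by rewrite -has_count; apply/hasP; exists u; rewrite ?mem_filter ?nu ?inL //= eqxx.
Qed.

End Ranked.

(** * Clauses on a grid of tiles *)

Definition tstate : finType := (bool * bool)%type.
(** Six variables for each tile: one for each state, and one for each of the ports on its east and
    north sides. *)
Definition vkind : finType := (tstate + bool)%type.
Definition ckind : finType := (unit + (tstate + tstate * bool))%type.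
Definition some_state : ckind := inl tt.
Definition unit_clause (s : tstate) : ckind := inr (inl s).
Definition port_clause (s : tstate) (d : bool) : ckind := inr (inr (s, d)).

(* A tile is in one of four states (a, b): whether it carries the signal that
   runs eastwards in its row, and the one that runs northwards in its column;
   the direction [true] stands for the former. The port of a tile on its east
   (north) side is forced up by the tile, and forces up the next one. *)
Section Tiles.
Variables (X H : nat).
Variables (dis : nat -> nat -> tstate -> bool) (free : nat -> nat -> tstate -> bool -> bool).

Definition variable : eqType := (nat * nat * vkind)%type.
Definition clause : eqType := (nat * nat * ckind)%type.

Definition in_grid (p : nat * nat) := (p.1 < X) && (p.2 < H).
Definition var_in (u : variable) := in_grid u.1.
Definition clause_in (c : clause) := in_grid c.1.

Definition carries (s : tstate) (d : bool) : bool := if d then s.1 else s.2.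

Definition behind (p : nat * nat) (d : bool) := if d then (p.1.-1, p.2) else (p.1, p.2.-1).
Definition has_behind (p : nat * nat) (d : bool) := if d then 0 < p.1 else 0 < p.2.

(* Clauses: some state holds; a disabled state does not; a state that carries a
   signal forces the port ahead; a state that does not is excluded by the port
   behind. A clause is switched off by adding the complementary literal. *)
Definition occurs (c : clause) (u : variable) (b : bool) : bool :=
  let: (p, k) := c in let: (p', v) := u in
  match k, v with
  | inl tt, inl _ => (p' == p) && b
  | inr (inl s), inl s' => [&& p' == p, s' == s & ~~ b || ~~ dis p.1 p.2 s]
  | inr (inr (s, d)), inl s' => [&& p' == p, s' == s & ~~ b || free p.1 p.2 s d]
  | inr (inr (s, d)), inr d' =>
      (d' == d) && (if carries s d then (p' == p) && b
                    else [&& has_behind p d, p' == behind p d & ~~ b])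
  | _, _ => false
  end.

Hypothesis border_free : forall p s d,
  ~~ has_behind p d -> ~~ carries s d -> free p.1 p.2 s d.

Lemma behind_in p d : in_grid p -> in_grid (behind p d).
Proof. by case: p => x y; rewrite /in_grid /behind; case: d => /=; lia. Qed.

Record tiling := Tiling { st : nat * nat -> tstate; port : nat * nat -> bool -> bool }.

Definition assignment (c : tiling) : variable -> bool :=
  fun u => in_grid u.1 && match u.2 with inl s => st c u.1 == s | inr d => port c u.1 d end.

Definition valid (c : tiling) : Prop := forall p, in_grid p ->
  ~~ dis p.1 p.2 (st c p) /\ forall d, ~~ free p.1 p.2 (st c p) d ->
  if carries (st c p) d then port c p d else ~~ port c (behind p d) d.

(** Tiles nearer to the far corner come first, and within a tile the ports, then the new state, then
    the old one. A port that is switched on excludes the states of the tile ahead that lack the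
    signal, so that tile must have changed before; and a state that carries a signal needs its port
    on. The factor 4 exceeds the ranks within a tile. *)
Definition var_rank (c : tiling) (u : variable) : nat :=
  4 * ((X - u.1.1) + (H - u.1.2)) +
  match u.2 with inr _ => 0 | inl s => if st c u.1 == s then 2 else 1 end.

Definition all_vars : seq variable :=
  flatten [seq [seq ((x, y), v) | y <- iota 0 H, v <- enum vkind] | x <- iota 0 X].

Definition step_of := flip_step var_in clause_in occurs.

Lemma all_varsP u : var_in u -> u \in all_vars.
Proof.
case: u => [[x y] v] /andP[/= xX yH].
apply/flattenP; exists [seq ((x, y'), v') | y' <- iota 0 H, v' <- enum vkind].
  by apply/mapP; exists x; rewrite ?mem_iota.
by apply/allpairsP; exists (y, v); rewrite /= mem_iota mem_enum.
Qed.

(** Ports are only switched on here, which makes the rank order safe; switching off is obtained by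
    reversing such a passage. *)
Lemma valid_reach c c' : valid c -> valid c' ->
  (forall p d, in_grid p -> port c p d -> port c' p d) ->
  reach step_of (assignment c) (assignment c').
Proof.
move=> vc vc' mono.
apply: (@ranked_reach _ _ _ _ _ all_vars (var_rank c)); first exact: all_varsP.
  by move=> u /negPf uout; rewrite /assignment -/(var_in u) uout.
move=> [p k]; rewrite /clause_in /= => pin.
have aP s : assignment c (p, inl s) = (st c p == s) by rewrite /assignment /= pin.
have aP' s : assignment c' (p, inl s) = (st c' p == s) by rewrite /assignment /= pin.
have [nd nf] := vc p pin; have [nd' nf'] := vc' p pin.
case: k => [[]|[s|[s d]]].
- have [e|ne] := eqVneq (st c p) (st c' p).
    by left; exists (p, inl (st c p)); rewrite aP aP' /= e !eqxx.
  right; exists (p, inl (st c p)), (p, inl (st c' p)).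
  rewrite aP aP' /= !eqxx /var_rank /= eqxx (negPf ne); split=> //.
  by rewrite ltn_add2l.
- left; exists (p, inl s); rewrite aP aP' /= !eqxx; split=> //.
    by case: eqP nd => [->->|]; rewrite ?orbT.
  by case: eqP nd' => [->->|]; rewrite ?orbT.
have [fr|nfr] := boolP (free p.1 p.2 s d).
  by left; exists (p, inl s); rewrite aP aP' /= !eqxx ?fr !orbT.
have [es|ns] := boolP ((st c p == s) || (st c' p == s)); last first.
  left; exists (p, inl s); move: ns; rewrite negb_or aP aP' /= !eqxx => /andP[-> ->].
  by split.
have [cs|ncs] := boolP (carries s d).
  have aE a0 : assignment a0 (p, inr d) = port a0 p d by rewrite /assignment /= pin.
  have [pt|npt] := boolP (port c p d).
    left; exists (p, inr d); rewrite !aE pt (mono p d pin pt) /= ?cs !eqxx; split=> //.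
  have ns : st c p != s.
    by apply: contraNneq npt => e; have := nf d; rewrite e cs => /(_ nfr).
  rewrite (negPf ns) /= in es.
  have pt' : port c' p d by have := nf' d; rewrite (eqP es) cs => /(_ nfr).
  right; exists (p, inl s), (p, inr d); rewrite !aE aP /= pt' (negPf ns) ?cs !eqxx.
  by split=> //; rewrite /var_rank /= (negPf ns) ltn_add2l.
have hp : has_behind p d by apply: contraNT nfr => nhp; apply: border_free.
have ppin := behind_in d pin.
have aE a0 : assignment a0 (behind p d, inr d) = port a0 (behind p d) d by rewrite /assignment /= ppin.
have [es'|ns'] := boolP (st c' p == s).
  have npt' : ~~ port c' (behind p d) d by have := nf' d; rewrite (eqP es') ?(negPf ncs) => /(_ nfr).
  have npt : ~~ port c (behind p d) d by apply: contra npt'; apply: mono.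
  left; exists (behind p d, inr d); rewrite !aE (negPf npt) (negPf npt') /= ?(negPf ncs) !eqxx hp.
  by split.
rewrite (negPf ns') orbF in es.
have npt : ~~ port c (behind p d) d by have := nf d; rewrite (eqP es) ?(negPf ncs) => /(_ nfr).
right; exists (behind p d, inr d), (p, inl s); rewrite aE aP' (negPf npt) (negPf ns') /= ?(negPf ncs) !eqxx hp.
split=> //; rewrite /var_rank /= es.
move: hp pin; rewrite /behind /has_behind /in_grid; case: (p) => x y; case: d {nf nf' nfr ncs ppin aE npt} => /= ? ?; lia.
Qed.

Lemma valid_satisfies c : valid c -> satisfies var_in clause_in occurs (assignment c).
Proof.
move=> vc [p k]; rewrite /clause_in /= => pin; have [nd nf] := vc p pin.
have aP s : assignment c (p, inl s) = (st c p == s) by rewrite /assignment /= pin.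
case: k => [[]|[s|[s d]]].
- by exists (p, inl (st c p)); rewrite ?aP //= !eqxx.
- exists (p, inl s); rewrite ?aP //= !eqxx /=.
  by case: eqP nd => [->->|]; rewrite ?orbT.
have [fr|nfr] := boolP (free p.1 p.2 s d).
  by exists (p, inl s); rewrite ?aP //= !eqxx ?fr !orbT.
have [e|ns] := eqVneq (st c p) s; last first.
  by exists (p, inl s); rewrite ?aP //= !eqxx (negPf ns).
have := nf d; rewrite e => /(_ nfr); have [cs|ncs] := boolP (carries s d) => pt.
  by exists (p, inr d) => //=; rewrite /assignment /= pin pt ?cs !eqxx.
have hp : has_behind p d by apply: contraNT nfr => nhp; apply: border_free.
exists (behind p d, inr d); first exact: behind_in.
by rewrite /assignment /= behind_in // (negPf pt) ?(negPf ncs) hp !eqxx.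
Qed.

Lemma satisfies_state a p : satisfies var_in clause_in occurs a -> in_grid p ->
  exists s, a (p, inl s).
Proof.
move=> sa pin; have [[p' v] _ /=] := sa (p, some_state) pin.
by case: v => // s /andP[/eqP-> as_]; exists s.
Qed.

Lemma satisfies_tile a p s : satisfies var_in clause_in occurs a -> in_grid p ->
  a (p, inl s) ->
  ~~ dis p.1 p.2 s /\ forall d, ~~ free p.1 p.2 s d ->
  if carries s d then a (p, inr d) else ~~ a (behind p d, inr d).
Proof.
move=> sa pin ps; split.
  have [[p' v] _ /=] := sa (p, unit_clause s) pin.
  by case: v => // s' /and3P[/eqP-> /eqP->]; rewrite ps.
move=> d nfr; have [[p' v] _ /=] := sa (p, port_clause s d) pin.
case: v => [s' /and3P[/eqP-> /eqP->]|d' /andP[/eqP->]]; first by rewrite ps (negPf nfr).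
by case: ifP => _ => [/andP[/eqP->]|/and3P[_ /eqP->]].
Qed.

Lemma step_of_sym a a' : step_of a a' -> step_of a' a.
Proof. exact: flip_step_sym. Qed.

End Tiles.

(** * Words with constraints between adjacent letters as tilings *)

Section Words.
Variables (m W : nat) (R : bool -> nat -> nat -> bool).
Hypothesis m_gt0 : 0 < m.

Definition word_ok (w : nat -> nat) : Prop :=
  (forall i, i < W -> w i < m) /\
  (forall i, 0 < i -> i < W -> R (odd i) (w i.-1) (w i)).

Definition word_step (w w' : nat -> nat) : Prop :=
  [/\ word_ok w, word_ok w' & exists2 i, i < W & exists a, w' = upd w i a].

Definition pos x := x %/ m.
Definition sy x := x %% m.

(* Row 0 selects a letter for each position; above it come two bands of [m]
   rows, which carry the letters of the even and of the odd positions to the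
   block of the next position. *)
Definition band y := m < y.
Definition ridx y := if band y then y - m.+1 else y.-1.
Definition own x y := band y == odd (pos x).
Definition height := (2 * m).+1.

(** In row 0 the eastward signal says that a letter is still to be selected: it is present in the
    first column of each block and cannot leave the last one unless a northward signal starts there.
    In the band of the parity of the block, a northward signal in the column of a letter starts the
    eastward signal in the row of that letter. In the other band, the two signals may cross only if
    [R] allows the two letters side by side. *)
Definition dis (x y : nat) (s : tstate) : bool :=
  if y == 0 then (sy x == 0) && ~~ s.1 || [&& sy x == m.-1, s.1 & ~~ s.2]
  else if own x y then [&& ridx y == sy x, ~~ s.1 & s.2]
  else [&& s.1, s.2 & ~~ R (odd (pos x)) (ridx y) (sy x)].

(** The eastward signal may end where row 0 selects a letter and, in the band of the preceding
    position, in the last column of a block. The other cases are the borders of the grid, where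
    signals may start or end freely. *)
Definition exempt (x y : nat) (s : tstate) (d : bool) : bool :=
  if d then
    if s.1 then (if y == 0 then s.2 else ~~ own x y && (sy x == m.-1)) else x == 0
  else if s.2 then y == 2 * m else y == 0.

Lemma border_free (p : nat * nat) s d : ~~ has_behind p d -> ~~ carries s d -> exempt p.1 p.2 s d.
Proof. by case: p => x y; case: d; rewrite /exempt /= lt0n negbK => -> /negPf->. Qed.

Lemma pos_sy x : x = pos x * m + sy x. Proof. exact: divn_eq. Qed.

Lemma sy_lt x : sy x < m. Proof. by rewrite ltn_mod. Qed.

Lemma pos_mk i b : b < m -> pos (i * m + b) = i.
Proof. by move=> lt; rewrite /pos divnMDl // divn_small // addn0. Qed.

Lemma sy_mk i b : b < m -> sy (i * m + b) = b.
Proof. by move=> lt; rewrite /sy modnMDl modn_small. Qed.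

Lemma pos_pred x : 0 < sy x -> pos x.-1 = pos x /\ sy x.-1 = (sy x).-1.
Proof.
move=> s0; have e : x.-1 = pos x * m + (sy x).-1 by rewrite {1}(pos_sy x); lia.
have lt : (sy x).-1 < m by have := sy_lt x; lia.
by rewrite e pos_mk // sy_mk.
Qed.

Lemma pos_pred0 x : 0 < x -> sy x = 0 -> [/\ 0 < pos x, pos x.-1 = (pos x).-1 & sy x.-1 = m.-1].
Proof.
move=> x0 s0; have e := pos_sy x; rewrite s0 addn0 in e.
have p0 : 0 < pos x by case: (pos x) e x0 => // ->.
have e1 : x.-1 = (pos x).-1 * m + m.-1 by case: (pos x) e p0 => // k -> _; rewrite mulSn /=; lia.
by rewrite e1 pos_mk ?sy_mk //; lia.
Qed.

Section Tiling.
Variables (S : nat -> nat -> bool) (z : nat -> nat).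

(** The letters [b] with [S i b] are raised as signals at position [i], while [z i] is the one
    selected in row 0. A set of raised letters is needed because the old and the new letter are both
    raised during a change. *)
Definition row_signal x y : bool :=
  if own x y then S (pos x) (ridx y) && (ridx y <= sy x)
  else (0 < pos x) && S (pos x).-1 (ridx y).

Definition word_tiling : tiling := Tiling
  (fun p => let: (x, y) := p in
     if y == 0 then (sy x <= z (pos x), sy x == z (pos x)) else (row_signal x y, S (pos x) (sy x)))
  (fun p d => let: (x, y) := p in
     if d then
       if y == 0 then sy x < z (pos x)
       else row_signal x y && ~~ (~~ own x y && (sy x == m.-1))
     else S (pos x) (sy x)).

Definition consistent : Prop :=
  [/\ forall i, i < W -> z i < m /\ S i (z i),
      forall i b, i < W -> S i b -> b < m &
      forall i r b, 0 < i -> i < W -> S i.-1 r -> S i b -> R (odd i) r b].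

Lemma pos_lt x : x < W * m -> pos x < W.
Proof. by move=> lt; rewrite /pos ltn_divLR. Qed.

Lemma word_tiling_valid : consistent -> valid (W * m) height dis exempt word_tiling.
Proof.
move=> [zP SP RP] [x y] /andP[/= xX yH]; have iW := pos_lt xX; have [zm Sz] := zP _ iW.
have syx := sy_lt x.
have [->|y0] := eqVneq y 0.
  rewrite /dis /=; split=> /=.
    by case: ltngtP; lia.
  case=> /=; rewrite /exempt /=.
    case: (leqP (sy x) (z (pos x))) => le /=; first by rewrite ltn_neqAle le andbT.
    move=> x0; have s0 : 0 < sy x by lia.
    by have [-> ->] := pos_pred s0; lia.
  by case: eqP => // ->; rewrite Sz.
rewrite /dis /exempt /= (negPf y0); split.
  have [ow|nown] := boolP (own x y).
    apply/negP => /and3P[/eqP e]; rewrite /row_signal ow e leqnn andbT.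
    by move/negPf => ->.
  apply/negP => /and3P[]; rewrite /row_signal (negPf nown) => /andP[i0 S1] S2 /negP; apply.
  exact: RP.
case=> /=.
  case: ifP => [rs -> //|nrs x0].
  rewrite (negPf y0); apply/negP => /andP[rs' ncut]; move: nrs rs' ncut; rewrite /row_signal.
  (* Across a block border the bands exchange their roles: the signal of the own band continues in
     the band of the preceding position, and the signal that was already there has been cut. *)
  case: (posnP (sy x)) => s0.
    have x1 : 0 < x by rewrite lt0n.
    have [i0 e1 e2] := pos_pred0 x1 s0.
    have eo : own x.-1 y = ~~ own x y.
      by rewrite /own e1; case: (pos x) i0 => //= n _; case: odd; case: band.
    rewrite eo e1 e2 eqxx; case: (own x y) => //=.
    by rewrite i0 /= => ->.
  have [e1 e2] := pos_pred s0; rewrite /own e1 e2 -/(own x y).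
  case: (own x y) => /=; last by move=> ->.
  by move=> n /andP[Sr le] _; move: n; rewrite Sr /=; lia.
by case: ifP => // nS _; rewrite nS.
Qed.

End Tiling.

Local Notation asg S z := (assignment (W * m) height (word_tiling S z)).
Local Notation tile_step := (step_of (W * m) height dis exempt).

Definition word_assignment (w : nat -> nat) := asg (fun i b => w i == b) w.

Lemma consistent_word w : word_ok w -> consistent (fun i b => w i == b) w.
Proof.
move=> [wm wR]; split=> [i iW|i b iW /eqP<-|i r b i0 iW /eqP<- /eqP<-]; first by rewrite eqxx wm.
  exact: wm.
exact: wR.
Qed.

Lemma word_satisfies w : word_ok w ->
  satisfies (var_in (W * m) height) (clause_in (W * m) height) (occurs dis exempt) (word_assignment w).
Proof.
by move=> ok; apply: valid_satisfies border_free _ (word_tiling_valid (consistent_word ok)).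
Qed.

Lemma tiling_reach S S' z z' : consistent S z -> consistent S' z' ->
  (forall i b, i < W -> S i b -> S' i b) -> (forall i, i < W -> z i <= z' i) ->
  reach tile_step (asg S z) (asg S' z').
Proof.
move=> c c' SS zz.
apply: (valid_reach border_free (word_tiling_valid c) (word_tiling_valid c')).
move=> [x y] d /andP[/= xX _]; have iW := pos_lt xX.
case: d => /=; last exact: SS.
case: ifP => _; first by move/leq_trans; apply; apply: zz.
case/andP => rs ->; rewrite andbT; move: rs; rewrite /row_signal.
case: ifP => _ /andP[h1 h2]; first by rewrite (SS _ _ iW h1).
by rewrite h1 SS //; lia.
Qed.

(** The new letter is raised, the selection in row 0 passes to it, and the old letter is lowered.
    Lowering a letter and moving the selection to the west are reversals of the monotone passages of
    [tiling_reach]. *)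
Lemma word_step_reach w w' : word_step w w' ->
  reach tile_step (word_assignment w) (word_assignment w').
Proof.
move=> [ok ok' [i iW [a ew']]].
have [[wm wR] [wm' wR']] := (ok, ok').
pose S1 k b := (w k == b) || (w' k == b).
have ek k : k != i -> w' k = w k by move=> ki; rewrite ew' upd_other.
have c1 z : z = w \/ z = w' -> consistent S1 z.
  move=> zw; split.
  - by move=> k kW; case: zw => ->; rewrite /S1 ?wm ?wm' // eqxx ?orbT.
  - by move=> k b kW /orP[]/eqP<-; [apply: wm | apply: wm'].
  - move=> k r b k0 kW; have [e|ki] := eqVneq k i.
      have e' : w' k.-1 = w k.-1 by apply: ek; lia.
      rewrite /S1 e' orbb => /eqP<- /orP[]/eqP<-; first exact: wR.
      by rewrite -e'; apply: wR'.
    rewrite /S1 (ek _ ki) orbb => + /eqP<- => /orP[]/eqP<-; first exact: wR.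
    by rewrite -(ek _ ki); apply: wR'.
have cw := consistent_word ok; have cw' := consistent_word ok'.
have sym := reach_sym (@step_of_sym (W * m) height dis exempt).
apply: reach_trans (tiling_reach cw (c1 w _) _ _) _; auto.
  by move=> k b _; rewrite /S1 => ->.
apply: reach_trans (_ : reach _ _ (asg S1 w')) (sym _ _ (tiling_reach cw' (c1 w' _) _ _)); auto; last first.
  by move=> k b _; rewrite /S1 => ->; rewrite orbT.
have [le|lt] := leqP (w i) (w' i); last apply: sym.
all: apply: tiling_reach => //; try (by apply: c1; auto); move=> k _; have [->|ki] := eqVneq k i;
  rewrite ?(ek _ ki) //; lia.
Qed.

Section Soundness.
Variable a : variable -> bool.
Hypothesis sa :
  satisfies (var_in (W * m) height) (clause_in (W * m) height) (occurs dis exempt) a.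

Definition letter i b := a ((i * m + b, 0), inr false).

Lemma block_in i b y : i < W -> b < m -> y <= 2 * m -> in_grid (W * m) height (i * m + b, y).
Proof.
move=> iW bm yH; rewrite /in_grid /= ltnS yH andbT.
by apply: leq_trans (_ : i.+1 * m <= _); [rewrite mulSn; lia | rewrite leq_mul2r iW orbT].
Qed.

(** If no letter of the block were raised, no tile of the block in row 0 could carry a northward
    signal, and the eastward one would be forced through all columns in state [(true, false)], which
    the last column forbids. *)
Lemma some_letter i : i < W -> exists2 b, b < m & letter i b.
Proof.
move=> iW; apply: contrapT => none.
have noN b : b < m -> ~~ letter i b by move=> bm; apply/negP => ?; apply: none; exists b.
have y0 : (0 == 2 * m) = false by lia.
have pass b : b < m -> forall s, a ((i * m + b, 0), inl s) -> s = (true, false).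
  elim: b => [|b IH] bm s as_.
    have [+ nf] := satisfies_tile sa (block_in iW bm (leq0n _)) as_.
    rewrite /dis /= sy_mk // eqxx /=; case: s nf as_ => [[] []] //= nf as_.
    have := nf false; rewrite /exempt /= y0 => /(_ isT) n.
    by have := noN 0 bm; rewrite /letter n.
  have [_ nf] := satisfies_tile sa (block_in iW bm (leq0n _)) as_.
  have bm' : b < m by lia.
  have [s' as'] := satisfies_state sa (block_in iW bm' (leq0n _)).
  have [_ nf'] := satisfies_tile sa (block_in iW bm' (leq0n _)) as'.
  have es' := IH bm' _ as'; subst s'.
  have Eb := nf' true; rewrite /exempt /= in Eb; have {}Eb := Eb isT.
  case: s as_ nf => [[] []] //= as_ nf.
  - have := nf false; rewrite /exempt /= y0 => /(_ isT) n.
    by have := noN _ bm; rewrite /letter n.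
  - by have := nf true; rewrite /exempt /= addnS /= Eb => /(_ isT).
  - by have := nf true; rewrite /exempt /= addnS /= Eb => /(_ isT).
have lt : m.-1 < m by lia.
have [s as_] := satisfies_state sa (block_in iW lt (leq0n _)).
have [+ _] := satisfies_tile sa (block_in iW lt (leq0n _)) as_.
by rewrite (pass _ lt _ as_) /dis /= sy_mk // eqxx orbT.
Qed.

Lemma column_up i b y s : i < W -> b < m -> letter i b -> 0 < y -> y <= 2 * m ->
  a ((i * m + b, y), inl s) -> s.2.
Proof.
move=> iW bm ib; elim: y s => // y IH s _ yH as_.
suff ny : a ((i * m + b, y), inr false).
  have [_ nf] := satisfies_tile sa (block_in iW bm yH) as_.
  by have := nf false; rewrite /exempt /=; case: (s.2) => //=; rewrite ny => /(_ isT).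
case: y IH yH {as_} => [//|y] IH yH.
have yH' : y.+1 <= 2 * m by lia.
have [s' as'] := satisfies_state sa (block_in iW bm yH').
have [_ nf'] := satisfies_tile sa (block_in iW bm yH') as'.
have := nf' false; rewrite /exempt /= (IH _ (ltn0Sn _) yH' as'); apply; lia.
Qed.

(** The letter [r] starts an eastward signal in its row, which is forced on to column [b] of the
    next block. There it meets the northward signal of [b], and such a crossing is enabled only by
    [R]. *)
Lemma letters_ok i r b : 0 < i -> i < W -> r < m -> b < m -> letter i.-1 r -> letter i b ->
  R (odd i) r b.
Proof.
move=> i0 iW rm bm ir ib.
(* The row of [r] in the band of position [i.-1]: rows [1] to [m] serve even positions, rows [m.+1]
   to [2 * m] odd ones. *)
pose Y := if odd i.-1 then m.+1 + r else r.+1.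
have Y0 : Y != 0 by rewrite /Y; case: odd.
have YH : Y <= 2 * m by rewrite /Y; case: odd; lia.
have bY : band Y = odd i.-1 by rewrite /band /Y; case: odd; lia.
have rY : ridx Y = r by rewrite /ridx bY /Y; case: odd => //=; rewrite addKn.
have iW' : i.-1 < W by lia.
have ownY x : own x Y = (odd i.-1 == odd (pos x)) by rewrite /own bY.
have oi : odd i.-1 = ~~ odd i by case: (i) i0 => //= n _; rewrite negbK.
have east k : i.-1 * m + r + k <= i * m + b ->
    forall s, a ((i.-1 * m + r + k, Y), inl s) -> s.1.
  elim: k => [|k IH] le s as_.
    rewrite addn0 in as_.
    have s2 := column_up iW' rm ir (_ : 0 < Y) YH as_.
    have [+ _] := satisfies_tile sa (block_in iW' rm YH) as_.
    rewrite /dis /= (negPf Y0) ownY pos_mk // eqxx rY sy_mk // eqxx /=.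
    by rewrite s2 ?lt0n // andbT negbK.
  set x := i.-1 * m + r + k.
  have gridx x' : x' <= i * m + b -> in_grid (W * m) height (x', Y).
    move=> lx; have := block_in iW bm YH; rewrite /in_grid /=; lia.
  have lx : x <= i * m + b by rewrite /x; lia.
  have [s' as'] := satisfies_state sa (gridx _ lx).
  have s'1 := IH lx _ as'.
  have [_ nf'] := satisfies_tile sa (gridx _ lx) as'.
  have Ex : a ((x, Y), inr true).
    have := nf' true; rewrite /exempt /= s'1 (negPf Y0); apply.
    (* The signal may be cut only in the last column of block [i], which is not before column
       [b]. *)
    rewrite ownY; apply/negP => /andP[no /eqP sx].
    have px : pos x = i.
      have e := pos_sy x.
      have ile : i <= (pos x).+1.
        have : i.-1 * m < (pos x).+1 * m by rewrite mulSn; have := sy_lt x; lia.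
        by rewrite ltn_mul2r => /andP[_]; lia.
      have ige : pos x <= i.
        have : pos x * m < i.+1 * m by rewrite mulSn; lia.
        by rewrite ltn_mul2r => /andP[_]; lia.
      have [//|ne] := eqVneq (pos x) i.
      have e1 : pos x = i.-1 by lia.
      by rewrite e1 eqxx in no.
    have := pos_sy x; rewrite px sx => e; move: le; rewrite addnS -/x e.
    lia.
  rewrite addnS -/x in as_ le.
  have [_ nf] := satisfies_tile sa (gridx _ le) as_.
  by have := nf true; rewrite /exempt /=; case: (s.1) => //=; rewrite Ex => /(_ isT).
have [s as_] := satisfies_state sa (block_in iW bm YH).
have [+ _] := satisfies_tile sa (block_in iW bm YH) as_.
have s1 : s.1.
  have le : i.-1 * m + r <= i * m + b.
    by case: (i) i0 => //= n _; rewrite mulSn; lia.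
  apply: (east (i * m + b - (i.-1 * m + r))); rewrite subnKC //.
have s2 : s.2 by apply: column_up ib _ YH as_ => //; rewrite lt0n.
rewrite /dis /= (negPf Y0) ownY pos_mk // oi sy_mk // rY s1 s2 /=.
by case: odd => /=; rewrite negbK.
Qed.

End Soundness.

(** Invariant: every word whose letters are all raised in the current assignment is reachable. A
    flip raises at most one new letter, at one position; by [some_letter] another letter was raised
    there before the flip, and putting it in place gives a reachable word one change away. *)
Lemma reach_word w0 w : word_ok w0 -> word_ok w -> (forall i, W <= i -> w i = w0 i) ->
  reach tile_step (word_assignment w0) (word_assignment w) -> reach word_step w0 w.
Proof.
move=> ok0 ok out r.
pose tracked a := forall v, (forall i, i < W -> v i < m /\ letter a i (v i)) ->
  (forall i, W <= i -> v i = w0 i) -> reach word_step w0 v.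
have letterE v i b : i < W -> b < m -> letter (word_assignment v) i b = (v i == b).
  move=> iW bm; rewrite /letter /word_assignment /assignment block_in //=.
  by rewrite pos_mk // sy_mk.
have t0 : tracked (word_assignment w0).
  move=> v lv vout; have -> : v = w0; last exact: reach_refl.
  apply/funext => i; case: (ltnP i W) => [iW|/vout //].
  by have [vm] := lv i iW; rewrite letterE // => /eqP.
suff step a a' : tile_step a a' -> tracked a -> tracked a'.
  have tw : tracked (word_assignment w).
    elim: r t0 => // a1 a2 a3 s12 _ IH t1; exact: IH (step _ _ s12 t1).
  apply: tw => // i iW; have wm := ok.1 i iW; rewrite wm; split=> //.
  by rewrite letterE.
move=> [sa sa' [u uin ea']] ta v lv vout.
have okl b v' : satisfies (var_in (W * m) height) (clause_in (W * m) height) (occurs dis exempt) b ->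
    (forall i, i < W -> v' i < m /\ letter b i (v' i)) -> word_ok v'.
  move=> sb lv'; split=> [i /lv'[]//|i i0 iW].
  have iW' : i.-1 < W by lia.
  have [m1 l1] := lv' _ iW'; have [m2 l2] := lv' _ iW.
  exact: (letters_ok sb i0 iW m1 m2 l1 l2).
have [all|/existsNP[i]] := EM (forall i, i < W -> letter a i (v i)).
  by apply: ta => // i iW; split; [case: (lv i iW) | apply: all].
move/not_implyP => [iW nl].
have [vm l'] := lv i iW.
have eu : u = ((i * m + v i, 0), inr false).
  apply/eqP/negPn/negP => ne; apply: nl; move: l'; rewrite /letter ea' /flip.
  by rewrite eq_sym (negPf ne).
have [c cm lc] := some_letter sa iW.
pose v1 := upd v i c.
have lv1 k : k < W -> v1 k < m /\ letter a k (v1 k).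
  move=> kW; rewrite /v1 updE; case: eqP => [->//|ki]; have [vkm lk] := lv k kW; split=> //.
  move: lk; rewrite /letter ea' /flip eu; case: eqP => // -[e].
  have := congr1 pos e; rewrite !pos_mk // => ek; by rewrite ek in ki.
have r1 : reach word_step w0 v1.
  apply: ta => // k Wk; rewrite /v1 upd_other ?vout //; lia.
apply: reach_last r1 _; split; [exact: (okl _ _ sa lv1) | exact: (okl _ _ sa' lv) | exists i => //].
exists (v i); rewrite /v1 upd_upd upd_id //.
Qed.

Lemma word_reach w0 w : word_ok w0 -> reach word_step w0 w ->
  reach tile_step (word_assignment w0) (word_assignment w).
Proof.
move=> _; elim=> {w0 w} [w|w1 w2 w3 s _ IH]; first exact: reach_refl.
exact: reach_trans (word_step_reach s) IH.
Qed.

End Words.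

(** * Two-cell rewriting by changes of single letters *)

Section Rewriting.
Variables (G : finType) (step2 : G -> G -> option (G * G)) (N : nat).
Variables (firstk lastk : pred G).
Hypothesis step2_kind : forall x y z w, step2 x y = Some (z, w) ->
  [/\ ~~ lastk x && ~~ lastk z, ~~ firstk y && ~~ firstk w,
      firstk x = firstk z & lastk y = lastk w].

Definition rewrites (g g' : nat -> G) : Prop :=
  exists i z w, [/\ i.+1 < N, step2 (g i) (g i.+1) = Some (z, w) &
    g' = upd (upd g i z) i.+1 w].

Definition rewrites_sym g g' := rewrites g g' \/ rewrites g' g.

(* Each cell is written twice, which locks its content. Applying a rule to two
   adjacent cells replaces the right copy of the first and the left copy of the
   second by markers, whose phase goes from 0 to 2; the outer copies may change
   in phase 1 only, and the rule takes effect when the left copy of the second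
   cell enters phase 1. *)
Definition symbol : finType := (G + (G * G) * 'I_3)%type.

Definition lft (rho : G * G) : G := if step2 rho.1 rho.2 is Some (z, _) then z else rho.1.
Definition rgt (rho : G * G) : G := if step2 rho.1 rho.2 is Some (_, w) then w else rho.2.

Definition in_cell (l r : symbol) : bool :=
  match l, r with
  | inl g, inl h => g == h
  | inl g, inr (rho, k) =>
      step2 rho.1 rho.2 && ((k != 2 :> nat) && (g == rho.1) || (k != 0 :> nat) && (g == lft rho))
  | inr (rho, k), inl h =>
      step2 rho.1 rho.2 && ((k != 2 :> nat) && (h == rho.2) || (k != 0 :> nat) && (h == rgt rho))
  | inr _, inr _ => false
  end.

(** The marker in the first cell leads: it appears first, in phase 0, is at most one phase ahead of
    the other, and is the first to dissolve, when the other is in phase 2. *)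
Definition between (r l : symbol) : bool :=
  match r, l with
  | inl _, inl _ => true
  | inr (rho, k), inl h => (k == 0 :> nat) && (h == rho.2)
  | inl g, inr (rho, k) => (k == 2 :> nat) && (g == lft rho)
  | inr (rho, k), inr (rho', k') => (rho == rho') && ((k == k' :> nat) || (k == k'.+1 :> nat))
  end.

Definition compat (e : bool) := if e then in_cell else between.

Definition good (s : nat -> symbol) : Prop :=
  forall i, 0 < i -> i < N.*2 -> compat (odd i) (s i.-1) (s i).

Definition symbol_step (s s' : nat -> symbol) : Prop :=
  [/\ good s, good s' & exists2 i, i < N.*2 & exists a, s' = upd s i a].

Definition spread (g : nat -> G) : nat -> symbol := fun p => inl (g p./2).

Definition is_plain (a : symbol) : bool := if a is inl _ then true else false.

Lemma good_spread g : good (spread g).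
Proof.
move=> i i0 _; rewrite /compat /spread; case: ifP => //= oi; apply/eqP.
by congr g; lia.
Qed.

Definition quad g i p0 p1 p2 p3 : nat -> symbol :=
  fun j => if j == i.*2 then p0 else if j == i.*2.+1 then p1
           else if j == i.*2.+2 then p2 else if j == i.*2.+3 then p3 else spread g j.

Lemma good_quad g i p0 p1 p2 p3 : i.+1 < N ->
  is_plain p0 -> is_plain p3 -> in_cell p0 p1 -> between p1 p2 -> in_cell p2 p3 ->
  good (quad g i p0 p1 p2 p3).
Proof.
move=> iN pl0 pl3 c01 c12 c23 j j0 jN.
have plain_between a b : is_plain a -> is_plain b -> between a b by case: a b => [?|?] [?|?].
have spread_ok : compat (odd j) (spread g j.-1) (spread g j) by apply: (@good_spread g).
have plainP k : is_plain (spread g k) by [].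
have q0 : quad g i p0 p1 p2 p3 i.*2 = p0 by rewrite /quad eqxx.
have q1 : quad g i p0 p1 p2 p3 i.*2.+1 = p1.
  by rewrite /quad eqxx; case: eqP => [?|_]; first by lia.
have q2 : quad g i p0 p1 p2 p3 i.*2.+2 = p2.
  by rewrite /quad eqxx; do 2 (case: eqP => [?|_]; first by lia).
have q3 : quad g i p0 p1 p2 p3 i.*2.+3 = p3.
  by rewrite /quad eqxx; do 3 (case: eqP => [?|_]; first by lia).
have qout k : k < i.*2 \/ i.*2.+3 < k -> quad g i p0 p1 p2 p3 k = spread g k.
  by move=> o; rewrite /quad; do 4 (case: eqP => [?|_]; first by lia).
have [lt|ge] := ltnP j i.*2; first by rewrite !qout //; lia.
have [gt|le] := ltnP i.*2.+4 j; first by rewrite !qout //; lia.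
have [e|n0] := eqVneq j i.*2.
  by rewrite e q0 qout ?odd_double; [apply: plain_between | lia].
have [->|n1] := eqVneq j i.*2.+1; first by rewrite /= q0 q1 odd_double.
have [->|n2] := eqVneq j i.*2.+2; first by rewrite /= q1 q2 negbK odd_double.
have [->|n3] := eqVneq j i.*2.+3; first by rewrite /= q2 q3 negbK odd_double.
have -> : j = i.*2.+4 by lia.
rewrite [_.-1]/= q3 qout; last by lia.
by rewrite /= !negbK odd_double; apply: plain_between.
Qed.

Lemma quad_step g i p0 p1 p2 p3 q0 q1 q2 q3 : i.+1 < N ->
  is_plain p0 -> is_plain p3 -> in_cell p0 p1 -> between p1 p2 -> in_cell p2 p3 ->
  is_plain q0 -> is_plain q3 -> in_cell q0 q1 -> between q1 q2 -> in_cell q2 q3 ->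
  [|| [&& p1 == q1, p2 == q2 & p3 == q3], [&& p0 == q0, p2 == q2 & p3 == q3],
      [&& p0 == q0, p1 == q1 & p3 == q3] | [&& p0 == q0, p1 == q1 & p2 == q2]] ->
  symbol_step (quad g i p0 p1 p2 p3) (quad g i q0 q1 q2 q3).
Proof.
move=> iN; have bnd : i.*2.+3 < N.*2 by lia.
move=> *; split; [exact: good_quad | exact: good_quad | ].
match goal with h : is_true [|| _, _, _ | _] |- _ => case/or4P: h => /and3P[/eqP-> /eqP-> /eqP->] end; clear -bnd.
- exists i.*2; first by lia.
  by exists q0; apply/funext => j; rewrite updE /quad; case: eqP.
- exists i.*2.+1; first by lia.
  exists q1; apply/funext => j; rewrite updE /quad; case: (j =P i.*2.+1) => // ->.
  by case: eqP => //; lia.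
- exists i.*2.+2; first by lia.
  exists q2; apply/funext => j; rewrite updE /quad; case: (j =P i.*2.+2) => // ->.
  by do 2 (case: eqP => [?|_]; first by lia).
- exists i.*2.+3; first by lia.
  exists q3; apply/funext => j; rewrite updE /quad; case: (j =P i.*2.+3) => // ->.
  by do 3 (case: eqP => [?|_]; first by lia).
Qed.

Definition phase0 : 'I_3 := @Ordinal 3 0 isT.
Definition phase1 : 'I_3 := @Ordinal 3 1 isT.
Definition phase2 : 'I_3 := @Ordinal 3 2 isT.

Lemma rewrites_reach g g' : rewrites g g' -> reach symbol_step (spread g) (spread g').
Proof.
move=> [i [z [w [iN e ->]]]].
set x := g i in e *; set y := g i.+1 in e *.
pose rho := (x, y); have el : lft rho = z by rewrite /lft /= e.
have er : rgt rho = w by rewrite /rgt /= e.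
pose m k : symbol := inr (rho, k).
have -> : spread g = quad g i (inl x) (inl x) (inl y) (inl y).
  apply/funext => j; rewrite /quad /spread.
  repeat (case: eqP => ? //); congr inl; rewrite /x /y; congr g; lia.
have -> : spread (upd (upd g i z) i.+1 w) = quad g i (inl z) (inl z) (inl w) (inl w).
  apply/funext => j; rewrite /quad /spread !updE.
  by repeat (case: eqP => ?; try (exfalso; lia)).
have step p0 p1 p2 p3 q0 q1 q2 q3 := @quad_step g i p0 p1 p2 p3 q0 q1 q2 q3 iN.
apply: reach_step (step _ _ _ _ (inl x) (m phase0) (inl y) (inl y) _ _ _ _ _ _ _ _ _ _ _) _;
  rewrite /= ?e ?el ?er ?eqxx ?orbT //.
apply: reach_step (step _ _ _ _ (inl x) (m phase0) (m phase0) (inl y) _ _ _ _ _ _ _ _ _ _ _) _;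
  rewrite /= ?e ?el ?er ?eqxx ?orbT //.
apply: reach_step (step _ _ _ _ (inl x) (m phase1) (m phase0) (inl y) _ _ _ _ _ _ _ _ _ _ _) _;
  rewrite /= ?e ?el ?er ?eqxx ?orbT //.
apply: reach_step (step _ _ _ _ (inl x) (m phase1) (m phase1) (inl y) _ _ _ _ _ _ _ _ _ _ _) _;
  rewrite /= ?e ?el ?er ?eqxx ?orbT //.
apply: reach_step (step _ _ _ _ (inl z) (m phase1) (m phase1) (inl y) _ _ _ _ _ _ _ _ _ _ _) _;
  rewrite /= ?e ?el ?er ?eqxx ?orbT //.
apply: reach_step (step _ _ _ _ (inl z) (m phase1) (m phase1) (inl w) _ _ _ _ _ _ _ _ _ _ _) _;
  rewrite /= ?e ?el ?er ?eqxx ?orbT //.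
apply: reach_step (step _ _ _ _ (inl z) (m phase2) (m phase1) (inl w) _ _ _ _ _ _ _ _ _ _ _) _;
  rewrite /= ?e ?el ?er ?eqxx ?orbT //.
apply: reach_step (step _ _ _ _ (inl z) (m phase2) (m phase2) (inl w) _ _ _ _ _ _ _ _ _ _ _) _;
  rewrite /= ?e ?el ?er ?eqxx ?orbT //.
apply: reach_step (step _ _ _ _ (inl z) (inl z) (m phase2) (inl w) _ _ _ _ _ _ _ _ _ _ _) _;
  rewrite /= ?e ?el ?er ?eqxx ?orbT //.
apply: reach_step (step _ _ _ _ (inl z) (inl z) (inl w) (inl w) _ _ _ _ _ _ _ _ _ _ _) _;
  rewrite /= ?e ?el ?er ?eqxx ?orbT //.
exact: reach_refl.
Qed.

Lemma symbol_step_sym s s' : symbol_step s s' -> symbol_step s' s.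
Proof.
move=> [ok ok' [i iN [a e]]]; split=> //; exists i => //; exists (s i).
by rewrite e upd_upd upd_id.
Qed.

(* The content of a cell with copies [l] and [r] before the copy [nx]. *)
Definition content (l r nx : symbol) : G :=
  match l, r with
  | inl g, inl _ => g
  | inl g, inr (rho, k) =>
      if k == 1 :> nat then
        (if nx is inr (_, k') then if k' == 0 :> nat then rho.1 else lft rho else rho.1)
      else g
  | inr (rho, k), inl h => if k == 1 :> nat then rgt rho else h
  | inr (rho, _), inr _ => rho.1
  end.

Ltac split_hyps := repeat match goal with
  | h : is_true (_ && _) |- _ => case/andP: h => ? ?
  | h : is_true (_ || _) |- _ => case/orP: h => ?
  | h : is_true (_ == _) |- _ => move/eqP: h => h
  | h : is_true false |- _ => by []
  end.


Lemma flip_right l r r' nx : in_cell l r -> in_cell l r' -> between r nx -> between r' nx ->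
  content l r nx = content l r' nx.
Proof.
case: l r r' nx => [g|[rho [[|[|[|?]]] ?]]] [h|[rho1 [[|[|[|?]]] ?]]]
  [h'|[rho2 [[|[|[|?]]] ?]]] [h3|[rho3 [[|[|[|?]]] ?]]] //=;
by move=> *; split_hyps; subst; congruence.
Qed.

Lemma flip_right_last l h h' nx : in_cell l (inl h) -> in_cell l (inl h') ->
  content l (inl h) nx = content l (inl h') nx.
Proof.
case: l => [g|[rho [[|[|[|?]]] ?]]] //=; move=> *; split_hyps; subst; congruence.
Qed.

(** A left copy is seen by its own cell and by the one before it. The contents change only when it
    passes between phases 0 and 1, and then both cells change together, as the rule prescribes. *)
Lemma flip_left l l' r nx pl pr : in_cell l r -> in_cell l' r ->
  between pr l -> between pr l' -> in_cell pl pr ->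
  (content l r nx = content l' r nx /\ content pl pr l = content pl pr l') \/
  exists rho, step2 rho.1 rho.2 /\
   ([/\ content l r nx = rho.2, content l' r nx = rgt rho,
        content pl pr l = rho.1 & content pl pr l' = lft rho] \/
    [/\ content l' r nx = rho.2, content l r nx = rgt rho,
        content pl pr l' = rho.1 & content pl pr l = lft rho]).
Proof.
rewrite /in_cell /between /content.
case: pr => [h4|[rho4 [[|[|[|?]]] ?]]]; case: l => [g|[rho [[|[|[|?]]] ?]]]; rewrite /= ?andbF //;
case: l' => [h|[rho1 [[|[|[|?]]] ?]]]; rewrite /= ?andbF //;
case: r => [h'|[rho2 [[|[|[|?]]] ?]]]; rewrite /= ?andbF //;
case: pl => [h3|[rho3 [[|[|[|?]]] ?]]]; rewrite /= ?andbF //;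
move=> *; split_hyps; subst; try congruence.
all: try by left; split; congruence.
all: try by right; exists rho1; split=> //; left; split; congruence.
all: try by right; exists rho1; split=> //; right; split; congruence.
Qed.

Lemma flip_left_first g h r nx : in_cell (inl g) r -> in_cell (inl h) r ->
  content (inl g) r nx = content (inl h) r nx.
Proof.
case: r nx => [r|[rho [[|[|[|?]]] i]]] [n|[rho1 [[|[|[|?]]] ?]]] //=;
by move=> h1 h2; split_hyps; subst; congruence.
Qed.

(** The two outermost copies have no neighbour outside to restrain them. They cannot become markers
    because no rule has a cell of the first kind on its right or one of the last kind on its
    left. *)
Definition first_ok (s : nat -> symbol) : Prop := exists2 g, s 0 = inl g & firstk g.
Definition last_ok (s : nat -> symbol) : Prop := exists2 g, s (N.*2).-1 = inl g & lastk g.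

Hypothesis N_gt0 : 0 < N.

Lemma rule_kind rho : step2 rho.1 rho.2 ->
  [/\ ~~ lastk rho.1 && ~~ lastk (lft rho), ~~ firstk rho.2 && ~~ firstk (rgt rho),
      firstk rho.1 = firstk (lft rho) & lastk rho.2 = lastk (rgt rho)].
Proof.
by rewrite /lft /rgt; case e: step2 => [[z w]|] // _; apply: step2_kind e.
Qed.

Lemma good_cell s i : good s -> i < N -> in_cell (s i.*2) (s i.*2.+1).
Proof. by move=> ok iN; have := ok i.*2.+1; rewrite /= odd_double; apply=> //; lia. Qed.

Lemma good_between s i : good s -> i.+1 < N -> between (s i.*2.+1) (s i.*2.+2).
Proof. by move=> ok iN; have := ok i.*2.+2; rewrite /= negbK odd_double; apply=> //; lia. Qed.

Lemma first_ok_step s s' : symbol_step s s' -> first_ok s -> first_ok s'.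
Proof.
move=> [ok ok' [j jN [a e]]] [g s0 fg]; have c := good_cell ok N_gt0; have c' := good_cell ok' N_gt0.
have [j0|j0] := eqVneq j 0; last by exists g; rewrite // e upd_other // eq_sym.
have e0 : s' 0 = a by rewrite e j0 upd_same.
have e1 : s' 1 = s 1 by rewrite e j0 upd_other.
rewrite /= in c c'; rewrite s0 in c; rewrite e0 e1 in c'.
case: a c' e0 {e} => [h|[rho k]] c' e0.
  exists h => //; move: c c'; case: (s 1) => [h1|[rho k]] /=.
    by move/eqP<-; move/eqP->.
  move=> /andP[rl c] /andP[_ c']; have [_ _ f _] := rule_kind rl.
  move: fg c c' => fg; case/orP => /andP[_ /eqP eg]; rewrite eg in fg;
  by case/orP => /andP[_ /eqP->]; rewrite -?f // f.
move: c c'; case: (s 1) => [h1|[rho' k']] //=.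
move/eqP<- => /andP[rl c']; have [_ /andP[n1 n2] _ _] := rule_kind rl.
by case/orP: c' => /andP[_ /eqP e']; move: fg; rewrite e' ?(negPf n1) ?(negPf n2).
Qed.

Lemma last_ok_step s s' : symbol_step s s' -> last_ok s -> last_ok s'.
Proof.
have lN : N.-1 < N by lia.
have e1N : N.-1.*2.+1 = N.*2.-1 by lia.
move=> [ok ok' [j jN [a e]]] [g s0 fg]; have c := good_cell ok lN; have c' := good_cell ok' lN.
rewrite e1N in c c'; have [j0|j0] := eqVneq j N.*2.-1; last first.
  by exists g; rewrite // e upd_other // eq_sym.
have e0 : s' N.*2.-1 = a by rewrite e j0 upd_same.
have e1 : s' N.-1.*2 = s N.-1.*2 by rewrite e j0 upd_other //; lia.
rewrite s0 in c; rewrite e0 e1 in c'.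
case: a c' e0 {e} => [h|[rho k]] c' e0.
  exists h => //; move: c c'; case: (s _) => [h1|[rho k]] /=.
    by move/eqP->; move/eqP<-.
  move=> /andP[rl c] /andP[_ c']; have [_ _ _ f] := rule_kind rl.
  move: fg c c' => fg; case/orP => /andP[_ /eqP eg]; rewrite eg in fg;
  by case/orP => /andP[_ /eqP->]; rewrite -?f // f.
move: c c'; case: (s _) => [h1|[rho' k']] //=.
move/eqP-> => /andP[rl c']; have [/andP[n1 n2] _ _ _] := rule_kind rl.
by case/orP: c' => /andP[_ /eqP e']; move: fg; rewrite e' ?(negPf n1) ?(negPf n2).
Qed.

Variable g0 : nat -> G.

Definition abstraction (s : nat -> symbol) : nat -> G :=
  fun i => if i < N then content (s i.*2) (s i.*2.+1) (s i.*2.+2) else g0 i.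

Lemma abstraction_step s s' : symbol_step s s' -> first_ok s -> last_ok s ->
  abstraction s' = abstraction s \/ rewrites_sym (abstraction s) (abstraction s').
Proof.
move=> st fs ls; have fs' := first_ok_step st fs; have ls' := last_ok_step st ls.
have [ok ok' [j jN [a e]]] := st.
have [i [iN ij]] : exists i, i < N /\ (j = i.*2 \/ j = i.*2.+1).
  by exists j./2; split; [lia | case oj: (odd j); [right | left]; have := odd_double_half j; rewrite oj; lia].
have same k : k != j -> s' k = s k by move=> kj; rewrite e upd_other.
have c := good_cell ok iN; have c' := good_cell ok' iN.
case: ij => ej; subst j.
  case: i iN e same jN c c' => [|i] iN e same jN c c'.
    left; apply/funext => k; rewrite /abstraction; case: ifP => // kN.
    case: k kN => [|k] kN; last by rewrite !same //; lia.
    have [g sg _] := fs; have [h s'h _] := fs'.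
    rewrite /= in c c' same *; rewrite s'h sg !same // in c c' *.
    exact: flip_left_first.
  have b := good_between ok iN; have b' := good_between ok' iN.
  have iN' : i < N by lia.
  have p := good_cell ok iN'.
  rewrite doubleS in e same jN c c' b b' *.
  rewrite (same i.*2.+1) in b'; last by lia.
  rewrite (same i.*2.+3) in c'; last by lia.
  have other k : k != i -> k != i.+1 -> abstraction s' k = abstraction s k.
    by move=> *; rewrite /abstraction; case: ifP => // kN; rewrite !same //; lia.
  have ai t : abstraction t i = content (t i.*2) (t i.*2.+1) (t i.*2.+2).
    by rewrite /abstraction iN'.
  have ai1 t : abstraction t i.+1 = content (t i.*2.+2) (t i.*2.+3) (t i.*2.+4).
    by rewrite /abstraction iN doubleS.
  have a'i : abstraction s' i = content (s i.*2) (s i.*2.+1) (s' i.*2.+2).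
    by rewrite ai !(same i.*2, same i.*2.+1) //; lia.
  have a'i1 : abstraction s' i.+1 = content (s' i.*2.+2) (s i.*2.+3) (s i.*2.+4).
    by rewrite ai1 (same i.*2.+3) ?(same i.*2.+4) //; lia.
  have rule rho f f' : step2 rho.1 rho.2 -> f i = rho.1 -> f i.+1 = rho.2 ->
      f' i = lft rho -> f' i.+1 = rgt rho -> (forall k, k != i -> k != i.+1 -> f' k = f k) ->
      rewrites f f'.
    move=> rl f1 f2 f'1 f'2 oth; exists i, (lft rho), (rgt rho); split=> //.
      by rewrite f1 f2 /lft /rgt; move: rl; case: step2 => // -[].
    apply/funext => k; rewrite !updE.
    by case: (eqVneq k i.+1) => [->//|k1]; case: (eqVneq k i) => [->//|k0]; apply: oth.
  have [[e1 e2]|[rho [rl [[e1 e2 e3 e4]|[e1 e2 e3 e4]]]]] :=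
    @flip_left _ _ _ (s i.*2.+4) _ _ c c' b b' p.
  - left; apply/funext => k; have [->|k0] := eqVneq k i; first by rewrite a'i ai e2.
    by have [->|k1] := eqVneq k i.+1; [rewrite a'i1 ai1 e1 | apply: other].
  - by right; left; apply: (rule rho) => //; [rewrite ai | rewrite ai1 | rewrite a'i | rewrite a'i1].
  - right; right; apply: (rule rho) => //; [by rewrite a'i | by rewrite a'i1 | by rewrite ai |
      by rewrite ai1 | by move=> *; rewrite other].
left; apply/funext => k; rewrite /abstraction; case: ifP => // kN.
have [->|ki] := eqVneq k i; last by rewrite !same //; lia.
rewrite (same i.*2) ?(same i.*2.+2); try lia.
rewrite (same i.*2) in c'; last by lia.
have [iN1|iN1] := ltnP i.+1 N.
  apply: flip_right => //; last exact: good_between.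
  by have := good_between ok' iN1; rewrite (same i.*2.+2) //; lia.
have el : i.*2.+1 = N.*2.-1 by lia.
have [g sg _] := ls; have [h s'h _] := ls'.
rewrite el in c c' *; rewrite sg s'h in c c' *.
exact: flip_right_last.
Qed.

Lemma abstraction_spread g : (forall i, N <= i -> g i = g0 i) -> abstraction (spread g) = g.
Proof.
move=> out; apply/funext => i; rewrite /abstraction; case: ltnP => [iN|/out //].
by rewrite /= doubleK.
Qed.

Theorem reach_rewrites g : firstk (g0 0) -> lastk (g0 N.-1) ->
  (forall i, N <= i -> g i = g0 i) ->
  reach symbol_step (spread g0) (spread g) <-> reach rewrites_sym g0 g.
Proof.
move=> f0 l0 out; split=> [r|].
  rewrite -{1}(@abstraction_spread g0) // -(abstraction_spread out).
  have fs : first_ok (spread g0) by exists (g0 0).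
  have ls : last_ok (spread g0) by exists (g0 N.-1); rewrite // /spread; congr (inl (g0 _)); lia.
  elim: r fs ls => {g out} [s|s1 s2 s3 s12 _ IH] fs ls; first exact: reach_refl.
  have [<-|st] := abstraction_step s12 fs ls.
    by apply: IH; [apply: first_ok_step fs | apply: last_ok_step ls].
  by apply: reach_step st (IH _ _); [apply: first_ok_step fs | apply: last_ok_step ls].
elim=> {out f0 l0} [h|h1 h2 h3 [r|r] _ IH]; first exact: reach_refl.
  exact: reach_trans (rewrites_reach r) IH.
exact: reach_trans (reach_sym symbol_step_sym (rewrites_reach r)) IH.
Qed.

End Rewriting.

(** * A Turing machine as a two-cell rewriting system *)

Section Simulation.
Variable M : tm.
Let W := work M.
Let I := 'I_(ntapes M).+1.

Definition heads : finType := {ffun I -> sym W}.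
Definition sides : finType := {ffun I -> sym W * sym W}.

(* The tapes are folded at their heads: cell 0 holds the scanned symbols and
   cell j the pairs of symbols at distance j on the left and on the right. *)
Definition cell : finType := (heads + (sides + unit))%type.
Definition head_cell (h : heads) : cell := inl h.
Definition side_cell (v : sides) : cell := inr (inl v).
Definition end_cell : cell := inr (inr tt).

(** [ready] sits at the head cell. [sweep] goes right with the state and the scanned symbols, which
    determine the transition, and with the symbols shifted out of the last cell. [return_] brings
    the new state back, and [cleaning] blanks the cells after acceptance. *)
Definition token : finType := (state M + (state M * heads * heads + (state M + unit)))%type.
Definition ready q : token := inl q.
Definition sweep q h c : token := inr (inl (q, h, c)).
Definition return_ q : token := inr (inr (inl q)).
Definition cleaning : token := inr (inr (inr tt)).

Definition tcell : finType := (cell * option token)%type.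

Definition is_head (c : cell) : bool := if c is inl _ then true else false.
Definition is_end (c : cell) : bool := if c is inr (inr tt) then true else false.

Definition side_of (c : cell) : sides := if c is inr (inl v) then v else [ffun=> (None, None)].

Definition actions := {ffun I -> sym W * move}.

Definition new_head (act : actions) (v : sides) : heads :=
  [ffun i => match (act i).2 with
             | MoveStay => (act i).1 | MoveRight => (v i).2 | MoveLeft => (v i).1 end].

Definition written (act : actions) : heads := [ffun i => (act i).1].

(* [c] is the symbol that moved away from the head out of the previous cell. *)
Definition new_side (act : actions) (v v' : sides) (c : heads) : sides :=
  [ffun i => match (act i).2 with
             | MoveStay => v i | MoveRight => (c i, (v' i).2) | MoveLeft => ((v' i).1, c i) end].

Definition new_carry (act : actions) (v : sides) (c : heads) : heads :=
  [ffun i => match (act i).2 with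
             | MoveStay => c i | MoveRight => (v i).1 | MoveLeft => (v i).2 end].

Definition arrive (c : cell) (q : state M) : token := if is_head c then ready q else return_ q.

Definition no_heads : heads := [ffun=> None].
Definition no_sides : sides := [ffun=> (None, None)].

Definition step_right (c : cell) (t : token) (c' : cell) : option (cell * token) :=
  match c, t with
  | inl h, inl q =>
      if trans q h is Some (_, act) then
        Some (head_cell (new_head act (side_of c')), sweep q h (written act))
      else if accepting q then Some (head_cell no_heads, cleaning) else None
  | inr (inl v), inr (inl (q, h, cr)) =>
      if trans q h is Some (_, act) then
        Some (side_cell (new_side act v (side_of c') cr), sweep q h (new_carry act v cr))
      else None
  | inr (inl v), inr (inr (inr tt)) => Some (side_cell no_sides, cleaning)
  | _, _ => None
  end.

Definition step_left (c : cell) (c' : cell) (t : token) : option token :=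
  match c', t with
  | inr (inr tt), inr (inl (q, h, _)) =>
      if trans q h is Some (q', _) then Some (arrive c q') else None
  | inr (inl _), inr (inr (inl q)) => Some (arrive c q)
  | _, _ => None
  end.

Definition step2 (x y : tcell) : option (tcell * tcell) :=
  if is_end x.1 || is_head y.1 then None else
  match x.2, y.2 with
  | Some t, None =>
      if step_right x.1 t y.1 is Some (c, t') then Some ((c, None), (y.1, Some t')) else None
  | None, Some t =>
      if step_left x.1 y.1 t is Some t' then Some ((x.1, Some t'), (y.1, None)) else None
  | _, _ => None
  end.

Definition firstk (x : tcell) : bool := is_head x.1.
Definition lastk (x : tcell) : bool := is_end x.1.

Lemma step_right_kind c t c' d t' : step_right c t c' = Some (d, t') ->
  is_head c = is_head d /\ is_end c = is_end d.
Proof.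
case: c t => [h|[v|[]]] [q|[[[q h'] cr]|[q|[]]]] //=.
- by case: trans => [[? ?]|]; [case=> <- _ | case: ifP => // _ [<- _]].
- by case: trans => [[? ?]|] // [<- _].
- by case=> <- _.
Qed.

Lemma step2_kind x y z w : step2 x y = Some (z, w) ->
  [/\ ~~ lastk x && ~~ lastk z, ~~ firstk y && ~~ firstk w,
      firstk x = firstk z & lastk y = lastk w].
Proof.
rewrite /step2 /firstk /lastk; case: ifP => // /negbT; rewrite negb_or => /andP[ex hy].
case: x ex => c [t|] /= ex; case: y hy => c' [t'|] //= hy.
- case e: step_right => [[d u]|] // [<- <-] /=.
  by have [<- <-] := step_right_kind e; rewrite ex hy.
- by case: step_left => // u [<- <-] /=; rewrite ex hy.
Qed.

Lemma step2_token x y z w : step2 x y = Some (z, w) ->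
  isSome x.2 (+) isSome y.2 /\ isSome z.2 (+) isSome w.2.
Proof.
rewrite /step2; case: ifP => // _; case: x => c [t|]; case: y => c' [t'|] //=.
- by case: step_right => [[d u]|] // [<- <-].
- by case: step_left => [u|] // [<- <-].
Qed.

(** Otherwise the token would be in the middle cell and could leave it both ways; but each kind of
    token leaves a given kind of cell in one direction only. *)
Lemma step2_exclusive x y z : step2 x y -> step2 y z -> isSome x.2 || isSome z.2.
Proof.
rewrite /step2; case: ifP => // _; case: x => c [t|]; case: y => c' [t'|] //=.
case: z => d [u|] //=; rewrite ?orbT //.
case: ifP => // _; case: c' => [?|[?|[]]]; by case: t' => [?|[[[? ?] ?]|[?|[]]]].
Qed.

Variable N : nat.
Hypothesis N_gt1 : 1 < N.

Lemma predN_gt0 : 0 < N.-1. Proof. by lia. Qed.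

Let rew := @rewrites tcell step2 N.
Let rew_sym := @rewrites_sym tcell step2 N.

Definition single (g : nat -> tcell) : Prop := exists p, forall j, isSome (g j).2 = (j == p).

Lemma rew_single g g' : rew_sym g g' -> single g -> single g'.
Proof.
case=> [[i [z [w [iN e ->]]]] [p gp]|[i [z [w [iN e e']]]] [p gp]].
  have [] := step2_token e; rewrite !gp => xy zw.
  exists (if isSome z.2 then i else i.+1) => j; rewrite !updE.
  have [->|n1] := eqVneq j i.+1.
    by case: (z.2) (w.2) zw => [?|] [?|] //= _; rewrite ?eqxx // gtn_eqF.
  have [->|n2] := eqVneq j i.
    by case: (z.2) (w.2) zw => [?|] [?|] //= _; rewrite ?eqxx // ltn_eqF.
  rewrite gp (_ : (j == p) = false); first by case: ifP => _; lia.
  by case: eqP xy => [<-|_]; case: eqP => [<-|_] //= _; lia.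
have [xy] := step2_token e.
have gi : g i = z by rewrite e' upd_other ?upd_same // ltn_eqF.
have gi1 : g i.+1 = w by rewrite e' upd_same.
rewrite -gi -gi1 !gp => zw.
exists (if isSome (g' i).2 then i else i.+1) => j.
have [->|n1] := eqVneq j i.+1.
  by case: (g' i).2 (g' i.+1).2 xy => [?|] [?|] //= _; rewrite ?eqxx // gtn_eqF.
have [->|n2] := eqVneq j i.
  by case: (g' i).2 (g' i.+1).2 xy => [?|] [?|] //= _; rewrite ?eqxx // ltn_eqF.
have -> : g' j = g j by rewrite e' !upd_other.
rewrite gp (_ : (j == p) = false); first by case: ifP => _; lia.
by case: eqP zw => [<-|_]; case: eqP => [<-|_] //= _; lia.
Qed.

Lemma rew_deterministic g g1 g2 : single g -> rew g g1 -> rew g g2 -> g1 = g2.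
Proof.
move=> [p gp] [i [z [w [iN e ->]]]] [i' [z' [w' [iN' e' ->]]]].
have [ii'|ne] := eqVneq i i'.
  by subst i'; move: e'; rewrite e => -[-> ->].
have [xy _] := step2_token e; have [xy' _] := step2_token e'.
rewrite !gp in xy xy'.
have excl a : i = a \/ i' = a -> i = a.+1 \/ i' = a.+1 -> False.
  move=> h h'; have e1 : step2 (g a) (g a.+1) by case: h => <-; rewrite ?e ?e'.
  have e2 : step2 (g a.+1) (g a.+2) by case: h' => <-; rewrite ?e ?e'.
  have := step2_exclusive e1 e2; rewrite !gp.
  by case: h h' => [ia|ia] [ja|ja]; subst; try lia; case: eqP xy => ?; case: eqP xy' => ?; lia.
by exfalso; case: (eqVneq i p) xy => [ip|_] /=; case: (eqVneq i' p) xy' => [ip'|_] /=; subst;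
  rewrite ?addbF ?addbT => *; try lia; first [apply: (excl i) | apply: (excl i')]; lia.
Qed.

Lemma reach_stuck g t u : single g -> (forall t', ~ rew t t') -> (forall u', ~ rew u u') ->
  reach rew g t -> reach rew g u -> t = u.
Proof.
move=> sg st su r; elim: r sg st => {g t} [t _ st r|g g1 t gg1 _ IH sg st r].
  by case: r st => // a b c ab _ /(_ _ ab).
case: r gg1 sg su IH => [a|a b c ab r] gg1 sg su IH; first by case: (su _ gg1).
have sg1 : single g1 by apply: rew_single sg; left.
by apply: IH => //; rewrite (rew_deterministic sg gg1 ab).
Qed.

(** A backward step followed by a forward path cancels: by determinism, the forward path begins by
    undoing it. It cannot be the last step, since the target is stuck. *)
Lemma reach_forward g t : (forall t', ~ rew t t') -> single g ->
  reach rew_sym g t -> reach rew g t.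
Proof.
move=> st sg r; elim: r st sg => {g t} [t _ _|g g1 t gg1 _ IH st sg]; first exact: reach_refl.
have r1 := IH st (rew_single gg1 sg).
case: gg1 => gg1; first exact: reach_step gg1 r1.
case: r1 gg1 st => [a|a b c ab r] gg1 st; first by case: (st _ gg1).
have s1 : single a by apply: rew_single sg; right.
by rewrite (rew_deterministic s1 gg1 ab).
Qed.

Definition tapes := {ffun I -> tape W}.

Definition tape_cell (T : tapes) (j : nat) : cell :=
  if j == 0 then head_cell [ffun i => tape_head (T i)]
  else if N.-1 <= j then end_cell
  else side_cell [ffun i => (nth None (tape_left (T i)) j.-1, nth None (tape_right (T i)) j.-1)].

(* The cells before [p] have been updated from [T] to [T']. *)
Definition partway (T T' : tapes) (p : nat) (t : token) : nat -> tcell :=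
  fun j => (if j < p then tape_cell T' j else tape_cell T j, if j == p then Some t else None).

Definition fits (T : tapes) := forall i, size (tape_left (T i)) <= N.-2 /\ size (tape_right (T i)) <= N.-2.

Lemma partway_next T T' p t t' : p < N.-1 ->
  step2 (tape_cell T p, Some t) (tape_cell T p.+1, None) =
    Some ((tape_cell T' p, None), (tape_cell T p.+1, Some t')) ->
  rew (partway T T' p t) (partway T T' p.+1 t').
Proof.
move=> pN e; exists p, (tape_cell T' p, None), (tape_cell T p.+1, Some t'); split.
- by lia.
- by rewrite /partway ltnn eqxx ltnNge leqnSn /= gtn_eqF.
apply/funext => j; rewrite !updE /partway.
have [->|n1] := eqVneq j p.+1; first by rewrite ltnn.
have [->|n2] := eqVneq j p; first by rewrite ltnSn.
by rewrite ltnS leq_eqVlt (negPf n2).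
Qed.

Lemma not_end_tape T p : p < N.-1 -> is_end (tape_cell T p) = false.
Proof. by move=> pN; rewrite /tape_cell; case: eqP => // _; rewrite leqNgt pN. Qed.

Lemma tape_cell_end T : tape_cell T N.-1 = end_cell.
Proof. by rewrite /tape_cell leqnn gtn_eqF // predN_gt0. Qed.

Lemma not_head_tape T p : is_head (tape_cell T p.+1) = false.
Proof. by rewrite /tape_cell /=; case: ifP. Qed.

Lemma step2_right c t c' : is_end c = false -> is_head c' = false ->
  step2 (c, Some t) (c', None) =
  if step_right c t c' is Some (d, t') then Some ((d, None), (c', Some t')) else None.
Proof. by rewrite /step2 /= => -> ->. Qed.

Lemma step2_left c c' t : is_end c = false -> is_head c' = false ->
  step2 (c, None) (c', Some t) =
  if step_left c c' t is Some t' then Some ((c, Some t'), (c', None)) else None.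
Proof. by rewrite /step2 /= => -> ->. Qed.

Section OneStep.
Variables (T : tapes) (q q' : state M) (act : actions).
Let h : heads := [ffun i => tape_head (T i)].
Hypothesis transE : trans q h = Some (q', act).
Hypothesis fitsT : fits T.

Definition next_tapes : tapes := [ffun i => move_head (act i).2 (write (act i).1 (T i))].

Let carry (p : nat) : heads := [ffun i => match (act i).2 with
  | MoveStay => (act i).1
  | MoveRight => nth None ((act i).1 :: tape_left (T i)) p
  | MoveLeft => nth None ((act i).1 :: tape_right (T i)) p end].

Lemma side_of_tape p i : side_of (tape_cell T p.+1) i =
  (nth None (tape_left (T i)) p, nth None (tape_right (T i)) p).
Proof.
rewrite /tape_cell /=; case: ifP => le /=; rewrite ffunE //.
(* The end cell is read as blank on both sides, which is right because the tapes list nothing that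
   far out. *)
have pN : N.-2 <= p by move: le; clear; lia.
by have [l r] := fitsT i; rewrite !nth_default //; [apply: leq_trans r pN | apply: leq_trans l pN].
Qed.

Lemma sweep_first : rew (partway T next_tapes 0 (ready q)) (partway T next_tapes 1 (sweep q h (carry 0))).
Proof.
have N1 := predN_gt0.
apply: partway_next => //; rewrite step2_right ?not_end_tape ?not_head_tape //.
rewrite {1}/tape_cell /= transE; congr (Some ((_, _), (_, Some _))).
  rewrite /tape_cell /=; congr inl; apply/ffunP => i; rewrite !ffunE side_of_tape.
  case: (T i) => l a r; case: (act i).2 => //=; by rewrite nth0.
congr (sweep _ _ _); apply/ffunP => i; rewrite !ffunE; by case: (act i).2.
Qed.

Lemma sweep_next p : 0 < p -> p < N.-1 ->
  rew (partway T next_tapes p (sweep q h (carry p.-1))) (partway T next_tapes p.+1 (sweep q h (carry p))).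
Proof.
case: p => // p _ pN; apply: partway_next => //.
rewrite step2_right ?not_end_tape ?not_head_tape //.
rewrite {1}/tape_cell /= leqNgt pN /= transE; congr (Some ((_, _), (_, Some _))).
  rewrite [RHS]/tape_cell /= leqNgt pN /=; congr (inr (inl _)); apply/ffunP => i.
  rewrite !ffunE side_of_tape.
  case: (T i) => l a r; case: (act i).2 => //=; by rewrite nth_behead.
congr (sweep _ _ _); apply/ffunP => i; rewrite !ffunE; by case: (act i).2.
Qed.

Lemma sweep_all p : p < N.-1 ->
  reach rew (partway T next_tapes 0 (ready q)) (partway T next_tapes p.+1 (sweep q h (carry p))).
Proof.
elim: p => [|p IH] pN; first exact: reach_step sweep_first (reach_refl _ _).
by apply: reach_last (IH _) (sweep_next _ pN) => //; lia.
Qed.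

Lemma move_back T' p t t' : p < N.-1 ->
  step2 (tape_cell T' p, None) (tape_cell T' p.+1, Some t) =
    Some ((tape_cell T' p, Some t'), (tape_cell T' p.+1, None)) ->
  rew (partway T' T' p.+1 t) (partway T' T' p t').
Proof.
move=> pN e; exists p, (tape_cell T' p, Some t'), (tape_cell T' p.+1, None); split.
- by lia.
- by rewrite /partway !if_same eqxx ltn_eqF.
apply/funext => j; rewrite !updE /partway !if_same.
have [->|n1] := eqVneq j p.+1; first by rewrite gtn_eqF.
by have [->|n2] := eqVneq j p.
Qed.

Lemma return_all p : p < N.-1 ->
  reach rew (partway next_tapes next_tapes p (arrive (tape_cell next_tapes p) q'))
    (partway next_tapes next_tapes 0 (ready q')).
Proof.
elim: p => [|p IH] pN; first exact: reach_refl.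
apply: reach_step (IH _); last by lia.
have pN' : p < N.-1 by move: pN; clear; lia.
apply: move_back => //; rewrite step2_left ?not_end_tape ?not_head_tape //.
by rewrite {1}/arrive not_head_tape {2}/tape_cell /= leqNgt pN.
Qed.

Lemma simulate_step :
  reach rew (partway T T 0 (ready q)) (partway next_tapes next_tapes 0 (ready q')).
Proof.
have lt : N.-2 < N.-1 by lia.
have e2 : N.-2.+1 = N.-1 by lia.
have -> : partway T T 0 (ready q) = partway T next_tapes 0 (ready q).
  by apply/funext => j; rewrite /partway.
apply: reach_trans (sweep_all lt) _; rewrite e2.
have -> : partway T next_tapes N.-1 (sweep q h (carry N.-2)) =
    partway next_tapes next_tapes N.-2.+1 (sweep q h (carry N.-2)).
  apply/funext => j; rewrite /partway e2 if_same; case: ltnP => // le.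
  by rewrite /tape_cell le; case: eqP le => // ->; lia.
apply: reach_step (return_all lt); apply: move_back => //.
rewrite step2_left ?not_end_tape ?not_head_tape //.
have -> : tape_cell next_tapes N.-2.+1 = end_cell by rewrite e2 tape_cell_end.
by rewrite /= transE.
Qed.

End OneStep.

Definition blank_tapes : tapes := [ffun=> Tape [::] None [::]].

(** Erasing everything after acceptance gives a target that does not depend on the final tapes. *)
Definition accept_word : nat -> tcell := partway blank_tapes blank_tapes N.-1 cleaning.

Lemma tape_cell_blank p : p < N.-1 -> tape_cell blank_tapes p =
  if p == 0 then head_cell no_heads else side_cell no_sides.
Proof.
move=> pN; rewrite /tape_cell; case: eqP => _; first by congr inl; apply/ffunP => i; rewrite !ffunE.
rewrite leqNgt pN /=; congr (inr (inl _)); apply/ffunP => i; rewrite !ffunE /=.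
by rewrite !nth_nil.
Qed.

Lemma simulate_accept (T : tapes) q : trans q [ffun i => tape_head (T i)] = None -> accepting q ->
  reach rew (partway T T 0 (ready q)) accept_word.
Proof.
move=> tr acc; have -> : partway T T 0 (ready q) = partway T blank_tapes 0 (ready q).
  by apply/funext => j; rewrite /partway.
have all p : p < N.-1 -> reach rew (partway T blank_tapes 0 (ready q)) (partway T blank_tapes p.+1 cleaning).
  elim: p => [|p IH] pN.
    apply: reach_step (reach_refl _ _); apply: partway_next => //.
    by rewrite step2_right ?not_end_tape ?not_head_tape // {1}/tape_cell /= tr acc tape_cell_blank.
  apply: reach_last (IH _) _; first by lia.
  apply: partway_next => //.
  rewrite step2_right ?not_end_tape ?not_head_tape // {1}/tape_cell /= leqNgt pN /=.
  by rewrite tape_cell_blank.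
have e2 : N.-2.+1 = N.-1 by lia.
have := all N.-2; rewrite e2 => /(_ ltac:(lia)).
congr reach; apply/funext => j; rewrite /accept_word /partway if_same; case: ltnP => // le.
by rewrite /tape_cell le; case: eqP le => // ->; lia.
Qed.

Lemma partway_single T T' p t : single (partway T T' p t).
Proof. by exists p => j; rewrite /partway /=; case: eqP. Qed.

Lemma accept_stuck g : ~ rew accept_word g.
Proof.
move=> [i [z [w [iN e _]]]]; move: e; rewrite /accept_word /step2 /partway !if_same /=.
have [->|ni] := eqVneq i N.-1; first by rewrite tape_cell_end.
have [->|_] := eqVneq i.+1 N.-1; last by case: ifP.
by rewrite tape_cell_end /=; case: ifP.
Qed.

Lemma halted_stuck (T : tapes) q g : trans q [ffun i => tape_head (T i)] = None -> ~~ accepting q ->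
  ~ rew (partway T T 0 (ready q)) g.
Proof.
move=> tr acc [i [z [w [iN e _]]]]; move: e; rewrite /step2 /partway /=.
case: i iN => [|i] iN /=; last by case: ifP.
by rewrite /tape_cell /= tr (negPf acc); case: ifP.
Qed.

Definition init_word (x : seq bool) : nat -> tcell :=
  partway (init M x).2 (init M x).2 0 (ready (start M)).

Lemma simulate_run x t : (forall t, fits (run M x t).2) ->
  reach rew (init_word x) (partway (run M x t).2 (run M x t).2 0 (ready (run M x t).1)).
Proof.
move=> f; elim: t => [|t IH]; first exact: reach_refl.
rewrite /run iterS -/(run M x t).
case e: (step _) => [C|] //=.
move: e; rewrite /step; case tr: trans => [[q' act]|] // [<-] /=.
exact: reach_trans IH (simulate_step tr (f t)).
Qed.

(** The accepting word and a rejecting halt are both stuck, and a deterministic system cannot reach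
    two different stuck words from one start. These two differ in the place of the token, the last
    cell or the head cell. *)
Theorem accept_iff x t : (forall t, fits (run M x t).2) -> halted (run M x t) ->
  accepting (run M x t).1 <-> reach rew_sym (init_word x) accept_word.
Proof.
move=> f hlt; have tr : trans (run M x t).1 [ffun i => tape_head ((run M x t).2 i)] = None.
  by move: hlt; rewrite /halted /step; case: trans => // -[].
have rt := simulate_run t f; split=> [acc|r].
  have r := reach_trans rt (simulate_accept tr acc).
  elim: r => [g|g g1 g2 s _ IH]; first exact: reach_refl.
  by apply: reach_step IH; left.
have r' := reach_forward accept_stuck (partway_single _ _ _ _) r.
apply/negPn/negP => acc.
have := reach_stuck (partway_single _ _ _ _) (fun g => @halted_stuck _ _ g tr acc) accept_stuck rt r'.
move/(congr1 (fun g => (g 0).2)); rewrite /accept_word /partway /=.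
by case: eqP => // e; lia.
Qed.

End Simulation.

(** * Straight-line drawings with integer coordinates *)

Section Drawing.
Local Open Scope ring_scope.
Import Order.TTheory GRing.Theory Num.Theory numFieldNormedType.Exports.

Definition point : Type := (int * int)%type.

Definition cross (a b c : point) : int :=
  (b.1 - a.1) * (c.2 - a.2) - (b.2 - a.2) * (c.1 - a.1).

(** Two intervals in weak order that are not all one point: their ends may be shared, but the images
    of the interiors of the two segments are strictly separated. *)
Definition below (a b c d : int) : bool :=
  [&& a <= c, a <= d, b <= c, b <= d & a + b < c + d].

(** The segment [cd] lies on one closed side of the line [ab] and not within the line, so its
    interior misses the line. *)
Definition one_side (a b c d : point) : bool :=
  let u := cross a b c in let v := cross a b d in
  [&& 0 <= u, 0 <= v & 0 < u + v] || [&& u <= 0, v <= 0 & u + v < 0].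

Definition axis_apart (a b c d : point) : bool :=
  [|| below a.1 b.1 c.1 d.1, below c.1 d.1 a.1 b.1,
      below a.2 b.2 c.2 d.2 | below c.2 d.2 a.2 b.2].

Definition apart (a b c d : point) : bool :=
  [|| axis_apart a b c d, one_side a b c d | one_side c d a b].

Definition off (a b c : point) : bool := axis_apart a b c c || (cross a b c != 0).

Section Segments.
Variable F : realFieldType.

Definition seg (a b : point) (t : F) : F * F :=
  (a.1%:~R + t * (b.1%:~R - a.1%:~R), a.2%:~R + t * (b.2%:~R - a.2%:~R)).

Let rcross (a b : point) (c : F * F) : F :=
  (b.1%:~R - a.1%:~R) * (c.2 - a.2%:~R) - (b.2%:~R - a.2%:~R) * (c.1 - a.1%:~R).

Lemma rcross_seg a b t : rcross a b (seg a b t) = 0.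
Proof. by rewrite /rcross /seg /=; ring. Qed.

Lemma rcross_seg2 a b c d t :
  rcross a b (seg c d t) = (1 - t) * (cross a b c)%:~R + t * (cross a b d)%:~R.
Proof. by rewrite /rcross /seg /cross /=; ring. Qed.

Lemma convex_le (x y m s : F) : x <= m -> y <= m -> 0 < s < 1 ->
  x + s * (y - x) <= m /\ (x + y < m + m -> x + s * (y - x) < m).
Proof.
move=> xm ym /andP[s0 s1].
have -> : x + s * (y - x) = m - ((1 - s) * (m - x) + s * (m - y)) by ring.
have h1 : 0 <= (1 - s) * (m - x) by rewrite mulr_ge0 //; lra.
have h2 : 0 <= s * (m - y) by rewrite mulr_ge0 //; lra.
split=> [|lt]; first by lra.
have [xm'|xm'] := ltP x m.
  have : 0 < (1 - s) * (m - x) by rewrite mulr_gt0 //; lra.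
  by lra.
have : 0 < s * (m - y) by rewrite mulr_gt0 //; lra.
by lra.
Qed.

Lemma below_seg (a b c d : int) (s t : F) : below a b c d -> 0 < s < 1 -> 0 < t < 1 ->
  a%:~R + s * (b%:~R - a%:~R) <> c%:~R + t * (d%:~R - c%:~R).
Proof.
move=> /and5P[ac ad bc bd lt] /andP[s0 s1] /andP[t0 t1] e.
have [m [am bm cm dm sm]] : exists m : F, [/\ a%:~R <= m, b%:~R <= m, m <= c%:~R, m <= d%:~R &
    a%:~R + b%:~R < m + m \/ m + m < c%:~R + d%:~R].
  have: a + b < Num.max a b + Num.max a b \/ Num.max a b + Num.max a b < c + d.
    by case: (leP a b) => ?; lia.
  rewrite -!(ltr_int F) !intrD => h.
  exists (Num.max a b)%:~R; rewrite !ler_int; split; rewrite ?le_max ?lexx ?orbT //.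
  - by rewrite ge_max ac bc.
  - by rewrite ge_max ad bd.
have [l1 l2] := convex_le am bm (introT andP (conj s0 s1)).
have [r1 r2] : c%:~R + t * (d%:~R - c%:~R) >= m /\
    (m + m < c%:~R + d%:~R -> c%:~R + t * (d%:~R - c%:~R) > m).
  have [r1 r2] := @convex_le (- c%:~R) (- d%:~R) (- m) t ltac:(lra) ltac:(lra) (introT andP (conj t0 t1)).
  by split=> [|h]; [lra | have := r2 ltac:(lra); lra].
by case: sm => sm; [have := l2 sm | have := r2 sm]; lra.
Qed.

Lemma one_side_seg a b c d s t : one_side a b c d -> 0 < s < 1 -> 0 < t < 1 ->
  seg a b s <> seg c d t.
Proof.
move=> os /andP[s0 s1] /andP[t0 t1] /(congr1 (rcross a b)).
rewrite rcross_seg rcross_seg2; move: os; rewrite /one_side.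
set u := cross a b c; set v := cross a b d.
rewrite -!(ler_int F) -!(ltr_int F) intrD mulr0z.
case/orP => /and3P[hu hv huv] h0.
- have [_ r2] := @convex_le (- u%:~R) (- v%:~R) 0 t ltac:(lra) ltac:(lra) (introT andP (conj t0 t1)).
  by have := r2 ltac:(lra); lra.
- have [_ r2] := @convex_le u%:~R v%:~R 0 t ltac:(lra) ltac:(lra) (introT andP (conj t0 t1)).
  by have := r2 ltac:(lra); lra.
Qed.

Lemma apart_seg a b c d s t : apart a b c d -> 0 < s < 1 -> 0 < t < 1 -> seg a b s <> seg c d t.
Proof.
move=> ap s01 t01 e; case/or3P: ap => [|h|h].
- case/or4P => h; move: (congr1 fst e) (congr1 snd e); rewrite /seg /= => e1 e2.
  + exact: below_seg h s01 t01 e1.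
  + exact: below_seg h t01 s01 (esym e1).
  + exact: below_seg h s01 t01 e2.
  + exact: below_seg h t01 s01 (esym e2).
- exact: one_side_seg h s01 t01 e.
- exact: one_side_seg h t01 s01 (esym e).
Qed.

Lemma off_seg a b c t : off a b c -> 0 < t < 1 -> seg a b t <> (c.1%:~R, c.2%:~R).
Proof.
move=> o t01 e; case/orP: o => [h|/eqP n0].
  have h' : apart a b c c by rewrite /apart h.
  by apply: (apart_seg h' t01 t01); rewrite e /seg !subrr !mulr0 !addr0.
apply: n0; apply/eqP; rewrite -(intr_eq0 F); apply/eqP.
have := rcross_seg a b t; rewrite e => <-.
by rewrite /rcross /cross /= !(rmorphB, rmorphM).
Qed.

Lemma seg_inj a b : a != b -> injective (seg a b).
Proof.
move=> ab s t e; have e1 := congr1 fst e; have e2 := congr1 snd e.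
rewrite /seg /= in e1 e2.
have inj (x y : int) : x != y -> x%:~R + s * (y%:~R - x%:~R) = x%:~R + t * (y%:~R - x%:~R) :> F ->
    s = t.
  move=> xy /addrI/mulIf; apply; rewrite subr_eq0 eqr_int eq_sym //.
have [e1'|n1] := eqVneq a.1 b.1; last exact: inj n1 e1.
have [e2'|n2] := eqVneq a.2 b.2; last exact: inj n2 e2.
by move: ab; rewrite [a]surjective_pairing [b]surjective_pairing e1' e2' eqxx.
Qed.

End Segments.

Lemma line_continuous (F : realFieldType) (x y : F) : continuous (fun t : F => x + t * y).
Proof.
by move=> t; apply: cvgD; [exact: cvg_cst | apply: cvgMr_tmp; exact: cvg_id].
Qed.

Lemma planar_drawing n (adj : rel 'I_n) (P : 'I_n -> point) :
  injective P -> (forall u, ~~ adj u u) ->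
  (forall u v w, adj u v -> off (P u) (P v) (P w)) ->
  (forall u v u' v', adj u v -> adj u' v' ->
     ~~ ((u == u') && (v == v')) -> ~~ ((u == v') && (v == u')) ->
     apart (P u) (P v) (P u') (P v')) ->
  planar adj.
Proof.
move=> injP irr offP apartP.
pose p u : R * R := ((P u).1%:~R, (P u).2%:~R).
exists p, (fun u v => seg (P u) (P v)) => edge.
have in01 (t : R) : t \in `]0, 1[ -> 0 < t < 1 by rewrite in_itv.
split.
- move=> u v [/eqP e1 /eqP e2]; apply: injP.
  rewrite !eqr_int in e1 e2.
  by rewrite [P u]surjective_pairing [P v]surjective_pairing (eqP e1) (eqP e2).
- move=> u v [uv lt]; split.
  + apply: continuous_subspaceT => t; rewrite /continuous_at.
    exact: (cvg_pair (@line_continuous R _ _ t) (@line_continuous R _ _ t)).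
  + move=> s t _ _; apply: seg_inj.
    by apply: contraTneq uv => /injP->.
  + by rewrite /seg /p !mul0r !addr0.
  + by rewrite /seg /p !mul1r !subrKC.
- move=> u v w t [uv _] /in01 t01; exact: off_seg (offP _ _ _ uv) t01.
- move=> u v u' v' s t [uv lt] [uv' lt'] ne /in01 s01 /in01 t01.
  apply: apart_seg s01 t01; apply: apartP => //.
    by apply/negP => /andP[/eqP e1 /eqP e2]; apply: ne; rewrite e1 e2.
  by apply/negP => /andP[/eqP e1 /eqP e2]; move: lt lt'; rewrite e1 e2 => ? ?; lia.
Qed.
End Drawing.

(** * The drawing of one tile *)

Definition loc : finType := ((vkind * bool + vkind) + ckind)%type.

Definition mk (p : nat * nat) (l : loc) : node variable clause :=
  match l with
  | inl (inl (v, b)) => inl (inl ((p, v), b))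
  | inl (inr v) => inl (inr (p, v))
  | inr k => inr (p, k)
  end.

Definition tile_of (k : node variable clause) : nat * nat :=
  match k with inl (inl (u, _)) => u.1 | inl (inr u) => u.1 | inr c => c.1 end.

Definition loc_of (k : node variable clause) : loc :=
  match k with
  | inl (inl (u, b)) => inl (inl (u.2, b)) | inl (inr u) => inl (inr u.2) | inr c => inr c.2
  end.

Lemma mkK k : mk (tile_of k) (loc_of k) = k.
Proof. by case: k => [[[[p v] b]|[p v]]|[p c]]. Qed.

Lemma tile_of_mk p l : tile_of (mk p l) = p.
Proof. by case: l => [[[v b]|v]|c]. Qed.

Lemma loc_of_mk p l : loc_of (mk p l) = l.
Proof. by case: l => [[[v b]|v]|c]. Qed.

Definition lit_loc (v : vkind) b : loc := inl (inl (v, b)).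
Definition tip_loc (v : vkind) : loc := inl (inr v).
Definition cls_loc (c : ckind) : loc := inr c.

(* A tile together with the ports behind it, on its west and south sides. *)
Definition eloc : eqType := (loc + bool)%type.
Definition own_ (l : loc) : eloc := inl l.

(** All edges that a tile can have, whatever [dis] and [free] are; an actual tile uses some of them,
    so one drawing serves for all. *)
Definition tile_edges : seq (eloc * eloc) :=
  flatten [seq (let: (a, b) := s in
    let P x := own_ (lit_loc (inl s) x) in let tp := own_ (tip_loc (inl s)) in
    let u := own_ (cls_loc (unit_clause s)) in
    let c d := own_ (cls_loc (port_clause s d)) in
    [:: (P true, P false); (P true, tp); (P false, tp); (P true, u); (P false, u);
        (P true, c true); (P false, c true); (P true, c false); (P false, c false);
        (P true, own_ (cls_loc some_state));
        (c true, if a then own_ (lit_loc (inr true) true) else inr true);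
        (c false, if b then own_ (lit_loc (inr false) true) else inr false)])
    | s <- [:: (false, false); (false, true); (true, false); (true, true)]] ++
  flatten [seq (let P x := own_ (lit_loc (inr d) x) in let tp := own_ (tip_loc (inr d)) in
    [:: (P true, P false); (P true, tp); (P false, tp)]) | d <- [:: true; false]].

Section Coordinates.
Local Open Scope ring_scope.
Import GRing.Theory.

Definition sgn (b : bool) : int := if b then 1 else -1.

Definition loc_point (l : loc) : point :=
  let at_state (s : tstate) (x y : int) : point := (sgn s.1 * x, sgn s.2 * y) in
  let at_port (d : bool) (x y : int) : point := if d then (x, y) else (y, x) in
  match l with
  | inl (inl (inl s, true)) => at_state s 2 2
  | inl (inl (inl s, false)) => at_state s 5 5
  | inl (inr (inl s)) => at_state s 4 3
  | inl (inl (inr d, true)) => at_port d 8 0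
  | inl (inl (inr d, false)) => at_port d 10 0
  | inl (inr (inr d)) => at_port d 9 1
  | inr (inl tt) => (0, 0)
  | inr (inr (inl s)) => at_state s 3 4
  | inr (inr (inr (s, true))) => at_state s 6 2
  | inr (inr (inr (s, false))) => at_state s 2 6
  end.

(** Tiles are 20 apart, so the negative literal of an east port, at [(10, 0)], is the point
    [(-10, 0)] of the next tile; similarly for north ports. *)
Definition eloc_point (x : eloc) : point :=
  match x with inl l => loc_point l | inr true => (-10, 0) | inr false => (0, -10) end.

Definition shift (p : nat * nat) (z : point) : point :=
  ((20 * p.1)%N%:Z + z.1, (20 * p.2)%N%:Z + z.2).

Definition gpos (k : node variable clause) : point := shift (tile_of k) (loc_point (loc_of k)).

Definition all_locs : seq loc :=
  [seq lit_loc v b | v <- [:: inl (false, false); inl (false, true); inl (true, false);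
     inl (true, true); inr true; inr false], b <- [:: true; false]] ++
  [seq tip_loc v | v <- [:: inl (false, false); inl (false, true); inl (true, false);
     inl (true, true); inr true; inr false]] ++
  cls_loc some_state ::
  [seq cls_loc (unit_clause s) | s <- [:: (false, false); (false, true); (true, false); (true, true)]] ++
  [seq cls_loc (port_clause s d) | s <- [:: (false, false); (false, true); (true, false); (true, true)],
     d <- [:: true; false]].

Lemma all_locsP l : l \in all_locs.
Proof.
case: l => [[[[[[] []]|[]] []]|[[[] []]|[]]]|[[]|[[[] []]|[[[] []] []]]]]; by vm_compute.
Qed.

Definition none_edge : eloc * eloc := (inr true, inr true).

(** Within one tile, planarity is a finite computation with integers. *)
Lemma edges_apart : all (fun i => all (fun j => (i == j) ||
    (let e := nth none_edge tile_edges i in let e' := nth none_edge tile_edges j in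
     apart (eloc_point e.1) (eloc_point e.2) (eloc_point e'.1) (eloc_point e'.2)))
  (iota 0 (size tile_edges))) (iota 0 (size tile_edges)).
Proof. by vm_compute. Qed.

Lemma edges_off : all (fun e => all (fun l => off (eloc_point e.1) (eloc_point e.2) (loc_point l)) all_locs) tile_edges.
Proof. by vm_compute. Qed.

Definition inside (z : int) : bool := (-10 <= z) && (z <= 10).

(** An edge may touch a side of the square of its tile with one end but does not lie in that side.
    Edges of different tiles are therefore separated along an axis. *)
Definition in_box (z z' : int) : bool :=
  [&& inside z, inside z', -20 < z + z' & z + z' < 20].

Lemma edges_box : all (fun e => in_box (eloc_point e.1).1 (eloc_point e.2).1 &&
  in_box (eloc_point e.1).2 (eloc_point e.2).2) tile_edges.
Proof. by vm_compute. Qed.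

Lemma loc_point_range l : [&& -10 < (loc_point l).1, (loc_point l).1 <= 10, -10 < (loc_point l).2 & (loc_point l).2 <= 10].
Proof.
have H : all (fun l => [&& -10 < (loc_point l).1, (loc_point l).1 <= 10, -10 < (loc_point l).2 & (loc_point l).2 <= 10]) all_locs.
  by vm_compute.
exact: (allP H _ (all_locsP l)).
Qed.

Lemma loc_point_inj : injective loc_point.
Proof.
have U : uniq [seq loc_point l | l <- all_locs] by vm_compute.
move=> l l' e.
have il := all_locsP l; have il' := all_locsP l'.
have := nth_uniq (0, 0) _ _ U; rewrite size_map.
move/(_ (index l all_locs) (index l' all_locs)); rewrite !index_mem => /(_ il il').
by rewrite !(nth_map l) ?index_mem // !nth_index // e eqxx => /esym/eqP/index_inj; apply.
Qed.

Lemma gpos_inj : injective gpos.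
Proof.
move=> k k'; rewrite -[k]mkK -[k']mkK /gpos !tile_of_mk !loc_of_mk.
have /and4P[a1 a2 a3 a4] := loc_point_range (loc_of k).
have /and4P[b1 b2 b3 b4] := loc_point_range (loc_of k').
case: (tile_of k) (tile_of k') => x y [x' y'] /= [e1 e2].
have ex : x = x' by lia.
have ey : y = y' by lia.
subst x' y'; congr mk; apply: loc_point_inj.
rewrite [LHS]surjective_pairing [RHS]surjective_pairing.
by congr pair; lia.
Qed.

Definition place (p : nat * nat) (x : eloc) : node variable clause :=
  match x with inl l => mk p l | inr d => lit _ (behind p d, inr d) false end.

Definition placeable (p : nat * nat) (x : eloc) : bool :=
  if x is inr d then has_behind p d else true.

Lemma gpos_place p x : placeable p x -> gpos (place p x) = shift p (eloc_point x).
Proof.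
case: x => [l|d] /= hp; first by rewrite /gpos tile_of_mk loc_of_mk.
case: p d hp => x y [] /= hp; rewrite /gpos /shift /=; congr pair; lia.
Qed.

Section Adjacency.
Variables (dis : nat -> nat -> tstate -> bool) (free : nat -> nat -> tstate -> bool -> bool).
Local Notation adjacent := (node_adj (occurs dis free)).

Definition edge_at (k k' : node variable clause) : Prop := exists p e,
  [/\ e \in tile_edges, placeable p e.1, placeable p e.2, k = place p e.1 & k' = place p e.2].

Lemma occurs_edge c u b : occurs dis free c u b -> edge_at (lit _ u b) (cls _ c) \/ edge_at (cls _ c) (lit _ u b).
Proof.
case: c u => p k [p' v]; case: k => [[]|[s|[s d]]]; case: v => [s'|d'] //=.
- case/andP=> /eqP-> ->; left; exists p, (own_ (lit_loc (inl s') true), own_ (cls_loc some_state)).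
  by split=> //; case: s' => [[] []].
- case/and3P=> /eqP-> /eqP-> _; left.
  exists p, (own_ (lit_loc (inl s) b), own_ (cls_loc (unit_clause s))).
  by split=> //; case: s b => [[] []] [].
- case/and3P=> /eqP-> /eqP-> _; left.
  exists p, (own_ (lit_loc (inl s) b), own_ (cls_loc (port_clause s d))).
  by split=> //; case: s b d => [[] []] [] [].
- case/andP=> /eqP->; case: ifP => [cs /andP[/eqP-> ->]|cs /and3P[hp /eqP-> nb]]; right.
    exists p, (own_ (cls_loc (port_clause s d)), own_ (lit_loc (inr d) true)).
    by split=> //; move: cs; case: s d => [[] []] [].
  exists p, (own_ (cls_loc (port_clause s d)), inr d).
  split=> //; first by move: cs; case: s d {hp} => [[] []] [].
  by rewrite /place (negPf nb).
Qed.

Lemma adj_edge k k' : adjacent k k' -> edge_at k k' \/ edge_at k' k.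
Proof.
case: k k' => [[[[p v] b]|[p v]]|c] [[[[p' v'] b']|[p' v']]|c'] //=.
- case/andP=> /eqP[<- <-] nb.
  case: b b' nb => [] [] // _; [left | right]; exists p, (own_ (lit_loc v true), own_ (lit_loc v false));
  by split=> //; case: v => [[[] []]|[]].
- move=> /eqP[<- <-]; left; exists p, (own_ (lit_loc v b), own_ (tip_loc v)).
  by split=> //; case: v b => [[[] []]|[]] [].
- by move=> /occurs_edge.
- move=> /eqP[<- <-]; right; exists p', (own_ (lit_loc v' b'), own_ (tip_loc v')).
  by split=> //; case: v' b' => [[[] []]|[]] [].
- by move=> /occurs_edge[]; auto.
Qed.

Lemma shift_cross p a b c : cross (shift p a) (shift p b) (shift p c) = cross a b c.
Proof. by rewrite /cross /shift /=; ring. Qed.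

Lemma shift_below (x a b c d : int) : below (x + a) (x + b) (x + c) (x + d) = below a b c d.
Proof. by rewrite /below; lia. Qed.

Lemma shift_apart p a b c d : apart (shift p a) (shift p b) (shift p c) (shift p d) = apart a b c d.
Proof. by rewrite /apart /one_side /axis_apart !shift_cross /= !shift_below. Qed.

Lemma shift_off p a b c : off (shift p a) (shift p b) (shift p c) = off a b c.
Proof. by rewrite /off /axis_apart !shift_cross /= !shift_below. Qed.

Lemma box_below (x y : nat) (a b c d : int) : (x < y)%N -> in_box a b -> in_box c d ->
  below ((20 * x)%N%:Z + a) ((20 * x)%N%:Z + b) ((20 * y)%N%:Z + c) ((20 * y)%N%:Z + d).
Proof. by rewrite /below /in_box /inside; lia. Qed.

Lemma apartC a b c d : apart a b c d = apart c d a b.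
Proof.
rewrite /apart /axis_apart; set o1 := one_side a b c d; set o2 := one_side c d a b.
by move: o1 o2 (below a.1 _ _ _) (below c.1 _ _ _) (below a.2 _ _ _) (below c.2 _ _ _) => [] [] [] [] [] [].
Qed.

Lemma crossC a b c : cross b a c = - cross a b c.
Proof. by rewrite /cross; ring. Qed.

Lemma belowC (a b c d : int) : below b a c d = below a b c d.
Proof. by rewrite /below; lia. Qed.

Lemma belowCr (a b c d : int) : below a b d c = below a b c d.
Proof. by rewrite /below; lia. Qed.

Lemma apart_swap a b c d : apart b a c d = apart a b c d.
Proof.
have os1 : one_side b a c d = one_side a b c d.
  by rewrite /one_side !(crossC a b) /=; move: (cross a b c) (cross a b d) => u v; lia.
have os2 : one_side c d b a = one_side c d a b.
  by rewrite /one_side /=; move: (cross c d a) (cross c d b) => u v; lia.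
rewrite /apart /axis_apart os1 os2.
by rewrite (belowC a.1) (belowC a.2) (belowCr c.1) (belowCr c.2).
Qed.

Lemma off_swap a b c : off b a c = off a b c.
Proof.
rewrite /off /axis_apart (belowC a.1) (belowC a.2) (belowCr c.1 c.1 a.1) (belowCr c.2 c.2 a.2).
by rewrite (crossC a b) oppr_eq0.
Qed.

End Adjacency.
End Coordinates.

(** * The graph of all tiles: planarity, bandwidth and degree *)

Section TileGraph.
Variables (X H : nat).
Variables (dis : nat -> nat -> tstate -> bool) (free : nat -> nat -> tstate -> bool -> bool).
Hypotheses (X_gt0 : 0 < X) (H_gt0 : 0 < H).
Local Notation adjacent := (node_adj (occurs dis free)).
Local Notation ranged := (in_range (var_in X H) (clause_in X H)).

Lemma off_tile k k' k0 : edge_at k k' -> off (gpos k) (gpos k') (gpos k0).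
Proof.
case=> p [e [ein h1 h2 -> ->]]; rewrite !gpos_place // /gpos.
move: (tile_of k0) (loc_of k0) => q l; have [->|ne] := eqVneq q p.
  by rewrite shift_off (allP (allP edges_off _ ein) _ (all_locsP l)).
have /andP[b1 b2] := allP edges_box _ ein; have /and4P[c1 c2 c3 c4] := loc_point_range l.
rewrite /off /axis_apart; apply/orP; left; move: b1 b2 c1 c2 c3 c4.
rewrite /in_box /inside /below /shift /=.
move: (eloc_point e.1) (eloc_point e.2) (loc_point l) => [a1 a2] [b1 b2] [d1 d2] /=.
case: q p {h1 h2} ne => x y [x' y'] /= ne *.
have [?|[?|[?|?]]] : x < x' \/ x' < x \/ y < y' \/ y' < y.
- have : ~ (x = x' /\ y = y') by move=> [ex ey]; rewrite ex ey eqxx in ne.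
  by clear; lia.
- by apply/or4P; constructor 2; lia.
- by apply/or4P; constructor 1; lia.
- by apply/or4P; constructor 4; lia.
- by apply/or4P; constructor 3; lia.
Qed.

Lemma edges_nth i j : i < size tile_edges -> j < size tile_edges -> i != j ->
  let e := nth none_edge tile_edges i in let e' := nth none_edge tile_edges j in
  apart (eloc_point e.1) (eloc_point e.2) (eloc_point e'.1) (eloc_point e'.2).
Proof.
move=> il jl ij; have h := allP edges_apart i; rewrite mem_iota in h.
have := allP (h il) j; rewrite mem_iota => /(_ jl).
by rewrite (negPf ij).
Qed.

Lemma apart_tiles k1 k2 k3 k4 : edge_at k1 k2 -> edge_at k3 k4 -> ~ (k1 = k3 /\ k2 = k4) ->
  apart (gpos k1) (gpos k2) (gpos k3) (gpos k4).
Proof.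
case=> p [e [ein h1 h2 -> ->]] [q [e' [ein' h1' h2' -> ->]]]; rewrite !gpos_place //.
have [->|ne] := eqVneq q p => diff.
  rewrite shift_apart.
  have := @edges_nth (index e tile_edges) (index e' tile_edges).
  rewrite !index_mem !nth_index //; apply=> //.
  by apply/eqP => /(congr1 (nth none_edge tile_edges)); rewrite !nth_index // => ee; apply: diff; rewrite ee.
have /andP[b1 b2] := allP edges_box _ ein; have /andP[b3 b4] := allP edges_box _ ein'.
rewrite /apart /axis_apart; apply/orP; left; rewrite /shift /=.
have [?|[?|[?|?]]] : q.1 < p.1 \/ p.1 < q.1 \/ q.2 < p.2 \/ p.2 < q.2.
- have : ~ (q.1 = p.1 /\ q.2 = p.2) by case: (p) (q) ne => x y [x' y'] /= ne [ex ey]; rewrite ex ey eqxx in ne.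
  by clear; lia.
- by apply/or4P; constructor 2; apply: box_below.
- by apply/or4P; constructor 1; apply: box_below.
- by apply/or4P; constructor 4; apply: box_below.
- by apply/or4P; constructor 3; apply: box_below.
Qed.


Definition loc_at (i : nat) : loc := nth (cls_loc some_state) all_locs i.
(** Twelve literals, six tips and thirteen clauses in each tile. *)
Definition nlocs : nat := 31.

Lemma index_locs l : index l all_locs < nlocs.
Proof. by have : size all_locs = nlocs by []; move=> <-; rewrite index_mem all_locsP. Qed.

Lemma index_locK l : loc_at (index l all_locs) = l.
Proof. by rewrite /loc_at nth_index ?all_locsP. Qed.

Lemma loc_atK i : i < nlocs -> index (loc_at i) all_locs = i.
Proof. by move=> lt; rewrite /loc_at index_uniq //; vm_compute. Qed.

Definition nverts : nat := X * H * nlocs.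

(** Tiles are numbered column by column. Edges join equal or consecutive columns, and a column has
    [H * nlocs] vertices, whence the bandwidth bound. *)
Definition vertex (v : nat) : node variable clause :=
  mk ((v %/ nlocs) %/ H, (v %/ nlocs) %% H) (loc_at (v %% nlocs)).

Definition number (k : node variable clause) : nat :=
  ((tile_of k).1 * H + (tile_of k).2) * nlocs + index (loc_of k) all_locs.

Lemma vertexK v : number (vertex v) = v.
Proof.
rewrite /number /vertex tile_of_mk loc_of_mk loc_atK ?ltn_mod // [_.1]/= [_.2]/=.
by rewrite -!divn_eq.
Qed.

Lemma numberK k : (tile_of k).2 < H -> vertex (number k) = k.
Proof.
move=> lt; rewrite /vertex /number divnMDl // (divn_small (index_locs _)) addn0.
rewrite modnMDl (modn_small lt) modnMDl (modn_small (index_locs _)) index_locK.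
rewrite divnMDl ?(divn_small lt) ?addn0; last by apply: leq_trans lt.
by rewrite -[RHS]mkK; case: (tile_of k).
Qed.

Lemma rangedE k : ranged k = in_grid X H (tile_of k).
Proof. by case: k => [[[[p v] b]|[p v]]|[p c]]. Qed.

Lemma number_lt k : ranged k -> number k < nverts.
Proof.
rewrite rangedE /number /nverts => /andP[]; move: (tile_of k).1 (tile_of k).2 (index_locs (loc_of k)) => x y.
move: (index _ _) => o oL xX yH.
have : x * H + y + 1 <= X * H by apply: leq_trans (_ : x.+1 * H <= _); [lia | rewrite leq_mul2r xX orbT].
by move: (x * H + y) (X * H) => a b; rewrite /nlocs in oL *; lia.
Qed.

Lemma vertex_ranged v : v < nverts -> ranged (vertex v).
Proof.
move=> lt; rewrite rangedE tile_of_mk /in_grid /= ltn_mod H_gt0 andbT.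
by rewrite ltn_divLR // ltn_divLR.
Qed.

Lemma nverts_gt0 : 0 < nverts.
Proof. by rewrite /nverts !muln_gt0 X_gt0 H_gt0. Qed.

Definition dec (v : 'I_nverts) : node variable clause := vertex v.
Definition enc (k : node variable clause) : 'I_nverts := insubd (Ordinal nverts_gt0) (number k).

Lemma dec_ranged v : ranged (dec v).
Proof. exact: vertex_ranged. Qed.

Lemma val_enc k : ranged k -> enc k = number k :> nat.
Proof. by move=> /number_lt lt; rewrite /enc val_insubd lt. Qed.

Lemma decK : cancel dec enc.
Proof. by move=> v; apply/val_inj; rewrite /= val_enc ?dec_ranged // /dec vertexK. Qed.

Lemma encK k : ranged k -> dec (enc k) = k.
Proof.
by move=> kr; rewrite /dec val_enc // numberK //; move: kr; rewrite rangedE => /andP[].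
Qed.

Definition tile_adj : rel 'I_nverts := sat_adj (occurs dis free) dec.

Lemma tile_adj_sym : symmetric tile_adj.
Proof. by move=> u v; apply: node_adj_sym. Qed.

Lemma tile_adj_irr : irreflexive tile_adj.
Proof. by move=> u; apply: node_adj_irr. Qed.

Lemma tile_adj_planar : planar tile_adj.
Proof.
have inj := can_inj decK.
apply: (@planar_drawing _ _ (fun v => gpos (dec v))).
- by move=> u v /gpos_inj/inj.
- by move=> u; rewrite tile_adj_irr.
- move=> u v w /adj_edge[e|e]; last rewrite off_swap; exact: off_tile e.
move=> u v u' v' /adj_edge uv /adj_edge uv' n1 n2.
have {}n1 : ~ (dec u = dec u' /\ dec v = dec v').
  by case=> /inj e1 /inj e2; rewrite e1 e2 !eqxx in n1.
have {}n2 : ~ (dec u = dec v' /\ dec v = dec u').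
  by case=> /inj e1 /inj e2; rewrite e1 e2 !eqxx in n2.
case: uv => e1; case: uv' => e2.
- exact: apart_tiles.
- by rewrite apartC apart_swap apartC; apply: apart_tiles.
- by rewrite apart_swap; apply: apart_tiles => // -[? ?]; apply: n2.
- by rewrite apart_swap apartC apart_swap apartC; apply: apart_tiles => // -[? ?]; apply: n1.
Qed.

Lemma edge_columns k k' : edge_at k k' ->
  (tile_of k).1 <= (tile_of k').1.+1 /\ (tile_of k').1 <= (tile_of k).1.+1.
Proof.
clear X_gt0 H_gt0; case=> p [e [_ _ _ -> ->]].
have t x : (tile_of (place p x)).1 <= p.1 <= (tile_of (place p x)).1.+1.
  case: x => [l|d] /=; first by rewrite tile_of_mk; lia.
  by case: p => a b; case: d => /=; lia.
have := t e.1; have := t e.2; lia.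
Qed.

Lemma tile_adj_near u v : tile_adj u v -> v < u + 2 * H * nlocs.
Proof.
have col (w : 'I_nverts) : (tile_of (dec w)).1 = w %/ (H * nlocs).
  by rewrite tile_of_mk /= -divnMA mulnC.
move=> /adj_edge uv; have : (tile_of (dec v)).1 <= (tile_of (dec u)).1.+1.
  by case: uv => /edge_columns[].
rewrite !col -mulnA; have P0 : 0 < H * nlocs by rewrite muln_gt0 H_gt0.
move: (H * nlocs) P0 => P P0; have := divn_eq u P; have := divn_eq v P.
have := ltn_pmod u P0; have := ltn_pmod v P0.
by move: (u %/ P) (v %/ P) (u %% P) (v %% P) => a b c d; nia.
Qed.

Lemma tile_adj_bandwidth : bandwidth tile_adj <= 2 * H * nlocs.
Proof.
rewrite /bandwidth; case: arg_minnP => [|f _ /(_ [ffun x => enum_rank x])].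
  by apply/injectiveP => u v; rewrite !ffunE => /enum_rank_inj.
move=> /(_ _)/leq_trans; apply; first by apply/injectiveP => u v; rewrite !ffunE => /enum_rank_inj.
apply/bigmax_leqP => [[u v]] /= uv.
rewrite !ffunE !enum_rank_ord /=.
have := tile_adj_near uv; rewrite tile_adj_sym in uv; have := tile_adj_near uv.
by lia.
Qed.

Definition ahead (p : nat * nat) (d : bool) := if d then (p.1.+1, p.2) else (p.1, p.2.+1).

Definition all_states : seq tstate := [:: (false, false); (false, true); (true, false); (true, true)].

Definition neighbours (k : node variable clause) : seq (node variable clause) :=
  match k with
  | inl (inl ((p, inl s), b)) =>
      [:: lit _ (p, inl s) (~~ b); tip _ (p, inl s); cls _ (p, unit_clause s);
          cls _ (p, port_clause s true); cls _ (p, port_clause s false)] ++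
      (if b then [:: cls _ (p, some_state)] else [::])
  | inl (inl ((p, inr d), b)) =>
      [:: lit _ (p, inr d) (~~ b); tip _ (p, inr d)] ++
      [seq cls _ (if b then p else ahead p d, port_clause s d) | s <- all_states & carries s d == b]
  | inl (inr u) => [:: lit _ u true; lit _ u false]
  | inr (p, inl tt) => [seq lit _ (p, inl s) true | s <- all_states]
  | inr (p, inr (inl s)) => [:: lit _ (p, inl s) true; lit _ (p, inl s) false]
  | inr (p, inr (inr (s, d))) =>
      [:: lit _ (p, inl s) true; lit _ (p, inl s) false;
          lit _ (if carries s d then p else behind p d, inr d) (carries s d)]
  end.

Lemma size_neighbours k : size (neighbours k) <= 6.
Proof. by case: k => [[[[p [s|[]]] []]|u]|[p [[]|[s|[s d]]]]]. Qed.

Lemma behindK p d : has_behind p d -> ahead (behind p d) d = p.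
Proof. by case: p d => x y [] /= ?; rewrite prednK. Qed.

Lemma neighboursP k k' : adjacent k k' -> k' \in neighbours k.
Proof.
case: k => [[[u b]|u]|c]; case: k' => [[[u' b']|u']|c'] //.
- by case/andP=> /eqP<-; case: u b b' => p [s|d] [] []; rewrite // inE eqxx.
- by move/eqP=> <-; case: u b => p [s|d] []; rewrite // !inE eqxx ?orbT.
- case: u c' => p v [p' [[]|[s|[s d]]]]; case: v => [s'|d'] //; rewrite /node_adj /occurs.
  + by case/andP=> /eqP<- ->; rewrite !inE eqxx !orbT.
  + by case/and3P=> /eqP<- /eqP<- _; rewrite !inE eqxx ?orbT.
  + by case/and3P=> /eqP<- /eqP<- _; case: d; rewrite !inE eqxx ?orbT.
  case/andP=> /eqP->; case: ifP => cs.
    case/andP=> /eqP-> ->; rewrite /neighbours mem_cat; apply/orP; right; apply/mapP.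
    by exists s; rewrite // mem_filter cs; case: s cs => [[] []].
  case/and3P=> hb /eqP-> /negPf->; rewrite /neighbours behindK // mem_cat; apply/orP; right; apply/mapP.
  by exists s; rewrite // mem_filter cs; case: s cs => [[] []].
- by move/eqP=> <-; case: b'; rewrite !inE eqxx ?orbT.
- case: u' c => p' v [p [[]|[s|[s d]]]]; case: v => [s'|d'] //=.
  + by case/andP=> /eqP<- ->; case: s' => [[] []]; rewrite !inE eqxx ?orbT.
  + by case/and3P=> /eqP<- /eqP<- _; case: b'; rewrite !inE eqxx ?orbT.
  + by case/and3P=> /eqP<- /eqP<- _; case: b'; rewrite !inE eqxx ?orbT.
  + case/andP=> /eqP->; rewrite !inE; case: ifP => [_ /andP[/eqP<- ->]|_ /and3P[_ /eqP-> /negPf->]];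
    by rewrite eqxx !orbT.
Qed.

(** The list [neighbours] never exceeds six. A positive state literal attains this when the three
    clauses of its state are switched off, since switching off adds just this literal to them. *)
Lemma tile_adj_degree p s : in_grid X H p -> ~~ dis p.1 p.2 s -> free p.1 p.2 s true ->
  free p.1 p.2 s false -> max_degree tile_adj = 6.
Proof.
move=> pin nd f1 f2; apply/eqP; rewrite eqn_leq; apply/andP; split.
  apply/bigmax_leqP => v _; apply: leq_trans (size_neighbours (dec v)).
  apply: leq_trans (_ : size [seq enc k | k <- neighbours (dec v)] <= _); last by rewrite size_map.
  apply: leq_trans (card_size _); apply: subset_leq_card; apply/subsetP => w.
  by rewrite inE => /neighboursP h; apply/mapP; exists (dec w); rewrite ?decK.
pose k : node variable clause := lit clause (p, inl s) true; pose v := enc k.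
have kin : ranged k by rewrite rangedE.
apply: leq_trans (leq_bigmax v).
have -> : 6 = size [seq enc k' | k' <- neighbours k] by [].
apply: leq_trans (_ : #|[set w in [seq enc k' | k' <- neighbours k]]| <= _).
  rewrite cardsE (card_uniqP _) // map_inj_in_uniq; first by apply: (@map_uniq _ _ loc_of); rewrite /k; case: (s) => [[] []]; vm_compute.
  move=> k1 k2 h1 h2 /(congr1 dec); rewrite !encK //.
    by move: h2; rewrite !inE => /or4P[|||/or3P[]] /eqP->; rewrite rangedE.
  by move: h1; rewrite !inE => /or4P[|||/or3P[]] /eqP->; rewrite rangedE.
apply: subset_leq_card; apply/subsetP => w; rewrite in_set => /mapP[k' k'in ->].
rewrite in_set /tile_adj /sat_adj (encK kin).
have [ka kr] : adjacent k k' /\ ranged k'.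
  by move: k'in; rewrite /k !inE => /or4P[|||/or3P[]] /eqP->; rewrite rangedE pin; split=> //;
    rewrite /node_adj /occurs /lit /tip /cls /some_state /unit_clause /port_clause /negb; cbv beta iota; rewrite ?eqxx ?nd ?f1 ?f2 ?orbT.
by rewrite encK.
Qed.

Lemma sum_periodic (f : nat -> nat) q k :
  \sum_(0 <= i < k * q) f (i %% q) = k * \sum_(0 <= i < q) f i.
Proof.
elim: k => [|k IH]; first by rewrite mul0n big_geq.
rewrite mulSn (big_cat_nat (n := q)) ?leq_addr //= mulSn; congr (_ + _).
  by apply: eq_big_nat => i /andP[_ lt]; rewrite modn_small.
rewrite -IH -{1}[q]add0n big_addn addKn; apply: eq_bigr => i _.
by rewrite modnDr.
Qed.

Lemma nb_tile_vars : nb_vars dec = X * H * 6.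
Proof.
rewrite /nb_vars cardsE -sum1_card big_mkcond /=.
pose f i : nat := is_tip (mk (0, 0) (loc_at i)).
rewrite (eq_bigr (fun v : 'I_nverts => f (v %% nlocs))); last first.
  move=> v _; rewrite /f /dec /vertex unfold_in; case: (loc_at _) => [[[u b]|u]|c] //.
rewrite -(big_mkord xpredT (fun i => f (i %% nlocs))) sum_periodic; congr (_ * _).
by rewrite /f unlock.
Qed.


End TileGraph.

(** * The reduction from acceptance by a machine *)

Section Reduction.
Variables (M : tm) (N : nat).
Hypothesis N_gt1 : 1 < N.

Definition letters : finType := symbol (tcell M).
Definition nletters : nat := #|letters|.
Definition default_letter : letters := inl (end_cell M, None).
Definition letter_at (a : nat) : letters := nth default_letter (enum letters) a.
Definition code (l : letters) : nat := index l (enum letters).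

Lemma code_lt l : code l < nletters.
Proof. by rewrite /nletters cardE index_mem mem_enum. Qed.

Lemma codeK l : letter_at (code l) = l.
Proof. by rewrite /letter_at nth_index ?mem_enum. Qed.

Lemma letter_atK a : a < nletters -> code (letter_at a) = a.
Proof. by move=> lt; rewrite /code index_uniq ?enum_uniq // -cardE. Qed.

Lemma nletters_gt0 : 0 < nletters.
Proof. exact: leq_ltn_trans (code_lt default_letter). Qed.

Definition rel_at (e : bool) (a b : nat) : bool :=
  compat (@step2 M) e (letter_at a) (letter_at b).

Local Notation W := N.*2.
Local Notation m := nletters.
Local Notation wok := (word_ok m W rel_at).
Local Notation wstep := (word_step m W rel_at).

Lemma word_ok_code s : good (@step2 M) N s -> wok (code \o s).
Proof.
move=> gs; split=> [i _|i i0 iW]; first exact: code_lt.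
by rewrite /rel_at /= !codeK; apply: gs.
Qed.

Lemma reach_code s s' : good (@step2 M) N s -> good (@step2 M) N s' ->
  reach (symbol_step (@step2 M) N) s s' <-> reach wstep (code \o s) (code \o s').
Proof.
move=> gs gs'; split.
  elim=> {s s' gs gs'} [s|s s1 s2 [g1 g2 [i iW [a e]]] _ IH]; first exact: reach_refl.
  apply: reach_step IH; split; try exact: word_ok_code.
  exists i => //; exists (code a); rewrite e; apply/funext => j.
  by rewrite /= !updE; case: eqP.
have decode w : (forall i a, upd w i a = upd w i a) -> wok w -> good (@step2 M) N (letter_at \o w).
  by move=> _ [_ R] i i0 iW; apply: R.
have sE t : t = letter_at \o (code \o t) by apply/funext => i; rewrite /= codeK.
move=> r; rewrite [s]sE [s']sE; elim: r => {s s' gs gs'} [w|w w1 w2 [o1 o2 [i iW [a e]]] _ IH].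
  exact: reach_refl.
apply: reach_step IH; split; try exact: decode.
exists i => //; exists (letter_at a); rewrite e; apply/funext => j.
by rewrite /= !updE; case: eqP.
Qed.

Local Notation X := (W * m).
Local Notation H := (height m).
Local Notation disN := (dis m rel_at).
Local Notation freeN := (exempt m).

Lemma X_gt0 : 0 < X. Proof. by rewrite muln_gt0 nletters_gt0; lia. Qed.
Lemma H_gt0 : 0 < H. Proof. by []. Qed.

Definition red_size : nat := nverts X H.
Definition red_adj : rel 'I_red_size := tile_adj disN freeN.

Definition start_assignment x := word_assignment m W (code \o spread (init_word M N x)).
Definition final_assignment := word_assignment m W (code \o spread (accept_word M N)).

Definition red_source x : {set 'I_red_size} := chosen (@dec X H) (start_assignment x).
Definition red_target : {set 'I_red_size} := chosen (@dec X H) final_assignment.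

Let okS g : wok (code \o spread g).
Proof. exact/word_ok_code/good_spread. Qed.

Let decE := encK X_gt0 H_gt0.
Let decR := @dec_ranged X H H_gt0.

Lemma red_source_dom x : dominating red_adj (red_source x).
Proof. exact: (dominating_chosen decE decR (word_satisfies nletters_gt0 (okS _))). Qed.

Lemma red_target_dom : dominating red_adj red_target.
Proof. exact: (dominating_chosen decE decR (word_satisfies nletters_gt0 (okS _))). Qed.

Definition red x : dsr_instance :=
  DSRInstance (@tile_adj_sym X H disN freeN) (@tile_adj_irr X H disN freeN)
    (red_source_dom x) red_target_dom (X * H * 6).+1%:Z%R.

Lemma assignment_out w u : ~~ var_in X H u -> word_assignment m W w u = false.
Proof. by rewrite /word_assignment /assignment /var_in => /negPf->. Qed.

(** Acceptance is carried through all levels: rewriting of cells, words of symbols, words of their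
    codes, satisfying assignments, dominating sets. *)
Lemma red_iff x t : (forall t, fits N (run M x t).2) -> halted (run M x t) ->
  dsr_tar_yes (red x) <-> accepting (run M x t).1.
Proof.
move=> ft hlt; rewrite (accept_iff N_gt1 ft hlt) /dsr_tar_yes /=.
have N0 : 0 < N by lia.
have out i : N <= i -> accept_word M N i = init_word M N x i.
  move=> Ni; rewrite /accept_word /init_word /partway /tape_cell.
  have -> : (i < N.-1) = false by lia.
  have -> : N.-1 <= i by lia.
  by have [-> ->] : (i == 0) = false /\ (i == N.-1) = false by lia.
rewrite -(reach_rewrites (@step2_kind M) N0 _ _ out); last first.
- rewrite /init_word /partway /tape_cell /lastk /= leqnn.
  by have -> : (N.-1 == 0) = false by lia.
- by [].
rewrite (reach_code (@good_spread _ _ N _) (@good_spread _ _ N _)).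
have sat g := word_satisfies nletters_gt0 (okS g).
have decK' := decK X_gt0 H_gt0.
have -> : ((X * H * 6).+1%:Z)%R = ((nb_vars (@dec X H)).+1%:Z)%R by rewrite nb_tile_vars.
split=> [r|r].
  apply: (reach_word nletters_gt0 (okS _) (okS _)).
    move=> i Wi; rewrite /= /spread out //; lia.
  apply: (dominating_reach decK' decE decR _ (sat _) (sat _) r).
  by move=> u uo; rewrite !assignment_out.
apply: (reach_dominating decK' decE decR (sat _)).
exact: (word_reach nletters_gt0 (okS _) r).
Qed.

(** This depends on [M] through its alphabet, and not on [N]. *)
Definition red_bandwidth : nat := 2 * H * nlocs.

Lemma red_shape x :
  [/\ planar (@adj (red x)), max_degree (@adj (red x)) = 6 & bandwidth (@adj (red x)) <= red_bandwidth].
Proof.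
split; [exact: tile_adj_planar X_gt0 H_gt0 | | exact: tile_adj_bandwidth X_gt0 H_gt0].
have m0 := nletters_gt0.
(* The top tile of the first column: the border exempts both port clauses of a state with only a
   northward signal, and in the upper band, which belongs to odd positions, that state is not
   disabled in block 0. *)
apply: (@tile_adj_degree _ _ _ _ X_gt0 H_gt0 (0, 2 * m) (false, true)).
- by rewrite /in_grid X_gt0 /= /height ltnS.
- rewrite /dis /own /band /pos div0n /=.
  by have [-> ->] : (2 * m == 0) = false /\ (m < 2 * m) by lia.
- by rewrite /exempt /= eqxx.
- by rewrite /exempt /= eqxx.
Qed.

End Reduction.

(** * Periodicity of the instance along the grid *)

Section Periodicity.
Variables (m : nat) (R : bool -> nat -> nat -> bool).
Hypothesis m_gt0 : 0 < m.
Local Notation H := (height m).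
Local Notation adjacent := (node_adj (occurs (dis m R) (exempt m))).
Local Notation node := (node variable clause).

Local Arguments occurs : simpl never.

Definition east (s : nat) (k : node) : node := mk ((tile_of k).1 + s, (tile_of k).2) (loc_of k).

Lemma pos_shift t x : pos m (x + 2 * m * t) = pos m x + 2 * t.
Proof.
by rewrite /pos [2 * m]mulnC -mulnA [m * _]mulnC [x + _]addnC divnMDl // addnC.
Qed.

Lemma sy_shift t x : sy m (x + 2 * m * t) = sy m x.
Proof. by rewrite /sy [2 * m]mulnC -mulnA [m * _]mulnC [x + _]addnC modnMDl. Qed.

Lemma dis_shift t x y s : dis m R (x + 2 * m * t) y s = dis m R x y s.
Proof. by rewrite /dis /own !sy_shift pos_shift mul2n oddD odd_double addbF. Qed.

Lemma exempt_shift t x y s d : 0 < x -> exempt m (x + 2 * m * t) y s d = exempt m x y s d.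
Proof.
move=> x0; rewrite /exempt /own !sy_shift pos_shift mul2n oddD odd_double addbF.
by have [-> ->] : (x + 2 * m * t == 0) = false /\ (x == 0) = false by lia.
Qed.

Lemma occurs_shift t x y k x' y' v b : 0 < x ->
  occurs (dis m R) (exempt m) ((x + 2 * m * t, y), k) ((x' + 2 * m * t, y'), v) b =
  occurs (dis m R) (exempt m) ((x, y), k) ((x', y'), v) b.
Proof.
move=> x0; rewrite /occurs.
have e z z' : ((z + 2 * m * t, y') == (z' + 2 * m * t, y)) = ((z, y') == (z', y)).
  by rewrite !xpair_eqE eqn_add2r.
case: k v => [[]|[s|[s d]]] [s'|d'] //=; rewrite ?e ?dis_shift ?exempt_shift //.
congr (_ && _); case: ifP => // _.
have -> : has_behind (x + 2 * m * t, y) d = has_behind (x, y) d.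
  by rewrite /has_behind /=; case: d => //=; lia.
congr [&& _, _ & _]; case: d; rewrite /behind /= !xpair_eqE.
  by rewrite -[(x + _).-1](_ : x.-1 + 2 * m * t = _) ?eqn_add2r //; lia.
by rewrite eqn_add2r.
Qed.

Lemma adjacent_east t k k' : 0 < (tile_of k).1 -> 0 < (tile_of k').1 ->
  adjacent (east (2 * m * t) k) (east (2 * m * t) k') = adjacent k k'.
Proof.
have e (x y x' y' : nat) : ((x + 2 * m * t, y) == (x' + 2 * m * t, y')) = ((x, y) == (x', y')).
  by rewrite !xpair_eqE eqn_add2r.
case: k => [[[[[x y] v] b]|[[x y] v]]|[[x y] c]];
  case: k' => [[[[[x' y'] v'] b']|[[x' y'] v']]|[[x' y'] c']] //= h h';
  rewrite ?xpair_eqE ?eqn_add2r //; exact: occurs_shift.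
Qed.

(** The number of vertices over two positions, the two copies of one cell. Two positions are needed
    because the bands depend on parity. *)
Definition period : nat := 2 * m * (H * nlocs).

Lemma period_gt0 : 0 < period. Proof. by rewrite !muln_gt0 m_gt0. Qed.

Lemma column_lt o : o < period -> (o %/ nlocs) %/ H < 2 * m.
Proof. by move=> lt; rewrite ltn_divLR // ltn_divLR // -mulnA. Qed.

Lemma vertex_period j o :
  vertex H (j * period + o) = east (2 * m * j) (vertex H o).
Proof.
rewrite /vertex /east tile_of_mk loc_of_mk.
have -> : j * period + o = (2 * m * j * H) * nlocs + o.
  by rewrite /period; move: (2 * m) => a; nia.
rewrite divnMDl // modnMDl divnMDl // modnMDl [_.1]/= [_.2]/=.
by rewrite [2 * m * j + _]addnC.
Qed.

Lemma tile_vertex o : (tile_of (vertex H o)).1 = (o %/ nlocs) %/ H.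
Proof. by rewrite tile_of_mk. Qed.

Lemma eastE s s' k : east s (east s' k) = east (s' + s) k.
Proof. by rewrite /east !tile_of_mk !loc_of_mk /= addnA. Qed.

Lemma vertex_adjacent_near j j' o o' : o < period -> o' < period ->
  adjacent (vertex H (j * period + o)) (vertex H (j' * period + o')) ->
  [|| j == j', j.+1 == j' | j'.+1 == j].
Proof.
move=> lo lo'; rewrite !vertex_period => /adj_edge.
have c q i : (tile_of (east (2 * m * i) (vertex H q))).1 = (q %/ nlocs) %/ H + 2 * m * i.
  by rewrite tile_of_mk tile_vertex.
have l := column_lt lo; have l' := column_lt lo'.
have : forall a b k k', a = (tile_of k).1 -> b = (tile_of k').1 -> edge_at k k' \/ edge_at k' k ->
    a <= b.+1 /\ b <= a.+1.
  by move=> a b k k' -> -> [/edge_columns|/edge_columns[]].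
move=> g /(g _ _ _ _ (esym (c _ _)) (esym (c _ _))).
move: (_ %/ _) (o' %/ _ %/ _) l l' => a b l l' [h1 h2]; clear g c lo lo'; nia.
Qed.

Lemma adjacent_period t j j' o o' : 0 < j -> 0 < j' ->
  adjacent (vertex H ((j + t) * period + o)) (vertex H ((j' + t) * period + o')) =
  adjacent (vertex H (j * period + o)) (vertex H (j' * period + o')).
Proof.
move=> j0 j'0; rewrite !vertex_period !mulnDr -!eastE adjacent_east //.
  by rewrite tile_of_mk addn_gt0 !muln_gt0 m_gt0 j0 orbT.
by rewrite tile_of_mk addn_gt0 !muln_gt0 m_gt0 j'0 orbT.
Qed.

(** The offsets [o] and [o'] range over a constant set, so adjacency is a finite table in the five
    flags. The last two set block 0 apart, as its first column is the border; all other blocks look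
    alike. *)
Definition adj_table (o o' : nat) (l : seq bool) : bool :=
  if l is [:: same; next; last; p; p'] then
    if same then adjacent (vertex H (p * period + o)) (vertex H (p * period + o'))
    else if next then adjacent (vertex H (p * period + o)) (vertex H (p.+1 * period + o'))
    else if last then adjacent (vertex H (p'.+1 * period + o)) (vertex H (p' * period + o'))
    else false
  else false.

Lemma adj_tableP j j' o o' : o < period -> o' < period ->
  adjacent (vertex H (j * period + o)) (vertex H (j' * period + o')) =
  adj_table o o' [:: j == j'; j.+1 == j'; j'.+1 == j; 0 < j; 0 < j'].
Proof.
move=> lo lo' /=; case: eqP => [<-|nj].
  by case: j => [//|j]; exact: (@adjacent_period j 1 1 o o').
case: eqP => [<-|nj1].
  by case: j {nj} => [//|j]; exact: (@adjacent_period j 1 2 o o').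
case: eqP => [<-|nj2].
  by case: j' {nj nj1} => [//|j']; exact: (@adjacent_period j' 2 1 o o').
by apply/negP => /(vertex_adjacent_near lo lo')/or3P[]/eqP.
Qed.

Definition tile_value (w : nat -> nat) (u : variable) : bool :=
  match u.2 with
  | inl s => st (word_tiling m (fun i b => w i == b) w) u.1 == s
  | inr d => port (word_tiling m (fun i b => w i == b) w) u.1 d
  end.

Lemma tile_value_shift w w' t x y v : (0 < t -> 0 < pos m x) ->
  w' (pos m x) = w (pos m x + 2 * t) ->
  (0 < pos m x -> w' (pos m x).-1 = w (pos m x + 2 * t).-1) ->
  tile_value w ((x + 2 * m * t, y), v) = tile_value w' ((x, y), v).
Proof.
move=> t0 e0 e1.
have p0 : (0 < pos m x + 2 * t) = (0 < pos m x) by case: (posnP t) t0 => [->|t0 /(_ isT)]; lia.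
have rs : row_signal m (fun i b => w i == b) (x + 2 * m * t) y =
    row_signal m (fun i b => w' i == b) x y.
  rewrite /row_signal /own !sy_shift pos_shift mul2n oddD odd_double addbF -mul2n -e0 p0.
  by case: ifP => // _; case: posnP => // p1; rewrite e1 //; lia.
rewrite /tile_value /= rs !sy_shift pos_shift -e0 /own pos_shift mul2n oddD odd_double addbF.
by [].
Qed.

Definition vertex_value (w : nat -> nat) (k : node) : bool :=
  if k is inl (inl (u, b)) then tile_value w u == b else false.

Lemma chosen_vertex W w (v : 'I_(nverts (W * m) H)) :
  (v \in chosen (@dec (W * m) H) (word_assignment m W w)) = vertex_value w (vertex H v).
Proof.
rewrite inE; have := @dec_ranged (W * m) H isT v.
rewrite /dec /true_lit /vertex_value; case: (vertex H v) => [[[[p k] b]|//]|//] /= pin.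
by rewrite /word_assignment /assignment /tile_value /= (pin : in_grid _ _ _).
Qed.

Variables (A : Type) (g : nat -> A) (c : A -> nat).

Definition near_word (p : bool) (a a' : A) : nat -> nat := fun i => c (if p && (i < 2) then a' else a).

(** The signals in a column come from its own position and the preceding one, hence from cells [j]
    and [j.-1]; block 1 of a two-cell word represents all [j > 0]. *)
Lemma vertex_value_period j o : o < period ->
  vertex_value (fun i => c (g i./2)) (vertex H (j * period + o)) =
  vertex_value (near_word (0 < j) (g j) (g j.-1)) (vertex H ((0 < j) * period + o)).
Proof.
move=> lo; have l := column_lt lo.
have ej : j = (0 < j) + j.-1 by case: j => [//|j]; rewrite add1n.
rewrite {1}ej vertex_period mulnDr -eastE -vertex_period.
have : (tile_of (vertex H ((0 < j) * period + o))).1 = 2 * m * (0 < j) + o %/ nlocs %/ H.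
  by rewrite vertex_period tile_of_mk tile_vertex addnC.
case: (vertex H _) => [[[[[x y] v] b]|//]|//] ex; rewrite /east /= in ex *.
congr (_ == b); set a := _ %/ _ in ex l.
have pE : pos m x = 2 * (0 < j) + a %/ m.
  by rewrite ex addnC pos_shift addnC.
have am : a %/ m < 2 by rewrite ltn_divLR.
move: (a %/ m) am pE => q q2 pE; clear ej l ex.
apply: tile_value_shift; rewrite pE /near_word.
- by case: j {pE}.
- case: j {pE} => [|j] /=; congr c; first by congr g; lia.
  by congr g; lia.
- case: j {pE} => [|j] /= h; congr c; first by congr g; lia.
  case: ifP => h'; congr g; lia.
Qed.

End Periodicity.

(** * Printing the instance *)

Lemma bits_of_nat_succ k : bits_of_nat k.+1 = increment (bits_of_nat k).
Proof.
have inc p : bits_of_pos (PosDef.Pos.succ p) = increment (bits_of_pos p).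
  by elim: p => //= p ->.
have e q : bin_of_nat (nat_of_pos q).+1 = BinNums.Npos (PosDef.Pos.succ q).
  by rewrite -(nat_of_succ_pos q); exact: (nat_of_binK (BinNums.Npos _)).
rewrite /bits_of_nat; case: k => // k.
have -> : k.+2 = (nat_of_pos (pos_of_nat k k)).+1 by have := bin_of_natK k.+1 => /= ->.
by rewrite e inc.
Qed.

Lemma bits_of_natE k : bits_of_nat k = iter k increment [::].
Proof. by elim: k => // k IH; rewrite bits_of_nat_succ IH. Qed.

(** A decision tree over the truth values of [ts] with the values of [f] at its leaves; a positive
    [t] makes the factor [TSub (TConst 1) t] vanish. *)
Fixpoint ttable (ts : seq term) (f : seq bool -> bool) : term :=
  if ts is t :: ts' then
    TAdd (TMul t (ttable ts' (fun l => f (true :: l))))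
         (TMul (TSub (TConst 1) t) (ttable ts' (fun l => f (false :: l))))
  else TConst (f [::]).

Definition truth S env (t : term) : bool := 0 < den S env t.

Lemma truth_ttable S env ts f : truth S env (ttable ts f) = f [seq truth S env t | t <- ts].
Proof.
rewrite /truth; elim: ts f => [|t ts IH] f /=; first by case: (f _).
rewrite addn_gt0 !muln_gt0 !IH subn_gt0; case: (posnP (den S env t)) => [->//|h].
have -> : (den S env t < 1) = false by lia.
by rewrite orbF.
Qed.

Lemma ttable_ok D k ts f : all (term_ok D k) ts -> term_ok D k (ttable ts f).
Proof. by elim: ts f => //= t ts IH f /andP[-> h]; rewrite !IH. Qed.

Definition empty_out : out := OFor (TConst 0) (OEmit (TConst 0)).

Definition unroll (Q : nat) (F : nat -> out) : out := foldr OSeq empty_out [seq F o | o <- iota 0 Q].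

Lemma emitted_unroll S env Q F :
  emitted S env (unroll Q F) = flatten [seq emitted S env (F o) | o <- iota 0 Q].
Proof. by rewrite /unroll; elim: (iota 0 Q) => //= o l ->. Qed.

Lemma unroll_ok D k Q F : (forall o, out_ok D k (F o)) -> out_ok D k (unroll Q F).
Proof. by move=> ok; rewrite /unroll; elim: (iota 0 Q) => //= o l ->; rewrite ok. Qed.

Lemma iota_blocks (A : Type) (f : nat -> seq A) (Q n : nat) :
  flatten [seq flatten [seq f (j * Q + o) | o <- iota 0 Q] | j <- iota 0 n] =
  flatten [seq f v | v <- iota 0 (n * Q)].
Proof.
elim: n => // n IH; rewrite -[in LHS]addn1 iotaD map_cat flatten_cat IH.
rewrite mulSn [Q + n * Q]addnC iotaD map_cat flatten_cat; congr (_ ++ _).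
by rewrite /= cats0 !add0n -[in RHS](addn0 (n * Q)) iotaDl -map_comp.
Qed.

(* The positions come in blocks of [Q], one for each value of a loop variable. *)
Definition blocks (n : term) (Q : nat) (F : nat -> out) : out := OFor n (unroll Q F).

Lemma blocks_ok D k n Q F : term_ok D k n -> (forall o, out_ok D k.+1 (F o)) ->
  out_ok D k (blocks n Q F).
Proof. by move=> okn okF; rewrite /= okn unroll_ok. Qed.

Lemma emitted_blocks S env n Q F f :
  (forall j o, o < Q -> j < den S env n -> emitted S (j :: env) (F o) = f (j * Q + o)) ->
  emitted S env (blocks n Q F) = flatten [seq f v | v <- iota 0 (den S env n * Q)].
Proof.
move=> h; rewrite -iota_blocks /=; congr flatten; apply/eq_in_map => j.
rewrite mem_iota => /= jn; rewrite emitted_unroll; congr flatten; apply/eq_in_map => o.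
by rewrite mem_iota => /= oQ; apply: h.
Qed.


Fixpoint tpow (t : term) (e : nat) : term := if e is e'.+1 then TMul t (tpow t e') else TConst 1.

Lemma den_tpow S env t e : den S env (tpow t e) = den S env t ^ e.
Proof. by elim: e => //= e ->; rewrite expnS. Qed.

Lemma tpow_ok D k t e : term_ok D k t -> term_ok D k (tpow t e).
Proof. by move=> ok; elim: e => //= e ->; rewrite ok. Qed.

Definition teq (t u : term) : term := TSub (TConst 1) (TAdd (TSub t u) (TSub u t)).

Lemma truth_teq S env t u : truth S env (teq t u) = (den S env t == den S env u).
Proof. by rewrite /truth /=; lia. Qed.

Section Emission.
Variables (M : tm) (r c : nat).
Local Notation m := (nletters M).
Local Notation H := (height m).
Local Notation Q := (period m).
Local Notation R := (@rel_at M).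

Definition big : term := tpow (TAdd (TLen r) (TConst c)) c.

Definition cell_bit (l : seq bool) : option (bool + work M) :=
  if nth false l 3 then Some (inl (nth false l 2)) else None.

Definition input_cell (l : seq bool) : tcell M :=
  if ~~ nth false l 0 then
    (head_cell [ffun i => if i == ord0 then cell_bit l else None], Some (ready (start M)))
  else if ~~ nth false l 1 then (end_cell M, None)
  else (side_cell [ffun i => (None, if i == ord0 then cell_bit l else None)], None).

Definition final_cell (l : seq bool) : tcell M :=
  if ~~ nth false l 0 then (head_cell (no_heads M), None)
  else if ~~ nth false l 1 then (end_cell M, Some (cleaning M))
  else (side_cell (no_sides M), None).

(** These four flags tell head cell, side cells and end cell apart and give the input bit of a cell,
    if it has one; that determines the initial and the accepting word. *)
Definition cell_terms (t : term) : seq term :=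
  [:: t; TSub (TSub big (TConst 1)) t; TBit r t; TSub (TLen r) t].

Definition set_terms : seq term :=
  TVar 0 :: cell_terms (TVar 0) ++ cell_terms (TSub (TVar 0) (TConst 1)).

Definition set_bit (F : seq bool -> tcell M) (o : nat) (l : seq bool) : bool :=
  let p := nth false l 0 in
  vertex_value m
    (near_word (fun a : tcell M => code (inl a)) p (F (take 4 (drop 1 l))) (F (drop 5 l)))
    (vertex H (p * Q + o)).

Definition out_set F : out := blocks big Q (fun o => OEmit (ttable set_terms (set_bit F o))).

Definition adj_terms : seq term :=
  [:: teq (TVar 1) (TVar 0); teq (TAdd (TVar 1) (TConst 1)) (TVar 0);
      teq (TAdd (TVar 0) (TConst 1)) (TVar 1); TVar 1; TVar 0].

Definition out_adj : out :=
  blocks big Q (fun o => blocks big Q (fun o' => OEmit (ttable adj_terms (adj_table m R o o')))).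

(** The order is that of [encode]. The last bit is the sign of the threshold, whose binary digits
    are supplied by [printer]. *)
Definition red_out : out :=
  OSeq (blocks big Q (fun=> OEmit (TConst 1)))
  (OSeq (OEmit (TConst 0))
  (OSeq out_adj
  (OSeq (out_set input_cell) (OSeq (out_set final_cell) (OEmit (TConst 0)))))).

Definition red_threshold : term := TAdd (TMul big (TConst (2 * m * H * 6))) (TConst 1).

Lemma big_ok D k : r < D -> term_ok D k big.
Proof. by move=> rD; apply: tpow_ok; rewrite /= rD. Qed.

Lemma red_threshold_ok D k : r < D -> term_ok D k red_threshold.
Proof. by move=> rD; rewrite /red_threshold /= big_ok. Qed.

Lemma red_out_ok D : r < D -> out_ok D 0 red_out.
Proof.
move=> rD; have okb k : term_ok D k big by apply: big_ok.
have st F : out_ok D 0 (out_set F).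
  by apply: blocks_ok => // o; apply: ttable_ok; rewrite /= !okb rD.
have oka : out_ok D 0 out_adj.
  by apply: blocks_ok => // o; apply: blocks_ok => // o'; apply: ttable_ok.
have ok1 : out_ok D 0 (blocks big Q (fun=> OEmit (TConst 1))) by apply: blocks_ok.
have okS a b : out_ok D 0 a -> out_ok D 0 b -> out_ok D 0 (OSeq a b) by move=> /= -> ->.
have okE : out_ok D 0 (OEmit (TConst 0)) by [].
apply: (okS _ _ ok1 (okS _ _ okE (okS _ _ oka (okS _ _ (st _) (okS _ _ (st _) okE))))).
Qed.

Variable S : stacks.
Let x := S r.
Let N := (size x + c) ^ c.
Hypothesis N_gt1 : 1 < N.

Lemma den_big env : den S env big = N.
Proof. by rewrite /big den_tpow. Qed.

Definition cell_flags (j : nat) : seq bool := [:: 0 < j; j < N.-1; nth false x j; j < size x].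

Lemma cell_flagsE env t : [seq truth S env u | u <- cell_terms t] = cell_flags (den S env t).
Proof.
rewrite /truth /= den_big; congr [:: _; _; _; _]; last by rewrite subn_gt0.
  by rewrite subn_gt0 subn1.
by rewrite -/x; case: nth.
Qed.

Lemma input_cellE j : j < N -> init_word M N x j = input_cell (cell_flags j).
Proof.
move=> jN; rewrite /init_word /partway /= /tape_cell /input_cell /cell_flags /=.
have bit : nth None [seq Some (inl b) : sym (work M) | b <- x] j = cell_bit (cell_flags j).
  rewrite /cell_bit /=; case: ltnP => lt; first by rewrite (nth_map false).
  by rewrite nth_default ?size_map.
case: posnP => [j0|j0] /=.
  congr (inl _, _); apply/ffunP => i; rewrite !ffunE /=; case: eqP => // _.
  by rewrite -[cell_bit _]/(cell_bit (cell_flags j)) -bit j0 nth0.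
rewrite -leqNgt; case: leqP => // lt; congr (inr (inl _), _).
apply/ffunP => i; rewrite !ffunE /= nth_nil; case: eqP => _ /=; last by rewrite nth_nil.
by rewrite -[cell_bit _]/(cell_bit (cell_flags j)) -bit nth_behead prednK.
Qed.

Lemma final_cellE j : j < N -> accept_word M N j = final_cell (cell_flags j).
Proof.
move=> jN; rewrite /accept_word /partway /final_cell /cell_flags /=.
have [lt|le] := ltnP j N.-1.
  by rewrite tape_cell_blank // (ltn_eqF lt); case: (posnP j).
rewrite /tape_cell le; have -> : j == N.-1 by lia.
by case: posnP => // j0; lia.
Qed.

Lemma emitted_set F g : (forall j, j < N -> g j = F (cell_flags j)) ->
  emitted S [::] (out_set F) =
  [seq vertex_value m (fun i => code (inl (g i./2))) (vertex H v) | v <- iota 0 (N * Q)].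
Proof.
move=> gF; rewrite -flatten_map1 -(den_big [::]).
apply: (@emitted_blocks _ _ _ _ _ (fun v => [:: vertex_value m _ (vertex H v)])).
move=> j o oQ; rewrite den_big => jN.
rewrite -[LHS]/[:: truth S [:: j] (ttable set_terms (set_bit F o))] truth_ttable; congr [:: _].
rewrite (@vertex_value_period m (nletters_gt0 M) _ _ (fun a : tcell M => code (inl a))) //.
rewrite /set_terms map_cons map_cat !cell_flagsE /set_bit; cbv zeta.
rewrite -[nth false _ 0]/(0 < j) -[take 4 _]/(cell_flags j) -[drop 5 _]/(cell_flags (j - 1)).
rewrite subn1 -!gF //; exact: leq_ltn_trans (leq_pred _) jN.
Qed.

Lemma emitted_adj : emitted S [::] out_adj =
  [seq node_adj (occurs (dis m R) (exempt m)) (vertex H u) (vertex H v) |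
    u <- iota 0 (N * Q), v <- iota 0 (N * Q)].
Proof.
rewrite /out_adj (@emitted_blocks _ _ _ _ _ (fun u => [seq node_adj
  (occurs (dis m R) (exempt m)) (vertex H u) (vertex H v) | v <- iota 0 (N * Q)])) ?den_big //.
move=> j o oQ jN.
rewrite -flatten_map1 -(den_big [:: j]).
apply: (@emitted_blocks _ _ _ _ _ (fun v => [:: node_adj (occurs (dis m R) (exempt m)) (vertex H (j * Q + o)) (vertex H v)])).
move=> j' o' oQ'; rewrite den_big => j'N.
rewrite -[LHS]/[:: truth S [:: j'; j] (ttable adj_terms (adj_table m R o o'))] truth_ttable.
rewrite (@adj_tableP m R (nletters_gt0 M)) //; congr [:: adj_table _ _ _ _ _].
rewrite /adj_terms /= !truth_teq /= !addn1; by [].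
Qed.

Lemma den_red_threshold : den S [::] red_threshold = (N.*2 * m * H * 6).+1.
Proof. by rewrite /= den_big; move: (H) => h; nia. Qed.

Lemma red_sizeE : red_size M N = N * Q.
Proof. by rewrite /red_size /nverts /period -muln2; nia. Qed.

Lemma map_enum_ord (A : Type) n (f : nat -> A) (g : 'I_n -> A) :
  (forall i : 'I_n, g i = f i) -> [seq g i | i <- enum 'I_n] = [seq f i | i <- iota 0 n].
Proof. by move=> e; rewrite -val_enum_ord -map_comp; apply: eq_map. Qed.

Lemma red_printed :
  emitted S [::] red_out ++ iter (den S [::] red_threshold) increment [::] = encode (red M N_gt1 x).
Proof.
rewrite -bits_of_natE den_red_threshold.
have -> : emitted S [::] red_out = emitted S [::] (blocks big Q (fun=> OEmit (TConst 1))) ++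
    [:: false] ++ emitted S [::] out_adj ++ emitted S [::] (out_set input_cell) ++
    emitted S [::] (out_set final_cell) ++ [:: false] by [].
have e1 : emitted S [::] (blocks big Q (fun=> OEmit (TConst 1))) = nseq (N * Q) true.
  rewrite (@emitted_blocks _ _ _ _ _ (fun=> [:: true])) // den_big.
  by elim: (N * Q) 0 => //= n IH i; rewrite IH.
rewrite e1 emitted_adj (emitted_set input_cellE) (emitted_set final_cellE) -red_sizeE -!catA /encode.
congr (_ ++ _ :: _ ++ _ ++ _ ++ _).
- rewrite /allpairs_dep; congr flatten; apply/esym.
  by apply: map_enum_ord => u; apply: map_enum_ord => v.
- by apply/esym; apply: map_enum_ord => u; rewrite /= /red_source chosen_vertex.
- by apply/esym; apply: map_enum_ord => u; rewrite /= /red_target chosen_vertex.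
Qed.


End Emission.

(** * Decoding of instances *)

Definition bits_value (l : seq bool) : nat := foldr (fun (b : bool) acc => b + acc.*2) 0 l.

Lemma bits_value_pos p : bits_value (bits_of_pos p) = nat_of_pos p.
Proof. by elim: p => [p IH|p IH|] //=; rewrite IH NatTrec.doubleE. Qed.

Lemma bits_valueK k : bits_value (bits_of_nat k) = k.
Proof.
rewrite /bits_of_nat -[RHS](bin_of_natK k); case: (bin_of_nat k) => // p.
exact: bits_value_pos.
Qed.

Lemma last_bits_of_nat k : last true (bits_of_nat k).
Proof.
rewrite /bits_of_nat; case: (bin_of_nat k) => // p.
suff h b : last b (bits_of_pos p) by apply: h.
by elim: p b => //= p IH b; apply: IH.
Qed.

Lemma canonical_bits l : last true l -> l = [::] \/ exists p, l = bits_of_pos p.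
Proof.
elim: l => [|b l IH] /=; first by left.
move=> h; right; case: l IH h => [|b' l] IH /= h.
  by rewrite h; exists BinNums.xH.
have [//|[p ep]] := IH h.
by case: b; rewrite ep; [exists (BinNums.xI p) | exists (BinNums.xO p)].
Qed.

Lemma bits_of_nat_value l : last true l -> bits_of_nat (bits_value l) = l.
Proof.
move=> /canonical_bits[->|[p ->]] //; rewrite bits_value_pos /bits_of_nat.
by rewrite (nat_of_binK (BinNums.Npos p)).
Qed.

Section Decoding.
Variables (x : seq bool) (n : nat).

Definition adj_offset : nat := n.+1.
Definition source_offset : nat := n.+1 + n * n.
Definition target_offset : nat := n.+1 + n * n + n.
Definition sign_offset : nat := n.+1 + n * n + n + n.
Definition threshold_offset : nat := sign_offset.+1.

Definition bit_adj : rel 'I_n := fun u v => nth false x (adj_offset + (u * n + v)).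
Definition bit_source : {set 'I_n} := [set v : 'I_n | nth false x (source_offset + v)].
Definition bit_target : {set 'I_n} := [set v : 'I_n | nth false x (target_offset + v)].
Definition bit_threshold : nat := bits_value (drop threshold_offset x).

(** A negative threshold is excluded because it makes the answer no, and domination of the two end
    sets comes with [tar_reachable]. The last digit of a positive threshold must be a one, as the
    encoding has no leading zeros. *)
Definition well_formed : Prop :=
  [/\ threshold_offset <= size x, symmetric bit_adj, irreflexive bit_adj,
      ~~ nth false x sign_offset & last true (drop threshold_offset x)].

Definition layout_of (A S T : seq bool) (sg : bool) (l : seq bool) : seq bool :=
  nseq n true ++ false :: A ++ S ++ T ++ sg :: l.

Lemma layout_of_nth A S T sg l : size A = n * n -> size S = n -> size T = n ->
  x = layout_of A S T sg l ->
  [/\ forall i, i < n * n -> nth false x (adj_offset + i) = nth false A i,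
      forall i, i < n -> nth false x (source_offset + i) = nth false S i,
      forall i, i < n -> nth false x (target_offset + i) = nth false T i,
      nth false x sign_offset = sg & drop threshold_offset x = l].
Proof.
move=> sA sS sT ex.
have skip P i l' : nth false (P ++ l') (size P + i) = nth false l' i.
  by rewrite nth_cat ltnNge leq_addr addKn.
pose P := rcons (nseq n true) false.
have sP : size P = n.+1 by rewrite size_rcons size_nseq.
have e0 : x = P ++ A ++ S ++ T ++ sg :: l by rewrite ex /layout_of -cat_rcons.
have e1 : x = (P ++ A) ++ S ++ T ++ sg :: l by rewrite e0 !catA.
have e2 : x = (P ++ A ++ S) ++ T ++ sg :: l by rewrite e0 !catA.
have e3 : x = (P ++ A ++ S ++ T) ++ sg :: l by rewrite e0 !catA.
have e4 : x = (P ++ A ++ S ++ T ++ [:: sg]) ++ l by rewrite e0 -!catA.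
split.
- move=> i lt; rewrite /adj_offset -sP {1}e0 skip nth_cat sA lt //.
- move=> i lt; have -> : source_offset = size (P ++ A) by rewrite size_cat sP sA.
  by rewrite e1 skip nth_cat sS lt.
- move=> i lt; have -> : target_offset = size (P ++ A ++ S).
    by rewrite !size_cat sP sA sS addnA.
  by rewrite e2 skip nth_cat sT lt.
- have -> : sign_offset = size (P ++ A ++ S ++ T) + 0.
    by rewrite !size_cat sP sA sS sT addn0 !addnA.
  by rewrite e3 skip.
- have -> : threshold_offset = size (P ++ A ++ S ++ T ++ [:: sg]).
    by rewrite !size_cat sP sA sS sT /= addn1 !addnS !addnA.
  by rewrite e4 drop_size_cat.
Qed.

Lemma layout_of_bits : all id (take n x) -> ~~ nth false x n -> threshold_offset <= size x ->
  x = layout_of [seq nth false x (adj_offset + i) | i <- iota 0 (n * n)]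
    [seq nth false x (source_offset + i) | i <- iota 0 n]
    [seq nth false x (target_offset + i) | i <- iota 0 n]
    (nth false x sign_offset) (drop threshold_offset x).
Proof.
move=> ones zero; rewrite /threshold_offset /sign_offset => le.
have piece a b : [seq nth false x (a + i) | i <- iota 0 b] = [seq nth false x i | i <- iota a b].
  by rewrite -[in RHS](addn0 a) iotaDl -map_comp.
have nx : n < size x by lia.
rewrite -{1}(cat_take_drop n x) (drop_nth false) //.
rewrite /layout_of; congr (_ ++ _ :: _).
- have sn : size (take n x) = n by rewrite size_takel // ltnW.
  apply: (@eq_from_nth _ false); rewrite sn ?size_nseq // => i lt.
  by rewrite nth_nseq lt; apply: (allP ones); rewrite mem_nth // sn.
- exact: negbTE.
rewrite !piece.
have cut a b : a + b <= size x -> drop a x = [seq nth false x i | i <- iota a b] ++ drop (a + b) x.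
  move=> h; rewrite -{1}(cat_take_drop b (drop a x)) drop_drop addnC; congr (_ ++ _).
  have sb : size (take b (drop a x)) = b by rewrite size_takel // size_drop; lia.
  apply: (@eq_from_nth _ false); rewrite sb ?size_map ?size_iota // => i lt.
  by rewrite nth_take // nth_drop (nth_map 0) ?size_iota // nth_iota.
rewrite /adj_offset (cut n.+1 (n * n)); last by lia.
congr (_ ++ _); rewrite (cut _ n) /source_offset; last by lia.
congr (_ ++ _); rewrite (cut _ n) /target_offset; last by lia.
by congr (_ ++ _); rewrite (drop_nth false); last by lia.
Qed.

End Decoding.

Definition leading_ones (x : seq bool) : nat := index false x.

Lemma index_ones n l : index false (nseq n true ++ false :: l) = n.
Proof. by elim: n => //= n ->. Qed.

Lemma ones_below x n : all id (take n x) && ~~ nth false x n && (n < size x) = (index false x == n) && (n < size x).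
Proof.
elim: x n => [|[] x IH] [|n] //=.
Qed.

Definition pairs_bits n (e : rel 'I_n) : seq bool := [seq e u v | u <- enum 'I_n, v <- enum 'I_n].

Lemma size_pairs_bits n (e : rel 'I_n) : size (pairs_bits e) = n * n.
Proof. by rewrite size_allpairs size_enum_ord. Qed.

Lemma pairs_bits_iota n (e : rel 'I_n) f : (forall u v : 'I_n, e u v = f (u * n + v)) ->
  pairs_bits e = [seq f i | i <- iota 0 (n * n)].
Proof.
move=> ef; rewrite -flatten_map1 -iota_blocks /pairs_bits /allpairs_dep; congr flatten.
apply: (@map_enum_ord _ _ (fun j => flatten [seq [:: f (j * n + o)] | o <- iota 0 n])) => u.
by rewrite flatten_map1; apply: map_enum_ord => v.
Qed.

Lemma nth_pairs_bits n (e : rel 'I_n) (u v : 'I_n) : nth false (pairs_bits e) (u * n + v) = e u v.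
Proof.
pose F i j := if insub i is Some u then (if insub j is Some v then e u v else false) else false.
have eF (i j : 'I_n) : e i j = F i j by rewrite /F !valK.
have n0 : 0 < n by case: (n) u => [[]|].
rewrite (@pairs_bits_iota _ _ (fun i => F (i %/ n) (i %% n))) => [|i j]; last first.
  by rewrite divnMDl // modnMDl divn_small // modn_small // addn0.
have lt : u * n + v < n * n by have := ltn_ord u; have := ltn_ord v; nia.
rewrite (nth_map 0) ?nth_iota ?size_iota //.
by rewrite add0n divnMDl // modnMDl divn_small // modn_small // addn0 -eF.
Qed.

Definition set_bits n (D : {set 'I_n}) : seq bool := [seq v \in D | v <- enum 'I_n].

Lemma size_set_bits n (D : {set 'I_n}) : size (set_bits D) = n.
Proof. by rewrite size_map size_enum_ord. Qed.

Lemma nth_set_bits n (D : {set 'I_n}) (v : 'I_n) : nth false (set_bits D) v = (v \in D).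
Proof. by rewrite (nth_map v) ?size_enum_ord // nth_ord_enum. Qed.

Definition bits_yes x n : Prop := well_formed x n /\
  tar_reachable (@bit_adj x n) (bit_threshold x n)%:Z%R (bit_source x n) (bit_target x n).

Lemma encode_layout I : encode I = layout_of (nvertices I) (pairs_bits (@adj I))
  (set_bits (source I)) (set_bits (target I)) (threshold I < 0)%R (bits_of_nat `|threshold I|%N).
Proof. by []. Qed.

Lemma encode_bits I (x := encode I) (n := nvertices I) :
  [/\ index false x = n, @bit_adj x n = @adj I, bit_source x n = source I,
      bit_target x n = target I &
      nth false x (sign_offset n) = (threshold I < 0)%R /\
      drop (threshold_offset n) x = bits_of_nat `|threshold I|%N].
Proof.
have [hA hS hT hs hl] := layout_of_nth (size_pairs_bits (@adj I)) (size_set_bits (source I))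
  (size_set_bits (target I)) (encode_layout I).
split=> //.
- exact: index_ones.
- apply/funext => u; apply/funext => v; rewrite /bit_adj hA ?nth_pairs_bits //.
  by have := ltn_ord u; have := ltn_ord v; rewrite /n; nia.
- by apply/setP => v; rewrite inE hS // nth_set_bits.
- by apply/setP => v; rewrite inE hT // nth_set_bits.
Qed.

Lemma yes_encode I : dsr_tar_yes I <-> bits_yes (encode I) (index false (encode I)).
Proof.
have [-> eA eS eT [es el]] := encode_bits I.
rewrite /bits_yes /well_formed eA eS eT es el /bit_threshold el bits_valueK /dsr_tar_yes.
split=> [yes|[[_ _ _ nneg _]]]; last first.
  by have -> : (`|threshold I|%N%:Z)%R = threshold I by lia.
have nneg : ~~ (threshold I < 0)%R.
  apply/negP => neg; case: yes => s [_ _ /(_ (source I) (mem_head _ _))[_ le]].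
  by move: neg le; lia.
have -> : (`|threshold I|%N%:Z)%R = threshold I by lia.
split=> //; split=> //.
- rewrite encode_layout /layout_of /threshold_offset /sign_offset size_cat size_nseq /= !size_cat.
  by rewrite size_pairs_bits !size_set_bits /=; lia.
- exact: adj_sym.
- exact: adj_irr.
- exact: last_bits_of_nat.
Qed.

(** All fields are found at offsets computed from the number of leading ones, so membership becomes
    a property of the string itself. *)
Lemma DSR_TAR_bits x : DSR_TAR x <-> bits_yes x (index false x).
Proof.
split=> [[I [-> /yes_encode]] //|yes].
have [[le sym irr nneg can] reach] := yes.
set n := index false x in yes le sym irr nneg can reach.
have lt : n < size x by apply: leq_trans le; rewrite /threshold_offset /sign_offset; lia.
have /andP[/andP[ones zero] _] : all id (take n x) && ~~ nth false x n && (n < size x).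
  by rewrite ones_below eqxx lt.
have [s [_ la good]] := reach.
have sdom := (good _ (mem_head _ _)).1.
have tdom : dominating (@bit_adj x n) (bit_target x n) by rewrite -la; apply: (good _ (mem_last _ _)).1.
pose I := DSRInstance sym irr sdom tdom (bit_threshold x n)%:Z%R.
have ex : x = encode I.
  rewrite encode_layout [LHS](layout_of_bits ones zero le) /=; congr layout_of.
  - by apply/esym/pairs_bits_iota.
  - by apply/esym/map_enum_ord => v; rewrite inE.
  - by apply/esym/map_enum_ord => v; rewrite inE.
  - by rewrite (negPf nneg); lia.
  - by rewrite bits_of_nat_value.
exists I; split=> //; apply/yes_encode; rewrite -ex; exact: yes.
Qed.

Lemma DSR_TAR_encode I : DSR_TAR (encode I) <-> dsr_tar_yes I.
Proof. by rewrite DSR_TAR_bits yes_encode. Qed.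

(** * Savitch's recursion on reconfiguration sequences *)

Section Savitch.
Variables (T : finType) (adj : rel T) (k : int).
Implicit Types A B C D : {set T}.

Definition admissible D : bool := dominating adj D && (#|D|%:Z <= k)%R.

Definition distance A B : nat := #|[set v | (v \in A) != (v \in B)]|.

Definition adjacent_sets A B : bool := [&& admissible A, admissible B & distance A B <= 1].

Fixpoint savitch (j : nat) A B : bool :=
  if j is j'.+1 then [exists C, savitch j' A C && savitch j' C B] else adjacent_sets A B.

Lemma savitchS j A B : savitch j.+1 A B = [exists C, savitch j A C && savitch j C B].
Proof. by []. Qed.

Lemma distance_le1 A B : distance A B <= 1 <-> A = B \/ tar_step A B.
Proof.
split=> [|[->|]].
- rewrite leq_eqVlt ltnS leqn0 => /orP[/cards1P[v /setP e]|/eqP/cards0_eq/setP e]; last first.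
    by left; apply/setP => v; have := e v; rewrite !inE => /negbFE/eqP.
  have other w : w != v -> (w \in A) = (w \in B).
    by move=> wv; have := e w; rewrite !inE (negPf wv) => /negbFE/eqP.
  have := e v; rewrite !inE eqxx => dv; right; apply/orP.
  have [vA|vA] := boolP (v \in A); [right | left]; apply/existsP; exists v; rewrite vA /=;
    apply/eqP/setP => w; rewrite !inE; have [->|wv] := eqVneq w v; rewrite ?(other w) //=.
  - by move: dv; rewrite vA; case: (v \in B).
  - by move: dv; rewrite (negPf vA); case: (v \in B).
- by rewrite /distance (_ : [set _ | _] = set0) ?cards0 //; apply/setP => v; rewrite !inE eqxx.
case/orP => /existsP[v /andP[vA /eqP->]]; rewrite /distance -(cards1 v); apply: subset_leq_card;
  by apply/subsetP => w; rewrite !inE; have [|wv] := eqVneq w v; rewrite //= eqxx.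
Qed.

Lemma savitch_reachable j A B : savitch j A B -> tar_reachable adj k A B.
Proof.
elim: j A B => [|j IH] A B /=; last first.
  by case/existsP => C /andP[/IH r1 /IH r2]; exact: tar_reachable_trans r1 r2.
case/and3P => /andP[dA cA] /andP[dB cB] /distance_le1[<-|st].
  by exists [::]; split=> // D; rewrite inE => /eqP->.
by exists [:: B]; split; rewrite /= ?st // => D; rewrite !inE => /orP[]/eqP->.
Qed.

Lemma savitch_path j A s : path adjacent_sets A s -> admissible A -> size s <= 2 ^ j ->
  savitch j A (last A s).
Proof.
have refl D : admissible D -> adjacent_sets D D.
  by move=> aD; rewrite /adjacent_sets aD; apply/distance_le1; left.
elim: j A s => [|j IH] A s p aA le.
  case: s p le => [_ _|B [|//]] /=; first exact: refl.
  by case/andP.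
rewrite -(cat_take_drop (2 ^ j) s) cat_path in p *; have /andP[p1 p2] := p.
rewrite last_cat savitchS; apply/existsP; exists (last A (take (2 ^ j) s)).
rewrite (IH _ _ p1 aA) ?size_take_min ?geq_minl //= (IH _ _ p2) //.
  elim: (take _ _) A aA p1 {p p2} => //= C s' IHs A _ /andP[/and3P[_ aB _]]; exact: IHs.
by rewrite size_drop; move: le; rewrite expnS; lia.
Qed.

(** A path without repetition visits at most [2 ^ #|T|] sets. Short paths are no obstacle, since
    [adjacent_sets] also relates an admissible set to itself. *)
Lemma savitchP j A B : #|T| <= j -> tar_reachable adj k A B <-> savitch j A B.
Proof.
move=> Tj; split=> [[s [p la good]]|]; last exact: savitch_reachable.
have adm D : D \in A :: s -> admissible D by move=> /good[dD cD]; rewrite /admissible dD.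
have p' : path adjacent_sets A s.
  elim: s A p adm {la good} => //= C s IH A /andP[st p] adm.
  rewrite IH // => [|D Ds]; last by apply: adm; rewrite inE Ds orbT.
  rewrite /adjacent_sets !adm ?inE ?eqxx ?orbT // andbT.
  by apply/distance_le1; right.
rewrite -la; case/shortenP: p' => s' p' u _.
apply: savitch_path => //; first by apply: adm; rewrite mem_head.
apply: leq_trans (_ : #|{set T}| <= _).
  by have := max_card (mem (A :: s')); rewrite (card_uniqP u) /=; apply: leq_trans.
by rewrite -cardsT -powersetT card_powerset cardsT leq_exp2l.
Qed.

End Savitch.

(** * The recursion as a quantified formula *)

Section Blocks.
Variables (y n : nat).
Hypothesis ny : n <= y.

(** Of each [y.+1] successive bits the first [y], which describe a midpoint, are existential, and
    the last, which chooses a half, is universal. *)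
Definition closes_block (W : seq bool) : bool := size W %% y.+1 == y.

(* A block consists of the bits of a midpoint, preceded by the bit that tells
   which half of the path is inspected. *)
Definition endpoint (ph : bool) (init : nat -> bool) (b : nat) (W : seq bool) (u : nat) : bool :=
  foldr (fun i acc => if nth false W (i * y.+1) == ph then nth false W ((i * y.+1).+1 + u) else acc)
    (init u) (iota 0 b).

Lemma endpoint_cons ph init b p mid W u : size mid = y -> u < y ->
  endpoint ph init b.+1 (p :: mid ++ W) u = if p == ph then nth false mid u else endpoint ph init b W u.
Proof.
move=> sm uy.
have e j : nth false (p :: mid ++ W) (y.+1 + j) = nth false W j.
  by rewrite addSn /= nth_cat sm ltnNge leq_addr addKn.
have e0 : nth false (p :: mid ++ W) 0 = p by [].
have e1 : nth false (p :: mid ++ W) u.+1 = nth false mid u by rewrite /= nth_cat sm uy.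
rewrite /endpoint; move: (p :: mid ++ W) e e0 e1 => X e e0 e1 /=.
rewrite mul0n e0 add1n e1; case: eqP => // _.
rewrite -[1]addn0 iotaDl; elim: (iota 0 b) => //= i l ->.
have -> : (1 + i) * y.+1 = y.+1 + i * y.+1 by rewrite add1n mulSn.
have -> : (y.+1 + i * y.+1).+1 + u = y.+1 + ((i * y.+1).+1 + u) by lia.
by rewrite !e.
Qed.

Definition endset (ph : bool) (init : nat -> bool) b W : {set 'I_n} := [set u : 'I_n | endpoint ph init b W u].

Lemma endset_cons ph init b p mid W : size mid = y ->
  endset ph init b.+1 (p :: mid ++ W) =
  if p == ph then [set u : 'I_n | nth false mid u] else endset ph init b W.
Proof.
move=> sm; apply/setP => u; have uy : u < y by apply: leq_trans ny.
by rewrite inE endpoint_cons //; case: eqP; rewrite inE.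
Qed.

Lemma qbf_value_false f univ r W : (forall W', f W' = false) -> qbf_value f univ r W = false.
Proof. by move=> f0; elim: r W => [|r IH] W //=; rewrite !IH if_same. Qed.

Lemma qbf_value_exists f r k W : size W %% y.+1 + k <= y ->
  qbf_value f closes_block (k + r) W <->
  exists2 mid, size mid = k & qbf_value f closes_block r (mid ++ W).
Proof.
elim: k W => [|k IH] W le.
  by split=> [|[[]]//]; exists [::].
have lt : size W %% y.+1 < y by lia.
have sz b : size (b :: W) %% y.+1 + k <= y.
  rewrite /= -addn1 -modnDml modn_small; lia.
rewrite addSn /= /closes_block (ltn_eqF lt) -/closes_block.
set v0 := qbf_value _ _ _ (false :: W); set v1 := qbf_value _ _ _ (true :: W).
have -> : (if v0 == false then v1 else v0) = v0 || v1 by case: v0; case: v1.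
have cat b mid : rcons mid b ++ W = mid ++ b :: W by rewrite cat_rcons.
split=> [/orP[/(IH _ (sz _))[mid sm h]|/(IH _ (sz _))[mid sm h]]|[mid sm h]].
- by exists (rcons mid false); rewrite ?size_rcons ?sm // cat.
- by exists (rcons mid true); rewrite ?size_rcons ?sm // cat.
case/lastP: mid sm h => // mid b; rewrite size_rcons cat => -[sm] h.
by apply/orP; case: b h => h; [right | left]; apply/(IH _ (sz _)); exists mid.
Qed.

Variables (adj : rel 'I_n) (k : int) (f : seq bool -> bool) (src tgt : nat -> bool).
Local Notation A_ := (endset true src).
Local Notation B_ := (endset false tgt).

(* In the left half the first endpoint is kept, in the right half the second. *)
Hypothesis leaf : forall W, size W = y * y.+1 -> f W = adjacent_sets adj k (A_ y W) (B_ y W).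

Lemma qbf_savitch j b W : b + j = y -> size W = b * y.+1 ->
  qbf_value f closes_block (j * y.+1) W <-> savitch adj k j (A_ b W) (B_ b W).
Proof.
elim: j b W => [|j IH] b W bj sW.
  by rewrite addn0 in bj; rewrite bj in sW *; rewrite mul0n /= leaf.
have s0 : size W %% y.+1 + y <= y by rewrite sW modnMl.
rewrite mulSn addSn -addnS (qbf_value_exists _ _ s0) savitchS.
have half mid : size mid = y -> qbf_value f closes_block (j * y.+1).+1 (mid ++ W) <->
    savitch adj k j (A_ b W) [set u : 'I_n | nth false mid u] &&
    savitch adj k j [set u : 'I_n | nth false mid u] (B_ b W).
  move=> sm /=.
  have -> : closes_block (mid ++ W) by rewrite /closes_block size_cat sm sW addnC modnMDl modn_small.
  have bS : b.+1 + j = y by lia.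
  have sz p : size (p :: mid ++ W) = b.+1 * y.+1 by rewrite /= size_cat sm sW mulSn addSn.
  have := IH _ _ bS (sz false); have := IH _ _ bS (sz true).
  rewrite !endset_cons //=; move: (qbf_value _ _ _ (true :: _)) (qbf_value _ _ _ (false :: _)).
  by move=> [] [] [h1 h1'] [h2 h2']; split => /=; try (move=> /andP[? ?]); auto; rewrite ?h1 ?h2.
split=> [[mid sm /(half _ sm) h]|/existsP[C h]].
  by apply/existsP; exists [set u : 'I_n | nth false mid u].
(* The characteristic string of [C], padded with [false] from length [n] to length [y]. *)
pose mid := [seq (if insub i is Some u then u \in C else false) | i <- iota 0 y].
have sm : size mid = y by rewrite size_map size_iota.
exists mid => //; apply/(half _ sm).
suff -> : [set u : 'I_n | nth false mid u] = C by [].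
apply/setP => u; have uy : u < y by apply: leq_trans ny.
by rewrite inE /mid (nth_map 0) ?size_iota // nth_iota // add0n valK.
Qed.

End Blocks.

(** * The matrix of the formula as a term *)

Definition tnot (t : term) : term := TSub (TConst 1) t.
Definition tle (t u : term) : term := TSub (TAdd u (TConst 1)) t.
Definition tcount (cap n b : term) : term := TFold cap n (TAdd (TVar 1) b).
Definition texists (n b : term) : term := tcount (TConst 1) n b.
Definition tforall (n b : term) : term := tnot (texists n (tnot b)).

Section Connectives.
Variables (S : stacks) (env : seq nat).
Local Notation tr := (truth S env).

Lemma truth_not t : tr (tnot t) = ~~ tr t.
Proof. by rewrite /truth /=; lia. Qed.

Lemma truth_and t u : tr (TMul t u) = tr t && tr u.
Proof. by rewrite /truth /= muln_gt0. Qed.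

Lemma truth_or t u : tr (TAdd t u) = tr t || tr u.
Proof. by rewrite /truth /= addn_gt0. Qed.

Lemma truth_le t u : tr (tle t u) = (den S env t <= den S env u).
Proof. by rewrite /truth /=; lia. Qed.

Lemma truth_bit r t : tr (TBit r t) = nth false (S r) (den S env t).
Proof. by rewrite /truth /=; case: nth. Qed.

End Connectives.

Section Quantifiers.
Variables (S : stacks) (env : seq nat).
Local Notation tr := (truth S env).

Lemma truth_exists n b P : (forall i acc, truth S [:: i, acc & env] b = P i) ->
  tr (texists n b) = has P (iota 0 (den S env n)).
Proof.
move=> bP; rewrite /truth /=; elim: (iota _ _) => //= i l IH.
by rewrite leq_min /= addn_gt0 orbC -/(truth _ _ b) bP IH.
Qed.

Lemma truth_forall n b P : (forall i acc, truth S [:: i, acc & env] b = P i) ->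
  tr (tforall n b) = all P (iota 0 (den S env n)).
Proof.
move=> bP; rewrite truth_not (@truth_exists _ _ (predC P)) ?has_predC ?negbK // => i acc.
by rewrite truth_not bP.
Qed.

Lemma den_count cap n b (P : pred nat) : (forall i acc, den S [:: i, acc & env] b = P i) ->
  den S env n <= den S env cap ->
  den S env (tcount cap n b) = count P (iota 0 (den S env n)).
Proof.
move=> bP; rewrite /= -{1}(size_iota 0 (den S env n)).
elim: (iota _ _) => //= i l IH le; rewrite bP IH; last exact: ltnW.
by rewrite addnC; apply/minn_idPr; apply: leq_trans le; rewrite -add1n leq_add ?leq_b1 ?count_size.
Qed.

End Quantifiers.

Lemma forall_iota n (P : pred nat) : [forall v : 'I_n, P v] = all P (iota 0 n).
Proof.
apply/forallP/allP => h v; last by apply: h; rewrite mem_iota /=.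
by rewrite mem_iota => /= lt; exact: (h (Ordinal lt)).
Qed.

Lemma exists_iota n (P : pred nat) : [exists v : 'I_n, P v] = has P (iota 0 n).
Proof.
apply/existsP/hasP => [[v h]|[v]]; first by exists (v : nat); rewrite // mem_iota /=.
by rewrite mem_iota => /= lt h; exists (Ordinal lt).
Qed.

Lemma card_iota n (P : pred nat) : #|[set v : 'I_n | P v]| = count P (iota 0 n).
Proof.
rewrite cardsE cardE -(size_map (val : 'I_n -> nat)) -size_filter; congr size.
rewrite /enum_mem -enumT /= -(val_enum_ord n) filter_map; congr (map _ _).
Qed.

(** The input length bounds the number of vertices, so it serves both as the length of a midpoint
    and as the depth of the recursion. *)
Definition t_y : term := TLen 0.
(** Folding starts at the largest index and each [false] resets the accumulator to 0, so the number
    of leading ones remains. *)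
Definition t_n : term :=
  TFold (TLen 0) (TLen 0) (TMul (TBit 0 (TVar 0)) (TAdd (TVar 1) (TConst 1))).
Definition t_adj_offset : term := TAdd t_n (TConst 1).
Definition t_source_offset : term := TAdd t_adj_offset (TMul t_n t_n).
Definition t_target_offset : term := TAdd t_source_offset t_n.
Definition t_sign_offset : term := TAdd t_target_offset t_n.
Definition t_threshold_offset : term := TAdd t_sign_offset (TConst 1).
Definition t_adj (a b : term) : term := TBit 0 (TAdd t_adj_offset (TAdd (TMul a t_n) b)).

Definition t_well_formed : term :=
  TMul (tle t_threshold_offset t_y)
  (TMul (tforall t_n (tforall t_n (teq (t_adj (TVar 2) (TVar 0)) (t_adj (TVar 0) (TVar 2)))))
  (TMul (tforall t_n (tnot (t_adj (TVar 0) (TVar 0))))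
  (TMul (tnot (TBit 0 t_sign_offset))
        (TAdd (teq t_threshold_offset t_y) (TBit 0 (TSub t_y (TConst 1))))))).

Definition t_phase : term := TBit 1 (TMul (TVar 0) (TAdd t_y (TConst 1))).

(** The accumulator starts at 0, so index [y], folded first, loads the endpoint given by the input;
    the other indices then run from the oldest block to the most recent, which prevails. The vertex
    is [TVar i.+2] because the fold binds two variables. *)
Definition t_endpoint (ph : bool) (offset : term) (i : nat) : term :=
  let b := if ph then t_phase else tnot t_phase in
  TFold (TConst 1) (TAdd t_y (TConst 1))
    (TAdd (TMul (teq (TVar 0) t_y) (TBit 0 (TAdd offset (TVar i.+2))))
      (TMul (TSub t_y (TVar 0))
        (TAdd (TMul b (TBit 1 (TAdd (TAdd (TMul (TVar 0) (TAdd t_y (TConst 1))) (TConst 1)) (TVar i.+2))))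
              (TMul (tnot b) (TVar 1))))).

(** Horner's rule from the high bits, cut at [n] in every round: the threshold may be exponential,
    but it is compared only with cardinalities, which are at most [n]. *)
Definition t_threshold : term :=
  TFold t_n (TSub t_y t_threshold_offset)
    (TAdd (TBit 0 (TAdd t_threshold_offset (TVar 0))) (TAdd (TVar 1) (TVar 1))).

Definition t_admissible ph offset : term :=
  let D := t_endpoint ph offset in
  TMul (tforall t_n (TAdd (D 0) (texists t_n (TMul (D 0) (t_adj (TVar 0) (TVar 2))))))
       (tle (tcount t_n t_n (D 0)) t_threshold).

Definition t_distance : term :=
  let A := t_endpoint true t_source_offset 0 in let B := t_endpoint false t_target_offset 0 in
  tcount t_n t_n (TAdd (TSub A B) (TSub B A)).

Definition t_matrix : term :=
  TMul t_well_formed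
  (TMul (t_admissible true t_source_offset)
  (TMul (t_admissible false t_target_offset) (tle t_distance (TConst 1)))).

Definition t_universal : term :=
  texists (TAdd (TLen 1) (TConst 1))
    (teq (TLen 1) (TAdd (TMul (TVar 0) (TAdd t_y (TConst 1))) t_y)).

Definition t_rounds : term := TMul t_y (TAdd t_y (TConst 1)).

Lemma denE S env : (forall t u, den S env (TAdd t u) = den S env t + den S env u) *
  (forall t u, den S env (TSub t u) = den S env t - den S env u) *
  (forall t u, den S env (TMul t u) = den S env t * den S env u) *
  (forall i, den S env (TVar i) = nth 0 env i) * (forall c, den S env (TConst c) = c) *
  (forall r, den S env (TLen r) = size (S r)) *
  (forall r t, den S env (TBit r t) = nth false (S r) (den S env t)).
Proof. by []. Qed.

Lemma den_fold S env cap n b : den S env (TFold cap n b) =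
  foldr (fun i acc => minn (den S env cap) (den S [:: i, acc & env] b)) 0 (iota 0 (den S env n)).
Proof. by []. Qed.

Section Semantics.
Variables (x W : seq bool).
Local Notation S := (registers x W).
Local Notation y := (size x).
Let n := index false x.

Lemma den_y env : den S env t_y = y. Proof. by []. Qed.

Lemma den_n env : den S env t_n = n.
Proof.
have gen c l z : size l <= c -> (forall i, i < size l -> nth false x (z + i) = nth false l i) ->
    foldr (fun i acc => minn c (nth false x i * (acc + 1))) 0 (iota z (size l)) = index false l.
  elim: l z => //= b l IH z le e; rewrite IH; first last.
  - by move=> i lt; rewrite addSnnS e.
  - exact: ltnW.
  rewrite -[z]addn0 e //= eqbF_neg; case: b {e} => /=; rewrite ?mul0n ?minn0 // mul1n addn1.
  by apply/minn_idPr; apply: leq_trans le; rewrite ltnS index_size.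
exact: gen.
Qed.

Lemma den_adj_offset env : den S env t_adj_offset = adj_offset n.
Proof. by rewrite denE den_n addn1. Qed.

Lemma den_source_offset env : den S env t_source_offset = source_offset n.
Proof. by rewrite denE den_adj_offset denE den_n. Qed.

Lemma den_target_offset env : den S env t_target_offset = target_offset n.
Proof. by rewrite denE den_source_offset den_n. Qed.

Lemma den_sign_offset env : den S env t_sign_offset = sign_offset n.
Proof. by rewrite denE den_target_offset den_n. Qed.

Lemma den_threshold_offset env : den S env t_threshold_offset = threshold_offset n.
Proof. by rewrite denE den_sign_offset addn1. Qed.

Lemma den_adj env a b : den S env (t_adj a b) =
  nth false x (adj_offset n + (den S env a * n + den S env b)) :> nat.
Proof. by rewrite denE denE den_adj_offset denE denE den_n. Qed.

Lemma truth_adj env a b : truth S env (t_adj a b) =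
  nth false x (adj_offset n + (den S env a * n + den S env b)).
Proof. by rewrite /truth den_adj; case: nth. Qed.

Definition well_formedb : bool :=
  [&& threshold_offset n <= y, [forall u, forall v, @bit_adj x n u v == @bit_adj x n v u],
      [forall u, ~~ @bit_adj x n u u], ~~ nth false x (sign_offset n) &
      last true (drop (threshold_offset n) x)].

Lemma well_formedP : reflect (well_formed x n) well_formedb.
Proof.
apply: (iffP and5P) => -[h1 h2 h3 h4 h5]; split=> //.
- by move=> u v; apply/eqP; apply: (forallP (forallP h2 u)).
- by move=> u; apply: negbTE; apply: (forallP h3).
- by apply/forallP => u; apply/forallP => v; rewrite h2.
- by apply/forallP => u; rewrite h3.
Qed.

Lemma truth_well_formed : truth S [::] t_well_formed = well_formedb.
Proof.
rewrite !truth_and truth_le den_threshold_offset /well_formedb -[den _ _ t_y]/y.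
case: (leqP (threshold_offset n) y) => //= le; congr [&& _, _, _ & _].
- pose P u v := nth false x (adj_offset n + (u * n + v)).
  rewrite (@truth_forall _ _ _ _ (fun u => all (fun v => P u v == P v u) (iota 0 n))); last first.
    move=> u acc; rewrite (@truth_forall _ _ _ _ (fun v => P u v == P v u)) ?den_n // => v acc'.
    by rewrite truth_teq !den_adj /P /=; do 2 case: nth.
  rewrite den_n -forall_iota; apply: eq_forallb => u.
  by rewrite -(forall_iota n (fun v => P u v == P v u)).
- rewrite (@truth_forall _ _ _ _ (fun u => ~~ nth false x (adj_offset n + (u * n + u)))); last first.
    by move=> u acc; rewrite truth_not truth_adj.
  by rewrite den_n -forall_iota.
- by rewrite truth_not truth_bit den_sign_offset.
rewrite truth_or truth_teq den_threshold_offset truth_bit denE den_y.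
have [e|ne] := eqVneq (threshold_offset n) y; first by rewrite drop_oversize ?e.
have lt : threshold_offset n < y by rewrite ltn_neqAle ne.
have sd : 0 < size (drop (threshold_offset n) x) by rewrite size_drop subn_gt0.
have -> : last true (drop (threshold_offset n) x) = last false (drop (threshold_offset n) x).
  by case: drop sd.
rewrite -nth_last nth_drop size_drop; congr nth.
by rewrite -[den _ _ (TConst 1)]/1; lia.
Qed.

Lemma den_endpoint ph off o i env : (forall e, den S e off = o) ->
  den S env (t_endpoint ph off i) =
  endpoint y ph (fun u => nth false x (o + u)) y W (nth 0 env i) :> nat.
Proof.
move=> offE; pose E := [:: 0].
pose val (j : nat) (acc : bool) : bool :=
  if j == y then nth false x (o + nth 0 env i)
  else if nth false W (j * y.+1) == ph then nth false W ((j * y.+1).+1 + nth 0 env i) else acc.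
pose b := if ph then t_phase else tnot t_phase.
pose body := TAdd (TMul (teq (TVar 0) t_y) (TBit 0 (TAdd off (TVar i.+2))))
      (TMul (TSub t_y (TVar 0))
        (TAdd (TMul b (TBit 1 (TAdd (TAdd (TMul (TVar 0) (TAdd t_y (TConst 1))) (TConst 1)) (TVar i.+2))))
              (TMul (tnot b) (TVar 1)))).
have bodyE j (acc : bool) : j <= y ->
    (0 < den S [:: j, acc : nat & env] body) = val j acc.
  move=> jy; rewrite -/(truth S [:: j, acc : nat & env] body).
  have bE : truth S [:: j, acc : nat & env] b = (nth false W (j * y.+1) == ph).
    by rewrite /b; case: (ph); rewrite ?truth_not /t_phase truth_bit !denE addn1 ?eqb_id // eqbF_neg.
  rewrite truth_or !truth_and truth_teq truth_or !truth_and truth_not bE.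
  have -> : truth S [:: j, acc : nat & env] (TBit 0 (TAdd off (TVar i.+2))) =
    nth false x (o + nth 0 env i) by rewrite truth_bit /= offE.
  have -> : truth S [:: j, acc : nat & env] (TSub t_y (TVar 0)) = (j != y).
    by rewrite /truth denE /= subn_gt0 ltn_neqAle jy andbT.
  have -> : truth S [:: j, acc : nat & env] (TVar 1) = acc by rewrite /truth /=; case: (acc).
  rewrite truth_bit /= addn1 addn1 /val; case: eqP => _ /=; first by rewrite orbF.
  by rewrite -[S 1]/W -[S 0]/x; case: eqP => _ /=; rewrite ?orbF.
have step l (acc : bool) : all (fun j => j <= y) l ->
    foldr (fun j acc => minn 1 (den S [:: j, acc & env] body)) acc l =
    foldr (fun j acc => val j acc) acc l :> nat.
  elim: l => //= j l IH /andP[jy le]; rewrite IH //.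
  have h d : minn 1 d = (0 < d) :> nat by case: d => [|[|d]].
  by rewrite h bodyE.
rewrite -[LHS]/(foldr (fun j acc => minn 1 (den S [:: j, acc & env] body)) false (iota 0 (y + 1))).
rewrite step; last by apply/allP => j; rewrite mem_iota; lia.
rewrite iotaD foldr_cat /= {2}/val eqxx /endpoint; congr nat_of_bool.
have : all (fun j => j < y) (iota 0 y) by apply/allP => j; rewrite mem_iota.
elim: (iota 0 y) => //= j l IH /andP[lt /IH->].
by rewrite /val ltn_eqF.
Qed.

(** Cutting in every round equals cutting once at the end, as doubling and adding a bit never takes
    a value from [n] or above to below [n]. *)
Lemma den_threshold env : den S env t_threshold = minn n (bits_value (drop (threshold_offset n) x)).
Proof.
pose f (i acc : nat) := minn n (nth false x (threshold_offset n + i) + (acc + acc)).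
have gen l z : (forall i, i < size l -> nth false x (threshold_offset n + (z + i)) = nth false l i) ->
    foldr f 0 (iota z (size l)) = minn n (bits_value l).
  elim: l z => [|b l IH] z e /=; first by rewrite minn0.
  rewrite IH => [|i lt]; last by rewrite addSnnS e.
  rewrite /f -{1}[z]addn0 e //= -addnn; move: (bits_value l) => v.
  by case: b {e}; lia.
have -> : den S env t_threshold = foldr f 0 (iota 0 (y - threshold_offset n)).
  rewrite /t_threshold den_fold den_n denE den_threshold_offset.
  have bE i acc : den S [:: i, acc & env] (TAdd (TBit 0 (TAdd t_threshold_offset (TVar 0)))
      (TAdd (TVar 1) (TVar 1))) = nth false x (threshold_offset n + i) + (acc + acc).
    by rewrite denE denE denE den_threshold_offset.
  move: (TAdd (TBit _ _) _) bE => b bE.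
  by elim: (iota _ _) => //= i l ->; rewrite bE.
rewrite -size_drop; apply: gen => i lt; by rewrite nth_drop.
Qed.

Local Notation AS := (admissible (@bit_adj x n) (bit_threshold x n)%:Z%R).

Lemma truth_admissible ph off o : (forall e, den S e off = o) ->
  truth S [::] (t_admissible ph off) = AS (endset y n ph (fun u => nth false x (o + u)) y W).
Proof.
move=> offE; set P := endpoint y ph (fun u => nth false x (o + u)) y W.
have dE env i : den S env (t_endpoint ph off i) = P (nth 0 env i) :> nat by apply: den_endpoint.
have tE env i : truth S env (t_endpoint ph off i) = P (nth 0 env i).
  by rewrite /truth dE; case: (P _).
rewrite truth_and /admissible; congr (_ && _).
  pose Q v u := P u && nth false x (adj_offset n + (u * n + v)).
  rewrite (@truth_forall _ _ _ _ (fun v => P v || has (Q v) (iota 0 n))); last first.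
    move=> v acc; rewrite truth_or tE (@truth_exists _ _ _ _ (Q v)) ?den_n // => u acc'.
    by rewrite truth_and tE truth_adj.
  rewrite den_n -forall_iota; apply: eq_forallb => v.
  rewrite in_set -/P -exists_iota; case: (P v) => //=.
  by apply: eq_existsb => u; rewrite in_set.
rewrite truth_le (@den_count _ _ _ _ _ P) // den_n den_threshold /endset card_iota lez_nat leq_min.
by have := count_size P (iota 0 n); rewrite size_iota => ->.
Qed.

Lemma truth_matrix : truth S [::] t_matrix = well_formedb &&
  adjacent_sets (@bit_adj x n) (bit_threshold x n)%:Z%R
    (endset y n true (fun u => nth false x (source_offset n + u)) y W)
    (endset y n false (fun u => nth false x (target_offset n + u)) y W).
Proof.
rewrite truth_and truth_well_formed truth_and (truth_admissible true den_source_offset).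
rewrite truth_and (truth_admissible false den_target_offset) /adjacent_sets truth_le.
congr [&& _, _, _ & _]; rewrite /t_distance.
pose A := endpoint y true (fun u => nth false x (source_offset n + u)) y W.
pose B := endpoint y false (fun u => nth false x (target_offset n + u)) y W.
have eA e : den S e (t_endpoint true t_source_offset 0) = A (nth 0 e 0).
  exact: (den_endpoint _ _ _ den_source_offset).
have eB e : den S e (t_endpoint false t_target_offset 0) = B (nth 0 e 0).
  exact: (den_endpoint _ _ _ den_target_offset).
rewrite (@den_count _ _ _ _ _ (fun u => A u != B u)) //; last first.
  move=> i acc; rewrite denE [X in X + _]denE [X in _ + X]denE eA eB /=.
  by case: (A i); case: (B i).
rewrite den_n denE -card_iota /distance.
by congr (#|pred_of_set _| <= 1); apply/setP => v; rewrite !inE.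
Qed.

Lemma truth_universal : truth S [::] t_universal = closes_block y W.
Proof.
rewrite (@truth_exists _ _ _ _ (fun q => size W == q * y.+1 + y)) => [|q acc]; last first.
  by rewrite truth_teq !denE /= addn1.
rewrite /closes_block; apply/hasP/eqP => [[q _ /eqP->]|e].
  by rewrite modnMDl modn_small.
exists (size W %/ y.+1); last by rewrite {1}(divn_eq (size W) y.+1) e.
by rewrite mem_iota -[den _ _ _]/(size W + 1) addn1 /= ltnS leq_div.
Qed.

End Semantics.

(** * Membership, hardness and the uniform constant *)

Theorem DSR_TAR_pspace : pspace DSR_TAR.
Proof.
have phi_ok : term_ok 2 0 t_matrix by [].
apply: (@pspace_qbf t_matrix t_universal t_rounds) => // x.
rewrite DSR_TAR_bits; set n := index false x.
have -> : holdsb t_universal x = closes_block (size x).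
  by apply/funext => W; apply: truth_universal.
(* On an ill-formed string the matrix is constantly false, and so is the formula. *)
have [wf|nwf] := boolP (well_formedb x); last first.
  rewrite qbf_value_false => [|W].
    by split=> // -[/well_formedP wf]; rewrite wf in nwf.
  by rewrite /holdsb -/(truth _ _ _) truth_matrix (negPf nwf).
have ny : n <= size x by apply: index_size.
rewrite -[den _ _ t_rounds]/(size x * (size x + 1)) addn1.
rewrite (@qbf_savitch (size x) n ny (@bit_adj x n) (bit_threshold x n)%:Z%R _
  (fun u => nth false x (source_offset n + u)) (fun u => nth false x (target_offset n + u)) _ (size x) 0 [::]) //.
  have e0 ph off : endset (size x) n ph (fun u => nth false x (off + u)) 0 [::] =
      [set u : 'I_n | nth false x (off + u)] by [].
  rewrite !e0 -savitchP ?card_ord // /bits_yes.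
  by split=> [[]|] //; split=> //; apply/well_formedP.
by move=> W _; rewrite /holdsb -/(truth _ _ _) truth_matrix wf.
Qed.

Definition width (c : nat) (x : seq bool) : nat := (size x + c) ^ c.

Lemma pspace_red L : pspace L -> exists M c (h : forall x, 1 < width c x),
  forall x, dsr_tar_yes (red M (h x) x) <-> L x.
Proof.
case=> M [p Mp].
(* The summand 3 ensures that the width exceeds 1 and that tapes within the space bound fit into the
   cells between head and end. *)
have [c cp] : poly_bounded (fun m => p.[m]%R + 3).
  by apply: poly_bounded_add; [apply: poly_bounded_horner | apply: poly_bounded_const].
have h x : 1 < width c x by have := cp (size x); rewrite /width; lia.
exists M, c, h => x; have [space [t [hlt acc]]] := Mp x I.
rewrite -acc; apply: red_iff hlt => t' i.
have le : tape_space ((run M x t').2 i) <= p.[size x]%R.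
  by apply: leq_trans (space t'); rewrite /space_used (bigD1 i) //= leq_addr.
by have := cp (size x); rewrite -/(width c x); move: le; rewrite /tape_space; lia.
Qed.

Lemma runs_red M c (h : forall x, 1 < width c x) r q : r < q ->
  exists2 f, poly_bounded f & forall m s, size (s r) <= m ->
    (forall i, i <= r -> size (s i) <= m) -> (forall i, q <= i -> s i = [::]) ->
    runs (printer q (red_threshold M r c) (red_out M r c)) s (f m)
      (upd s q (encode (red M (h (s r)) (s r)))).
Proof.
move=> rq; have [f pf cf] := runs_printer rq (red_threshold_ok M c 0 (ltnSn r)) (red_out_ok M c (ltnSn r)).
exists f => // m s _ sm s0.
rewrite -(@red_printed M r c s (h (s r))); apply: cf.
by split=> // i lt; apply: sm.
Qed.

(** The first program leaves its instance on stack 1, where the second reads it. The intermediate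
    instance has polynomial length because time bounds height. *)
Lemma red_red_computable M1 c1 (h1 : forall x, 1 < width c1 x) M2 c2 (h2 : forall x, 1 < width c2 x) :
  polytime_computable (fun x => let y := encode (red M1 (h1 x) x) in encode (red M2 (h2 y) y)).
Proof.
have [f pf cf] := @runs_red M1 c1 h1 0 1 isT; have [g pg cg] := @runs_red M2 c2 h2 1 2 isT.
pose T m := f m + g (m + f m) + 1.
apply: (@polytime_program (printer 1 (red_threshold M1 0 c1) (red_out M1 0 c1) ;;
  printer 2 (red_threshold M2 1 c2) (red_out M2 1 c2))%C 2 _ T).
  apply: poly_bounded_add; last exact: poly_bounded_const.
  apply: poly_bounded_add => //; apply: (@poly_bounded_comp g (fun m => m + f m)) => //.
  by apply: poly_bounded_add => //; apply: poly_bounded_id.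
move=> x; set y := encode (red M1 (h1 x) x).
have i0 : input_stacks x 0 = x by [].
have r1 := cf (size x) (input_stacks x).
have {r1} := r1 _ _ _; rewrite i0 -/y => r1.
have {}r1 : runs (printer 1 (red_threshold M1 0 c1) (red_out M1 0 c1)) (input_stacks x) (f (size x))
    (upd (input_stacks x) 1 y).
  by apply: r1 => // [[]|[|i]].
have ysz i : i <= 1 -> size (upd (input_stacks x) 1 y i) <= size x + f (size x).
  case: r1 => n0 le ev1 _.
  have [_ /(_ i)] := @ev_bounded _ _ _ _ (size x) ev1 (fun j => ltac:(by rewrite /input_stacks updE; case: ifP)).
  by move/leq_trans; apply; rewrite leq_add2l.
have r2 := cg (size x + f (size x)) (upd (input_stacks x) 1 y) (ysz 1 isT) ysz.
exists (upd (upd (input_stacks x) 1 y) 2 (encode (red M2 (h2 y) y))); last by rewrite upd_same.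
apply: runs_seq r1 (r2 _) _; last by rewrite /T addn1.
by case=> [|[|i]].
Qed.

Theorem theorem18 :
  exists c : nat,
    pspace_complete DSR_TAR /\
    pspace_complete_on
      (encodings (fun I => [/\ planar (@adj I), max_degree (@adj I) = 6
                             & bandwidth (@adj I) <= c]))
      DSR_TAR.
Proof.
(* [M0] decides the reconfiguration problem itself; its alphabet fixes the constant once and for
   all. *)
have [M0 [c0 [h0 red0]]] := pspace_red DSR_TAR_pspace.
exists (red_bandwidth M0).
have hard : pspace_hard_on (encodings (fun I => [/\ planar (@adj I), max_degree (@adj I) = 6
    & bandwidth (@adj I) <= red_bandwidth M0])) DSR_TAR.
  move=> L /pspace_red[M [c [h redL]]].
  (* The bandwidth of the first instance depends on the machine for [L]; the second reduction,
     always made from [M0], brings it under the common constant. *)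
  exists (fun x => let y := encode (red M (h x) x) in encode (red M0 (h0 y) y)); split.
    exact: red_red_computable.
  move=> x /=; set y := encode (red M (h x) x); split.
    by exists (red M0 (h0 y) y); split=> //; apply: red_shape.
  by rewrite DSR_TAR_encode red0 DSR_TAR_encode redL.
have [M [p pM]] := DSR_TAR_pspace.
split; split=> //.
- exact: DSR_TAR_pspace.
- move=> L /hard[f [pf fL]]; exists f; split=> // x; split=> //; exact: (fL x).2.
- by exists M, p => x _; apply: pM.
Qed.
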